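(* Let $(X,d)$ be a compact metric space, let $(\Omega,\mathscr F,\mathbb P)$ be a Bernoulli product probability space, and let $f:\Omega\times X\to X$ be a mostly contracting random map. Then there exists $q<1$ such that for every $x\in X$ and for $\mathbb P$-a.e. $\omega\in\Omega$, there exist a neighborhood $B$ of $x$ and a constant $C>0$ such that $$\operatorname{diam} f^n_\omega(B)\le C q^n\qquad\text{for all } n\ge 1.$$
   Context: Bernoulli product space: $(\Omega,\mathscr F,\mathbb P)=(T^{\mathbb N},\mathscr A^{\mathbb N},p^{\mathbb N})$ for a probability space $(T,\mathscr A,p)$. A (Bernoulli) random map is a measurable $f:\Omega\times X\to X$ such that $f_\omega:=f(\omega,\cdot)=f_{\omega_0}$ depends only on $\omega_0$ for $\mathbb P$-a.e. $\omega=(\omega_i)_{i\ge0}$. Put $f^0_\omega=\mathrm{id}$ and $f^n_\omega=f_{\omega_{n-1}}\circ\cdots\circ f_{\omega_0}$. A Borel probability measure $\mu$ on $X$ is $f$-stationary if $\mathbb P\times\mu$ is invariant under the skew product $F(\omega,x)=(\sigma\omega,f_\omega(x))$, where $\sigma$ is the shift. For a Lipschitz map $g:X\to X$, $\mathrm{Lip}(g)$ is its Lipschitz constant and the local Lipschitz constant at $z$ is $Lg(z)=\lim_{r\to0^+}\mathrm{Lip}(g|_{B(z,r)})$. The random map $f$ is Lipschitz if $\mathrm{Lip}(f_\omega)<\infty$ for $\mathbb P$-a.e. $\omega$. A Lipschitz random map $f$ is mostly contracting if $\int\log^+\mathrm{Lip}(f_\omega)\,d\mathbb P<\infty$ and $$\lambda(f):=\sup\{\lambda(\mu):\mu\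 f\text{-stationary}\}<0,\qquad \lambda(\mu):=\lim_{n\to\infty}\frac1n\int\log Lf^n_\omega(x)\,d\mathbb P\,d\mu\in[-\infty,\infty).$$ $\operatorname{diam}A=\sup\{d(x,y):x,y\in A\}$. *)

(* Defs.v *)
From HB Require Import structures.
From mathcomp Require Export all_boot all_order all_algebra.
From mathcomp Require Export all_classical all_reals all_analysis.

Set Implicit Arguments.
Unset Strict Implicit.
Unset Printing Implicit Defensive.

Import Order.TTheory GRing.Theory Num.Theory.

Local Open Scope classical_set_scope.
Local Open Scope ring_scope.
Local Open Scope ereal_scope.

(* [Pointed] is needed because every [measurableType] is pointed. *)
#[short(type="pointedMetricType")]
HB.structure Definition PointedMetric (R : numDomainType) :=
  {X of Metric R X & Pointed X}.

Section Lipschitz.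
Context {R : realType} {X : metricType R}.
Implicit Types (g : X -> X) (A : set X).

(* The least K >= 0 such that d(g x, g y) <= K d(x, y) for all x, y in A, and
   +oo if there is none. *)
Definition Lip_on A g : \bar R :=
  ereal_inf [set K%:E | K in [set K : R | (0 <= K)%R /\
    forall x y, A x -> A y -> (mdist (g x) (g y) <= K * mdist x y)%R]].

Definition Lip g : \bar R := Lip_on setT g.

(* The function of r is nondecreasing and nonnegative, so the limit exists. *)
Definition local_Lip g (z : X) : \bar R :=
  lim (Lip_on (ball z r) g @[r --> 0%R^'+]).

Definition diam A : \bar R :=
  ereal_sup [set (mdist p.1 p.2)%:E | p in A `*` A].

End Lipschitz.

Definition borel {R : realType} (X : pointedMetricType R) :=
  g_sigma_algebraType (@open X).

Section BernoulliSpace.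
Context {d : measure_display} (T : measurableType d).

Definition coordinate_events : set (set (nat -> T)) :=
  [set A | exists i (B : set T), measurable B /\ A = [set w | B (w i)]].

(* T^N with the product sigma-algebra. *)
Definition sequences_in := g_sigma_algebraType coordinate_events.

Definition seq_shift (k : nat) (w : sequences_in) : sequences_in :=
  fun i => w (k + i)%N.

(* P is the product measure p^N: by the pi-lambda theorem its values on the
   cylinders determine it. *)
Definition is_bernoulli {R : realType} (p : probability T R)
    (P : probability sequences_in R) : Prop :=
  forall (n : nat) (A : nat -> set T), (forall i, measurable (A i)) ->
    P [set w | forall i, (i < n)%N -> A i (w i)] = \prod_(i < n) p (A i).

End BernoulliSpace.

Section RandomMap.
Context {d : measure_display} {T : measurableType d} {R : realType}
  {X : pointedMetricType R}.
Variable P : probability (sequences_in T) R.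
Implicit Types (f : sequences_in T -> X -> X) (mu : probability (borel X) R).

Definition random_map f : Prop :=
  measurable_fun setT
    (fun wx : sequences_in T * borel X => f wx.1 wx.2 : borel X) /\
  exists g : T -> X -> X, {ae P, forall w, f w = g (w 0%N)}.

(* For a random map, f (seq_shift i w) is a.s. the map f_{w_i} attached to the
   symbol w_i, so this is f_{w_(n-1)} o ... o f_{w_0}. *)
Fixpoint iterate f (n : nat) (w : sequences_in T) : X -> X :=
  if n is m.+1 then f (seq_shift m w) \o iterate f m w else id.

Definition skew_product f (wx : sequences_in T * borel X) :
    sequences_in T * borel X :=
  (seq_shift 1 wx.1, f wx.1 wx.2).

Definition stationary f mu : Prop :=
  forall A : set (sequences_in T * borel X), measurable A ->
    (P \x mu) (skew_product f @^-1` A) = (P \x mu) A.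

Definition lyapunov f mu : \bar R :=
  limn (fun n : nat => (n%:R^-1)%:E *
    \int[P \x mu]_wx lne (local_Lip (iterate f n wx.1) wx.2)).

Definition max_lyapunov f : \bar R :=
  ereal_sup [set lyapunov f mu | mu in [set mu | stationary f mu]].

Definition mostly_contracting f : Prop :=
  [/\ random_map f,
      {ae P, forall w, Lip (f w) < +oo},
      \int[P]_w maxe (lne (Lip (f w))) 0 < +oo
    & max_lyapunov f < 0].

End RandomMap.

(* Main.v *)
(* Off a null set the map may be replaced by one that depends on w_0 alone and is
   everywhere Lipschitz.  If for no n the mean of log L f^n were at most - c n
   uniformly in x, then averaging the orbits of bad starting points x_n along an
   ultrafilter would give, by the Riesz representation theorem, a stationary
   measure of exponent at least - c; so max_lyapunov < 0 yields a block length m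
   with a uniformly negative mean.  By compactness the same holds for the Lipschitz
   constant of f^m on all balls of one radius r.  Capping the block logarithms from
   above makes them bounded, so that exponential moments decay geometrically
   along the random orbit, whence an almost sure linear drift; the excess over the
   cap is an i.i.d. sequence of small mean, controlled by the maximal ergodic
   argument.  Hence block products decay exponentially, and a ball small enough
   never leaves the balls of radius r around the orbit of x. *)

From HB Require Import structures.
Require Import Defs.
From mathcomp Require Import ring lra zify measurable_realfun.
Set Implicit Arguments.
Unset Strict Implicit.
Unset Printing Implicit Defensive.
Import Order.TTheory GRing.Theory Num.Theory.
Import numFieldNormedType.Exports.
Local Open Scope classical_set_scope.
Local Open Scope ring_scope.

(** * The Riesz representation theorem on a compact metric space *)

(** Since [L f^n] may vanish, its logarithm need not be integrable from below; all means are
    therefore taken of [tlog a], the logarithm cut off at [-a]. The chain rule adds the cut-offs of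
    its factors, so levels have to grow with time. The level n * n at time n amounts to n per step
    and eventually exceeds any fixed M per step; this allows the cut-off to be removed at the limit
    measure, by monotone convergence. A truncated mean is only upper semicontinuous in x, so lower
    bounds reach the limit measure through continuous majorants. Conditioning on the past is done by
    [splice]: the first k symbols of one sequence glued to an independent second sequence have law P
    again, and Fubini does the rest. The cap is forced because [log^+ Lip] is assumed integrable
    only, without exponential moments. If a block has mean at most -c, the capped sums keep a drift
    c / 4 per block and the excess costs c / 16; of the remainder, c / 8 is kept, and half of that
    pays for the incomplete last block. *)

Section ContinuousReal.
Context {R : realType} {X : metricType R}.
Implicit Types f g : X -> R.

Lemma lipschitz_continuous f (K : R) :
  (forall x y, f x - f y <= K * mdist x y) -> continuous f.
Proof.
move=> fK x; apply/cvgrPdist_lt => e e0.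
have K1 : 0 < `|K| + 1 by rewrite ltr_wpDl.
have : nbhs x (ball x (e / (`|K| + 1))) by apply: nbhsx_ballx; rewrite divr_gt0.
apply: filterS => y; rewrite ballEmdist /= ltr_pdivlMr// => xy.
apply: le_lt_trans xy; rewrite ler_norml.
have Kd : K * mdist x y <= mdist x y * (`|K| + 1).
  rewrite mulrC ler_wpM2l ?mdist_ge0// (le_trans (ler_norm K))// lerDl//.
have h1 := fK x y; have h2 := fK y x; rewrite metric_sym in h2.
by apply/andP; split; lra.
Qed.

Lemma continuous_funD f g : continuous f -> continuous g ->
  continuous (fun x => f x + g x).
Proof. by move=> cf cg x; apply: cvgD; [exact: cf|exact: cg]. Qed.

Lemma continuous_funZ f (a : R) : continuous f -> continuous (fun x => a * f x).
Proof. by move=> cf x; apply: cvgM; [exact: cvg_cst|exact: cf]. Qed.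

Lemma continuous_fun_max f g : continuous f -> continuous g ->
  continuous (fun x => Num.max (f x) (g x)).
Proof. by move=> cf cg x; apply: continuous_max; [exact: cf|exact: cg]. Qed.

Lemma continuous_fun_min f g : continuous f -> continuous g ->
  continuous (fun x => Num.min (f x) (g x)).
Proof. by move=> cf cg x; apply: continuous_min; [exact: cf|exact: cg]. Qed.

Lemma continuous_fun_cst (a : R) : continuous (fun _ : X => a).
Proof. by move=> x; exact: cvg_cst. Qed.

Lemma continuous_fun_sum (F : nat -> X -> R) n :
  (forall i, continuous (F i)) -> continuous (fun x => \sum_(i < n) F i x).
Proof.
move=> cF; elim: n => [|n ih].
  by under eq_fun do rewrite big_ord0; exact: continuous_fun_cst.
by under eq_fun do rewrite big_ord_recr; exact: continuous_funD.
Qed.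

Lemma open_sub_ball (U : set X) x : open U -> U x ->
  exists2 r : R, 0 < r & ball x r `<=` U.
Proof.
by move=> oU Ux; have /nbhs_ballP[r /= r0 rU] := open_nbhs_nbhs (conj oU Ux);
  exists r.
Qed.

(* The distance to the complement of U, cut off at 1. *)
Definition depth (U : set X) (x : X) : R :=
  sup [set r | 0 <= r <= 1 /\ ball x r `<=` U].

Let depth_sup (U : set X) x : has_sup [set r : R | 0 <= r <= 1 /\ ball x r `<=` U].
Proof.
split; last by exists 1 => r /= [/andP[]].
by exists 0; split; [rewrite lexx ler01|move=> y; rewrite ballEmdist /= ltNge mdist_ge0].
Qed.

Lemma depth_ge0 U x : 0 <= depth U x.
Proof.
apply: ub_le_sup; first exact: (depth_sup U x).2.
by split; [rewrite lexx ler01|move=> y; rewrite ballEmdist /= ltNge mdist_ge0].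
Qed.

Lemma depth_gt0 U x : open U -> U x -> 0 < depth U x.
Proof.
move=> oU Ux; have [r r0 rU] := open_sub_ball oU Ux.
have m0 : 0 < Num.min r 1 by rewrite lt_min r0 ltr01.
apply: (lt_le_trans m0); apply: ub_le_sup; first exact: (depth_sup U x).2.
split; first by rewrite (ltW m0) ge_min lexx orbT.
by apply: subset_trans rU; apply: le_ball; rewrite ge_min lexx.
Qed.

Lemma depth_out U x : ~ U x -> depth U x = 0.
Proof.
move=> Ux; apply/eqP; rewrite eq_le depth_ge0 andbT.
apply: ge_sup; first exact: (depth_sup U x).1.
move=> r [/andP[r0 _] rU]; rewrite leNgt; apply/negP => r0'.
by apply: Ux; apply: rU; apply: ballxx.
Qed.

Lemma depth_lip U x y : depth U x - depth U y <= 1 * mdist x y.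
Proof.
rewrite mul1r lerBlDr; apply: ge_sup; first exact: (depth_sup U x).1.
move=> r [/andP[r0 r1] rU]; rewrite -lerBlDl.
have [rd|rd] := leP (r - mdist x y) 0; first exact: le_trans (depth_ge0 _ _).
apply: ub_le_sup; first exact: (depth_sup U y).2.
split; first by rewrite (ltW rd)/= lerBlDr (le_trans r1)// lerDl mdist_ge0.
move=> z; rewrite ballEmdist /= => yz; apply: rU; rewrite ballEmdist /=.
by have := metric_triangle x y z; lra.
Qed.

Lemma depth_continuous U : continuous (depth U).
Proof. exact: lipschitz_continuous (depth_lip U). Qed.

(** For open U these increase with k to the indicator of U, and they equal 1 from some k on wherever
    the depth is bounded below by a positive constant. *)
Definition bump (U : set X) (k : nat) (x : X) : R := Num.min 1 (k%:R * depth U x).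

Lemma bump_continuous U k : continuous (bump U k).
Proof.
apply: continuous_fun_min; first exact: continuous_fun_cst.
exact/continuous_funZ/depth_continuous.
Qed.

Lemma bump_ge0 U k x : 0 <= bump U k x.
Proof. by rewrite le_min ler01 mulr_ge0// depth_ge0. Qed.

Lemma bump_le1 U k x : bump U k x <= 1.
Proof. by rewrite ge_min lexx. Qed.

Lemma bump_out U k x : ~ U x -> bump U k x = 0.
Proof. by move=> Ux; rewrite /bump depth_out// mulr0; apply/min_idPr. Qed.

Lemma bump_in U x : open U -> U x -> \forall k \near \oo, bump U k x = 1.
Proof.
move=> oU Ux; have d0 := depth_gt0 oU Ux.
near=> k; apply/min_idPl; rewrite -ler_pdivrMr//.
by near: k; exact: nbhs_infty_ger.
Unshelve. all: by end_near. Qed.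

End ContinuousReal.

(** * The outer measure of a positive normalized functional *)

Section Riesz.
Context {R : realType} {X : pointedMetricType R}.
Hypothesis cX : compact [set: X].
Variable Lam : (X -> R) -> R.
Hypothesis LamD : forall f g : X -> R, continuous f -> continuous g ->
  Lam (fun x => f x + g x) = Lam f + Lam g.
Hypothesis LamZ : forall (a : R) (f : X -> R), continuous f ->
  Lam (fun x => a * f x) = a * Lam f.
Hypothesis Lam_ge0 : forall f : X -> R, continuous f ->
  (forall x, 0 <= f x) -> 0 <= Lam f.
Hypothesis Lam1 : Lam (fun _ => 1) = 1.

Lemma Lam_cst a : Lam (fun _ => a) = a.
Proof.
rewrite -[RHS]mulr1 -Lam1 -LamZ; last exact: continuous_fun_cst.
by under [in RHS]eq_fun do rewrite mulr1.
Qed.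

Lemma Lam_le (f g : X -> R) : continuous f -> continuous g ->
  (forall x, f x <= g x) -> Lam f <= Lam g.
Proof.
move=> cf cg fg; have cf' : continuous (fun x => -1 * f x) by exact: continuous_funZ.
rewrite -subr_ge0 -mulN1r -LamZ// -LamD//; apply: Lam_ge0.
  exact: continuous_funD.
by move=> x; rewrite mulN1r subr_ge0.
Qed.

Lemma Lam_sum (F : nat -> X -> R) n : (forall i, continuous (F i)) ->
  Lam (fun x => \sum_(i < n) F i x) = \sum_(i < n) Lam (F i).
Proof.
move=> cF; elim: n => [|n ih].
  by under eq_fun do rewrite big_ord0; rewrite Lam_cst big_ord0.
under eq_fun do rewrite big_ord_recr; rewrite LamD// ?ih ?big_ord_recr//.
exact: continuous_fun_sum.
Qed.

Local Open Scope ereal_scope.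

(** Vanishing off U replaces the usual compact support inside U: the sets where f >= e > 0 are
    closed in a compact space, and the part of f below e costs at most e. *)
Definition test_function (U : set X) (f : X -> R) : Prop :=
  [/\ continuous f, (forall x, 0 <= f x <= 1)%R & forall x, ~ U x -> f x = 0%R].

Definition open_content (U : set X) : \bar R :=
  ereal_sup [set (Lam f)%:E | f in [set f | test_function U f]].

Definition riesz_outer (A : set X) : \bar R :=
  ereal_inf [set open_content U | U in [set U | open U /\ A `<=` U]].

Lemma test_function0 U : test_function U (fun _ => 0%R).
Proof.
by split=> // [|x]; [exact: continuous_fun_cst|rewrite lexx ler01].
Qed.

Lemma open_content_ub U f : test_function U f -> (Lam f)%:E <= open_content U.
Proof. by move=> tf; apply: ereal_sup_ubound; exists f. Qed.

Lemma open_content_ge0 U : 0 <= open_content U.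
Proof.
by apply: (le_trans _ (open_content_ub (test_function0 U))); rewrite Lam_cst.
Qed.

Lemma open_content_le1 U : open_content U <= 1.
Proof.
apply: ge_ereal_sup => _ [f [cf f01 _] <-]; rewrite lee_fin -Lam1.
apply: Lam_le => // [|x]; first exact: continuous_fun_cst.
by have /andP[] := f01 x.
Qed.

Lemma le_open_content U V : U `<=` V -> open_content U <= open_content V.
Proof.
move=> UV; apply: ge_ereal_sup => _ [f [cf f01 f0] <-].
by apply: open_content_ub; split => // x Vx; apply: f0 => Ux; apply/Vx/UV.
Qed.

Lemma open_contentT : open_content setT = 1.
Proof.
apply/eqP; rewrite eq_le open_content_le1 -[1]/(1%:E) -Lam1.
apply: open_content_ub; split => [|x|x /(_ I)//]; first exact: continuous_fun_cst.
by rewrite ler01 lexx.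
Qed.

Lemma riesz_outer_open U : open U -> riesz_outer U = open_content U.
Proof.
move=> oU; apply/eqP; rewrite eq_le; apply/andP; split.
  by apply: ereal_inf_lbound; exists U => //; split.
by apply: le_ereal_inf_tmp => _ [V [oV UV] <-]; exact: le_open_content.
Qed.

Lemma le_riesz_outer A B : A `<=` B -> riesz_outer A <= riesz_outer B.
Proof.
move=> AB; apply: le_ereal_inf_tmp => _ [V [oV BV] <-].
by apply: ereal_inf_lbound; exists V => //; split => //; exact: subset_trans BV.
Qed.

Lemma riesz_outer_ge0 A : 0 <= riesz_outer A.
Proof. by apply: le_ereal_inf_tmp => _ [V _ <-]; exact: open_content_ge0. Qed.

Lemma riesz_outer_le1 A : riesz_outer A <= 1.
Proof.
rewrite -open_contentT; apply: ereal_inf_lbound; exists setT => //.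
by split => //; exact: openT.
Qed.

Lemma riesz_outer_fin A : riesz_outer A \is a fin_num.
Proof.
by rewrite ge0_fin_numE ?riesz_outer_ge0// (le_lt_trans (riesz_outer_le1 A))// ltry.
Qed.

Lemma riesz_outer0 : riesz_outer set0 = 0.
Proof.
rewrite riesz_outer_open; last exact: open0.
apply/eqP; rewrite eq_le open_content_ge0 andbT.
apply: ge_ereal_sup => _ [f [cf f01 f0] <-].
have -> : f = (fun _ => 0%R) by apply/funext => x; exact: f0.
by rewrite Lam_cst.
Qed.

Lemma closed_superlevel (f : X -> R) (e : R) : continuous f ->
  closed [set x | (e <= f x)%R].
Proof.
move=> cf; have := @closed_ge R e.
by move=> /(closed_comp (fun x _ => cf x)); apply.
Qed.

Lemma open_superlevel (f : X -> R) (e : R) : continuous f ->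
  open [set x | (e < f x)%R].
Proof. by move=> cf; have /(open_comp (fun x _ => cf x)) := @open_gt R e. Qed.

Lemma open_sublevel (f : X -> R) (e : R) : continuous f ->
  open [set x | (f x < e)%R].
Proof. by move=> cf; have /(open_comp (fun x _ => cf x)) := @open_lt R e. Qed.

(** A test function of the union is, up to e, dominated by finitely many bumps of the sets U i,
    because the set K where it is at least e is compact. *)
Lemma open_content_subadditive (U : (set X)^nat) : (forall i, open (U i)) ->
  open_content (\bigcup_i U i) <= \sum_(i <oo) open_content (U i).
Proof.
move=> oU; apply: ge_ereal_sup => _ [f [cf f01 f0] <-].
apply/lee_addgt0Pr => e e0.
pose K := [set x | (e <= f x)%R].
have cK : compact K.
  by apply: subclosed_compact cX _ => //; exact: closed_superlevel.
(* One n serves both as the number of sets used and as the steepness of their bumps; near x it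
   suffices that n exceeds i and the inverse of half the depth of x. *)
have [n _ nK] : \forall n \near \oo, K `<=` (fun x => exists2 i, (i < n)%N &
    bump (U i) n x = 1%R).
  move/compact_near_coveringP : cK; apply => x Kx.
  have [i _ Uix] : (\bigcup_i U i) x.
    apply: contrapT => /f0 fx0; move: Kx; rewrite /K/= fx0.
    by rewrite leNgt e0.
  have d0 := depth_gt0 (oU i) Uix.
  have : \forall x' \near x & n \near \oo,
      (depth (U i) x / 2 < depth (U i) x')%R /\
      ((i < n)%N /\ ((depth (U i) x / 2)^-1 <= n%:R)%R).
    exists ([set x' | (depth (U i) x / 2 < depth (U i) x')%R],
            [set n | (i < n)%N /\ ((depth (U i) x / 2)^-1 <= n%:R)%R]) => //=.
    split.
      apply: open_nbhs_nbhs; split; first exact/open_superlevel/depth_continuous.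
      by rewrite /=; lra.
    near=> n; split; near: n; first by exists i.+1.
    exact: nbhs_infty_ger.
  apply: filterS => -[x' k]/= [h1 [h2 h3]]; exists i => //.
  apply/min_idPl.
  have h : (0 < depth (U i) x / 2)%R by rewrite divr_gt0.
  apply: (@le_trans _ _ ((depth (U i) x / 2)^-1 * (depth (U i) x / 2))%R).
    by rewrite mulVf ?gt_eqF.
  apply: ler_pM; [by rewrite invr_ge0 ltW|exact: ltW|exact: h3|exact: ltW].
have {}nK := nK n (leqnn n).
apply: (@le_trans _ _ (\sum_(i < n) (Lam (bump (U i) n))%:E + e%:E)).
  rewrite sumEFin -EFinD lee_fin -(Lam_sum (F := fun i => bump (U i) n)); last first.
    by move=> i; exact: bump_continuous.
  rewrite -[X in (_ <= _ + X)%R]Lam_cst -LamD; last 2 first.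
  - by apply: (continuous_fun_sum (F := fun i => bump (U i) n)) => i; exact: bump_continuous.
  - exact: continuous_fun_cst.
  apply: Lam_le => // [|x].
    apply: continuous_funD; last exact: continuous_fun_cst.
    by apply: (continuous_fun_sum (F := fun i => bump (U i) n)) => i; exact: bump_continuous.
  have s0 : (0 <= \sum_(i < n) bump (U i) n x)%R.
    by apply: sumr_ge0 => i _; exact: bump_ge0.
  have [fe|fe] := leP e (f x); last first.
    by rewrite (le_trans (ltW fe))// lerDr.
  have [i lin bi] := nK x fe.
  apply: (@le_trans _ _ 1%R); first by have /andP[] := f01 x.
  rewrite ler_wpDr ?(ltW e0)// (bigD1 (Ordinal lin))//= bi lerDl.
  by apply: sumr_ge0 => j _; exact: bump_ge0.
rewrite leeD2r//; apply: (@le_trans _ _ (\sum_(i < n) open_content (U i))).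
  apply: lee_sum => i _; apply: open_content_ub; split.
  - exact: bump_continuous.
  - by move=> x; rewrite bump_ge0 bump_le1.
  - by move=> x; exact: bump_out.
rewrite -(big_mkord xpredT (fun i => open_content (U i))).
by apply: nneseries_lim_ge => i _ _; exact: open_content_ge0.
Unshelve. all: by end_near. Qed.

Lemma riesz_outer_approx A (e : R) : (0 < e)%R ->
  exists U, [/\ open U, A `<=` U & open_content U <= riesz_outer A + e%:E].
Proof.
move=> e0; have := lb_ereal_inf_adherent e0 (riesz_outer_fin A).
by move=> [_ [U [oU AU] <-] /ltW Ue]; exists U.
Qed.

Lemma riesz_outer_sigma_subadditive : sigma_subadditive riesz_outer.
Proof.
move=> F; apply/lee_addgt0Pr => e e0.
have h i : exists U, [/\ open U, F i `<=` U &
    open_content U <= riesz_outer (F i) + (e / (2 ^ i.+1)%:R)%:E].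
  by apply: riesz_outer_approx; rewrite divr_gt0// ltr0n expn_gt0.
have [U hU] := choice h.
have et := @epsilon_trick R (fun i => riesz_outer (F i)) e xpredT
  (fun i => riesz_outer_ge0 (F i)) (ltW e0).
apply: le_trans et.
apply: (@le_trans _ _ (open_content (\bigcup_i U i))).
  rewrite -riesz_outer_open; last first.
    by apply: bigcup_open => i _; case: (hU i).
  by apply: le_riesz_outer; apply: subset_bigcup => i _; case: (hU i).
apply: le_trans (open_content_subadditive _) _.
  by move=> i; case: (hU i).
by apply: lee_nneseries => i *; [exact: open_content_ge0|case: (hU i)].
Qed.

Definition riesz_outer_measure : {outer_measure set X -> \bar R} :=
  HB.pack riesz_outer (isOuterMeasure.Build R X riesz_outer riesz_outer0
    riesz_outer_ge0 le_riesz_outer riesz_outer_sigma_subadditive).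

(** Inside an open V containing A, take a nearly optimal f for V [&] U, then a nearly optimal g for
    the part W of V where f is small. W contains A minus U, because f vanishes off U, and f + g is
    almost a test function of V. *)
Lemma open_caratheodory (U : set X) : open U ->
  caratheodory_measurable riesz_outer_measure U.
Proof.
move=> oU; apply: le_caratheodory_measurable => A /=.
apply/lee_addgt0Pr => e e0.
have e40 : (0 < e / 4)%R by rewrite divr_gt0.
have [V [oV AV Ve]] := riesz_outer_approx A e40.
apply: (@le_trans _ _ (open_content V + (3 * (e / 4))%:E)); last first.
  apply: (le_trans (leeD2r _ Ve)); rewrite -addeA -EFinD leeD2l// lee_fin.
  by lra.
have fnu W : open_content W \is a fin_num.
  by rewrite ge0_fin_numE ?open_content_ge0// (le_lt_trans (open_content_le1 W))// ltry.
have [_ [f [cf f01 f0] <-] fVU] := ub_ereal_sup_adherent e40 (fnu (V `&` U)).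
pose W := V `&` [set x | (f x < e / 4)%R].
have oW : open W by apply: openI => //; exact: open_sublevel.
have [_ [g [cg g01 g0] <-] gW] := ub_ereal_sup_adherent e40 (fnu W).
have AVU : riesz_outer (A `&` U) <= open_content (V `&` U).
  apply: ereal_inf_lbound; exists (V `&` U) => //.
  by split; [exact: openI|exact: setSI].
have AW : riesz_outer (A `&` ~` U) <= open_content W.
  apply: ereal_inf_lbound; exists W => //; split => // x [Ax Ux].
  split; first exact: AV.
  by rewrite /= f0// => -[].
apply: le_trans (leeD AVU AW) _.
have -> : open_content (V `&` U) = (fine (open_content (V `&` U)))%:E by rewrite fineK.
have -> : open_content W = (fine (open_content W))%:E by rewrite fineK.
have -> : open_content V = (fine (open_content V))%:E by rewrite fineK.
rewrite -!EFinD lee_fin.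
rewrite -/(open_content _) in fVU; rewrite -/(open_content _) in gW.
move: fVU gW; rewrite -[in X in X -> _](fineK (fnu (V `&` U))).
rewrite -[in X in _ -> X -> _](fineK (fnu W)) -!EFinB !lte_fin => fVU gW.
set a := fine (open_content (V `&` U)) in fVU *.
set b := fine (open_content W) in gW *.
have c1 : (0 < 1 + e / 4)%R by rewrite addr_gt0.
(* Where f < e / 4 the sum is at most 1 + e / 4, and elsewhere g vanishes, so the factor brings f +
   g below 1. *)
have tfg : test_function V (fun x => (1 + e / 4)^-1 * (f x + g x))%R.
  split.
  - exact/continuous_funZ/continuous_funD.
  - move=> x; have /andP[fx0 fx1] := f01 x; have /andP[gx0 gx1] := g01 x.
    rewrite mulr_ge0 ?invr_ge0 ?(ltW c1) ?addr_ge0//=.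
    rewrite mulrC ler_pdivrMr// mul1r.
    have [fe|fe] := ltP (f x) (e / 4)%R; first by lra.
    by rewrite g0; [lra|move=> [_ /=]; rewrite ltNge fe].
  - by move=> x Vx; rewrite f0 ?g0 ?addr0 ?mulr0// => -[].
have := open_content_ub tfg; rewrite -(fineK (fnu V)) lee_fin LamZ; last exact: continuous_funD.
rewrite LamD// mulrC ler_pdivrMr//.
set v := fine (open_content V) => hv.
have v1 : (v <= 1)%R by rewrite -lee_fin fineK// open_content_le1.
have ve : (v * (1 + e / 4) <= v + e / 4)%R.
  by rewrite mulrDr mulr1 lerD2l ler_piMl// ltW.
by rewrite /=; lra.
Qed.

Lemma borel_caratheodory (A : set (borel X)) : measurable A ->
  caratheodory_measurable riesz_outer_measure (A : set X).
Proof.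
move=> mA.
suff : <<s (@open X) >> `<=` caratheodory_measurable riesz_outer_measure.
  exact.
apply: smallest_sub; last exact: open_caratheodory.
split; first exact: caratheodory_measurable_set0.
  by move=> B mB; rewrite setTD; exact: caratheodory_measurable_setC.
by move=> F mF; exact: caratheodory_measurable_bigcup.
Qed.

(** The same values as the outer measure, retyped on [borel X] to carry the measure structure. *)
Definition riesz_fun (A : set (borel X)) : \bar R := riesz_outer (A : set X).

Lemma riesz_fun0 : riesz_fun set0 = 0.
Proof. exact: riesz_outer0. Qed.

Lemma riesz_fun_ge0 A : 0 <= riesz_fun A.
Proof. exact: riesz_outer_ge0. Qed.

Lemma riesz_fun_sigma_additive : semi_sigma_additive riesz_fun.
Proof.
move=> F mF tF mbF.
have := @caratheodory_measure_sigma_additive R X riesz_outer_measure F.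
by apply => // [i|]; exact: borel_caratheodory.
Qed.

HB.instance Definition _ := isMeasure.Build _ (borel X) R riesz_fun
  riesz_fun0 riesz_fun_ge0 riesz_fun_sigma_additive.

Lemma riesz_funT : riesz_fun setT = 1.
Proof. by rewrite /riesz_fun riesz_outer_open ?open_contentT//; exact: openT. Qed.

HB.instance Definition _ := Measure_isProbability.Build _ (borel X) R riesz_fun
  riesz_funT.

Definition riesz_measure : probability (borel X) R := riesz_fun.

End Riesz.

(** * Real-valued expectations under a probability *)

Section Expectation.
Context {d : measure_display} {T : measurableType d} {R : realType}.
Variable P : probability T R.
Implicit Types f g : T -> R.

Definition integ f : Prop := P.-integrable setT (EFin \o f).
Definition expect f : R := \int[P]_x f x.

Lemma integ_measurable f : integ f -> measurable_fun setT f.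
Proof. by move=> /measurable_int/measurable_EFinP. Qed.

Lemma expectE f : integ f -> (\int[P]_x (f x)%:E)%E = (expect f)%:E.
Proof. by move=> fi; rewrite /expect /Rintegral fineK// integrable_fin_num. Qed.

Lemma integ_dom f g : measurable_fun setT f -> integ g ->
  (forall x, `|f x| <= g x) -> integ f.
Proof.
move=> mf ig fg; apply: le_integrable ig => //; first exact/measurable_EFinP.
by move=> x _ /=; rewrite lee_fin (le_trans (fg x))// ler_norm.
Qed.

Lemma integ_cst (a : R) : integ (fun _ => a).
Proof. exact: (finite_measure_integrable_cst P a measurableT). Qed.

Lemma integ_bounded f (M : R) : measurable_fun setT f ->
  (forall x, `|f x| <= M) -> integ f.
Proof. by move=> mf fM; apply: integ_dom (integ_cst M) _. Qed.

Lemma integD f g : integ f -> integ g -> integ (fun x => f x + g x).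
Proof. by move=> fi gi; have := integrableD measurableT fi gi. Qed.

Lemma integZ (a : R) f : integ f -> integ (fun x => a * f x).
Proof. by move=> fi; have := integrableZl measurableT a fi. Qed.

Lemma integN f : integ f -> integ (fun x => - f x).
Proof. by move=> fi; have := integrableN fi. Qed.

Lemma integB f g : integ f -> integ g -> integ (fun x => f x - g x).
Proof. by move=> fi gi; apply: integD => //; exact: integN. Qed.

Lemma integ_norm f : integ f -> integ (fun x => `|f x|).
Proof. by move=> fi; have := integrable_norm fi. Qed.

Lemma integ_sum (F : nat -> T -> R) n : (forall i, integ (F i)) ->
  integ (fun x => \sum_(i < n) F i x).
Proof.
move=> Fi; elim: n => [|n ih].
  by under eq_fun do rewrite big_ord0; exact: integ_cst.
by under eq_fun do rewrite big_ord_recr; exact: integD.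
Qed.

Lemma integ_max f g : integ f -> integ g -> integ (fun x => Num.max (f x) (g x)).
Proof.
move=> fi gi; apply: (@integ_dom _ (fun x => `|f x| + `|g x|)).
- by apply: measurable_maxr; exact: integ_measurable.
- by apply: integD; exact: integ_norm.
- move=> x; have := normr_ge0 (f x); have := normr_ge0 (g x).
  by rewrite /Num.max; case: ifP => _; lra.
Qed.

Lemma expect_cst (a : R) : expect (fun _ => a) = a.
Proof. by rewrite /expect Rintegral_cst// [X in fine X](probability_setT P) mulr1. Qed.

Lemma expectD f g : integ f -> integ g ->
  expect (fun x => f x + g x) = expect f + expect g.
Proof. by move=> fi gi; rewrite /expect RintegralD. Qed.

Lemma expectB f g : integ f -> integ g ->
  expect (fun x => f x - g x) = expect f - expect g.
Proof. by move=> fi gi; rewrite /expect RintegralB. Qed.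

Lemma expectZ (a : R) f : integ f -> expect (fun x => a * f x) = a * expect f.
Proof. by move=> fi; rewrite /expect RintegralZl. Qed.

Lemma expect_sum (F : nat -> T -> R) n : (forall i, integ (F i)) ->
  expect (fun x => \sum_(i < n) F i x) = \sum_(i < n) expect (F i).
Proof.
move=> Fi; elim: n => [|n ih].
  by under eq_fun do rewrite big_ord0; rewrite expect_cst big_ord0.
under eq_fun do rewrite big_ord_recr; rewrite expectD// ?ih ?big_ord_recr//.
exact: integ_sum.
Qed.

Lemma expect_le f g : integ f -> integ g -> (forall x, f x <= g x) ->
  expect f <= expect g.
Proof. by move=> fi gi fg; apply: le_Rintegral => // x _; exact: fg. Qed.

Lemma expect_ge0 f : (forall x, 0 <= f x) -> 0 <= expect f.
Proof. by move=> f0; apply: Rintegral_ge0. Qed.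

Lemma expect_indic A : measurable A -> (expect (\1_A))%:E = P A.
Proof.
move=> mA; rewrite -expectE; last exact: integrable_indic.
by rewrite integral_indic// setIT.
Qed.

Lemma expect_cvg (F : nat -> T -> R) f g : (forall n, measurable_fun setT (F n)) ->
  integ g -> (forall n x, `|F n x| <= g x) -> (forall x, F ^~ x @ \oo --> f x) ->
  expect (F n) @[n --> \oo] --> expect f.
Proof.
move=> mF gi Fg Ff.
have mf : measurable_fun setT f.
  by apply: (measurable_fun_cvg mF) => x _; exact: Ff.
have [fi _ h] : [/\ P.-integrable setT (EFin \o f),
  (fun n => \int[P]_x `|(EFin \o F n) x - (EFin \o f) x|)%E @ \oo --> 0%E &
  (fun n => \int[P]_x (EFin \o F n) x)%E @ \oo --> (\int[P]_x (EFin \o f) x)%E].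
  apply: (@dominated_convergence _ T R P setT measurableT _ _ (EFin \o g)) => //.
  - by move=> n; exact/measurable_EFinP.
  - exact/measurable_EFinP.
  - by apply: aeW => x _; apply: cvg_EFin; [exact: nearW|exact: Ff].
  - by apply: aeW => x n _; rewrite /= lee_fin; exact: Fg.
rewrite /expect /Rintegral; apply: fine_cvg.
by rewrite fineK// integrable_fin_num.
Qed.

End Expectation.

Section Measurability.
Context {R : realType}.

Lemma measurable_superlevel {d : measure_display} {T : measurableType d} (f : T -> R) :
  (forall r, measurable [set x | r < f x]) -> measurable_fun setT f.
Proof.
move=> mf mT; apply: (measurability _ (RGenOInfty.measurableE R)) => //.
move=> _ [_ [r ->] <-]; rewrite setTI.
by have := mf r; congr (measurable _); apply/seteqP; split => x /=; rewrite in_itv/= andbT.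
Qed.

Context {X : pointedMetricType R}.

Lemma open_borel (U : set X) : open U -> measurable (U : set (borel X)).
Proof. by move=> oU; exact: sub_sigma_algebra. Qed.

Lemma continuous_borel (f : X -> R) : continuous f ->
  measurable_fun setT (f : borel X -> R).
Proof.
move=> cf; apply: (@measurable_superlevel _ (borel X) f) => r.
by apply: open_borel; exact: (open_comp (fun x _ => cf x) (@open_gt R r)).
Qed.

End Measurability.

Section CompactBorel.
Context {R : realType} {X : pointedMetricType R}.
Hypothesis cX : compact [set: X].

Lemma continuous_bounded (f : X -> R) : continuous f ->
  exists M : R, forall x, `|f x| <= M.
Proof.
move=> cf; have [n _ nf] : \forall n \near \oo, [set: X] `<=`
    (fun x => `|f x| <= n%:R).
  move/compact_near_coveringP : cX; apply => x _.
  have cn : continuous (fun x => `|f x|) by move=> y; apply: cvg_norm; exact: cf.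
  exists ([set x' | `|f x'| < `|f x| + 1], [set n | `|f x| + 1 <= n%:R]) => /=.
    split; last exact: nbhs_infty_ger.
    apply: open_nbhs_nbhs; split; first exact: open_sublevel.
    by rewrite /= ltrDl.
  by move=> [x' k]/= [h1 h2]; rewrite (le_trans (ltW h1)).
by exists n%:R => x; exact: (nf n (leqnn n)).
Qed.

Lemma continuous_integ (mu : probability (borel X) R) (f : X -> R) :
  continuous f -> integ mu f.
Proof.
move=> cf; have [M fM] := continuous_bounded cf.
by apply: (@integ_bounded _ _ _ mu f M) => //; exact: continuous_borel.
Qed.

Lemma bump_cvg (U : set X) (x : X) : open U ->
  bump U k x @[k --> \oo] --> (\1_U x : R).
Proof.
move=> oU; have [Ux|Ux] := pselect (U x).
  rewrite indicE mem_set//; apply: cvg_near_cst; exact: bump_in.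
rewrite indicE memNset//; apply: cvg_near_cst; apply: nearW => k.
exact: bump_out.
Qed.

(** The indicator of an open set is a bounded limit of bumps, so the two measures agree on open
    sets, which form a generating class stable under intersection. *)
Lemma borel_probability_ext (mu nu : probability (borel X) R) :
  (forall f : X -> R, continuous f -> expect mu f = expect nu f) ->
  forall A : set (borel X), measurable A -> mu A = nu A.
Proof.
move=> munu A mA.
have ind (m : probability (borel X) R) (U : set X) : open U ->
    expect m (bump U k) @[k --> \oo] --> expect m (\1_U : borel X -> R).
  move=> oU; apply: (@expect_cvg _ _ _ m _ _ (fun _ => 1)).
  - by move=> k; apply: continuous_borel; exact: bump_continuous.
  - exact: integ_cst.
  - by move=> k x; rewrite ger0_norm ?bump_ge0// bump_le1.
  - by move=> x; exact: bump_cvg.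
apply: (@measure_unique _ R (borel X) (@open X) (fun _ => setT)) => //.
- by move=> U V; exact: openI.
- by move=> _; exact: openT.
- by rewrite bigcup_const//; exists 0%N.
- move=> U oU; have mU := open_borel oU.
  apply: (etrans (esym (expect_indic mu mU))); apply: etrans (expect_indic nu mU); congr EFin.
  apply: cvg_unique (ind mu U oU) _ => //.
  have -> : (fun k => expect mu (bump U k)) = (fun k => expect nu (bump U k)).
    by apply/funext => k; apply: munu; exact: bump_continuous.
  exact: ind.
- by move=> _; rewrite (le_lt_trans (probability_le1 _ _))// ltry.
Qed.

(** Layer-cake slicing: the i-th term is the part of t lying in the unit interval starting at i. *)
Lemma sum_clamp n (t : R) : 0 <= t ->
  \sum_(i < n) Num.min 1 (Num.max 0 (t - i%:R)) = Num.min n%:R t.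
Proof.
move=> t0; elim: n => [|n ih].
  by rewrite big_ord0; apply/esym/min_idPl.
rewrite big_ord_recr ih /= -natr1.
rewrite /Num.min /Num.max.
by repeat case: ifPn; rewrite -?leNgt => *; lra.
Qed.

End CompactBorel.

Section RieszIntegral.
Context {R : realType} {X : pointedMetricType R}.
Hypothesis cX : compact [set: X].
Variable Lam : (X -> R) -> R.
Hypothesis LamD : forall f g : X -> R, continuous f -> continuous g ->
  Lam (fun x => f x + g x) = Lam f + Lam g.
Hypothesis LamZ : forall (a : R) (f : X -> R), continuous f ->
  Lam (fun x => a * f x) = a * Lam f.
Hypothesis Lam_ge0 : forall f : X -> R, continuous f ->
  (forall x, 0 <= f x) -> 0 <= Lam f.
Hypothesis Lam1 : Lam (fun _ => 1) = 1.

Let mu : probability (borel X) R := riesz_measure cX LamD LamZ Lam_ge0 Lam1.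

(** Slice n f into unit layers [phi i]. Each layer is a test function of the open set where n f > i,
    which bounds [Lam] of it by the measure of that set; the indicators of these sets add up to at
    most n f + 1. Dividing by n makes the error arbitrarily small. *)
Let unit_bound n (f : X -> R) : continuous f -> (forall x, 0 <= f x <= 1) ->
  n%:R * Lam f <= n%:R * expect mu f + 1.
Proof.
move=> cf f01.
pose phi (i : nat) (x : X) : R := Num.min 1 (Num.max 0 (n%:R * f x - i%:R)).
have cphi i : continuous (phi i).
  apply: continuous_fun_min; first exact: continuous_fun_cst.
  apply: continuous_fun_max; first exact: continuous_fun_cst.
  apply: continuous_funD; first exact: continuous_funZ.
  exact: continuous_fun_cst.
have nf : (fun x => n%:R * f x) = (fun x => \sum_(i < n) phi i x).
  apply/funext => x; have /andP[f0 f1] := f01 x.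
  rewrite /phi sum_clamp ?mulr_ge0//; apply/esym/min_idPr.
  by rewrite ler_piMr.
rewrite -LamZ// nf (Lam_sum LamD LamZ Lam1 n cphi).
pose U (i : nat) := [set x : X | i%:R < n%:R * f x].
have oU i : open (U i) by apply: open_superlevel; exact: continuous_funZ.
have mU i : measurable (U i : set (borel X)) by exact: open_borel.
have phiU i : Lam (phi i) <= expect mu (\1_(U i) : borel X -> R).
  rewrite -lee_fin expect_indic//.
  rewrite [leRHS](_ : _ = riesz_outer Lam (U i))// riesz_outer_open//.
  apply: open_content_ub; split => //.
    by move=> x; rewrite le_min ler01 le_max lexx/= ge_min lexx.
  move=> x /negP; rewrite -leNgt => h; rewrite /phi.
  have -> : Num.max 0 (n%:R * f x - i%:R) = 0 by apply/max_idPl; rewrite subr_le0.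
  by apply/min_idPr.
apply: (@le_trans _ _ (\sum_(i < n) expect mu (\1_(U i) : borel X -> R))).
  by apply: ler_sum => i _.
have iU i : integ mu (\1_(U i) : borel X -> R) by exact: integrable_indic.
rewrite -(@expect_sum _ _ _ mu (fun i => \1_(U i)) n iU).
have cnf : continuous (fun x => n%:R * f x) by exact: continuous_funZ.
rewrite -expectZ; last exact: continuous_integ.
rewrite -[X in _ + X](expect_cst mu) -expectD; last 2 first.
- exact: continuous_integ.
- exact: integ_cst.
apply: expect_le.
- exact: (@integ_sum _ _ _ mu (fun i => \1_(U i))).
- by apply: integD; [exact: continuous_integ|exact: integ_cst].
move=> x; have /andP[f0 f1] := f01 x.
have t0 : 0 <= n%:R * f x + 1 by rewrite addr_ge0// mulr_ge0.
apply: (@le_trans _ _ (Num.min n%:R (n%:R * f x + 1))); last first.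
  by rewrite ge_min lexx orbT.
rewrite -sum_clamp//; apply: ler_sum => i _.
have c0 : 0 <= Num.min 1 (Num.max 0 (n%:R * f x + 1 - i%:R)).
  by rewrite le_min ler01 le_max lexx.
rewrite indicE; case: (boolP (x \in _)) => //=.
rewrite inE /U /= => h; rewrite le_min lexx le_max; apply/orP; right.
by move: h; lra.
Qed.

Let unit_le (f : X -> R) : continuous f -> (forall x, 0 <= f x <= 1) ->
  Lam f <= expect mu f.
Proof.
move=> cf f01; apply/ler_addgt0Pr => e e0.
pose n := (Num.truncn e^-1).+1.
have n0 : 0 < n%:R :> R by rewrite ltr0n.
rewrite -(ler_pM2l n0) mulrDr; apply: le_trans (unit_bound n cf f01) _.
rewrite lerD2l -ler_pdivrMr// mul1r ltW// /n; exact: truncnS_gt.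
Qed.

Lemma riesz_expect (f : X -> R) : continuous f -> expect mu f = Lam f.
Proof.
have unit_eq (g : X -> R) : continuous g -> (forall x, 0 <= g x <= 1) ->
    expect mu g = Lam g.
  move=> cg g01; apply/eqP; rewrite eq_le unit_le// andbT.
  have cg' : continuous (fun x => -1 * g x) by exact: continuous_funZ.
  (* The one-sided bound for 1 - g is the reverse inequality for g. *)
  have := unit_le (f := fun x => 1 + -1 * g x).
  rewrite LamD//; last exact: continuous_fun_cst.
  rewrite Lam1 LamZ// expectD; last 2 first.
  - exact: integ_cst.
  - exact: continuous_integ.
  rewrite expect_cst expectZ; last exact: continuous_integ.
  move=> h; have : 1 + -1 * Lam g <= 1 + -1 * expect mu g.
    apply: h; first by apply: continuous_funD => //; exact: continuous_fun_cst.
    by move=> x; have /andP[] := g01 x; lra.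
  lra.
move=> cf; have [M fM] := continuous_bounded cX cf.
have M0 : 0 < `|M| + 1 by rewrite ltr_wpDl.
(* An affine change of variable brings the bounded f into [0, 1]. *)
pose g x := 2^-1 + (2 * (`|M| + 1))^-1 * f x.
have cg' : continuous (fun x => (2 * (`|M| + 1))^-1 * f x) by exact: continuous_funZ.
have cg : continuous g by apply: continuous_funD => //; exact: continuous_fun_cst.
have g01 x : 0 <= g x <= 1.
  rewrite /g; have : `|(2 * (`|M| + 1))^-1 * f x| <= 2^-1.
    rewrite normrM gtr0_norm ?invr_gt0 ?mulr_gt0// mulrC ler_pdivrMr ?mulr_gt0//.
    have := fM x; have := ler_norm M; lra.
  by rewrite ler_norml => /andP[]; lra.
have := unit_eq g cg g01.
rewrite /g LamD//; last exact: continuous_fun_cst.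
rewrite (Lam_cst LamZ Lam1) LamZ// expectD; last 2 first.
- exact: integ_cst.
- exact: continuous_integ.
rewrite expect_cst expectZ; last exact: continuous_integ.
move=> /addrI; apply: mulfI.
by rewrite gt_eqF// invr_gt0 mulr_gt0.
Qed.

End RieszIntegral.

Theorem riesz_representation {R : realType} {X : pointedMetricType R}
    (Lam : (X -> R) -> R) : compact [set: X] ->
  (forall f g : X -> R, continuous f -> continuous g ->
    Lam (fun x => f x + g x) = Lam f + Lam g) ->
  (forall (a : R) (f : X -> R), continuous f ->
    Lam (fun x => a * f x) = a * Lam f) ->
  (forall f : X -> R, continuous f -> (forall x, 0 <= f x) -> 0 <= Lam f) ->
  Lam (fun _ => 1) = 1 ->
  exists mu : probability (borel X) R,
    forall f : X -> R, continuous f -> expect mu f = Lam f.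
Proof.
move=> cX LamD LamZ Lam_ge0 Lam1.
by exists (riesz_measure cX LamD LamZ Lam_ge0 Lam1) => f; exact: riesz_expect.
Qed.

(** * Laws, products and independence in the Bernoulli space *)

Section Law.
Context {d1 d2 : measure_display} {T1 : measurableType d1}
  {T2 : measurableType d2} {R : realType}.
Variables (P : probability T1 R) (phi : T1 -> T2).
Hypothesis mphi : measurable_fun setT phi.

Definition law_fun (A : set T2) : \bar R := P (phi @^-1` A).

Let m : measure T2 R :=
  measure_function_pushforward__canonical__measure_function_Measure P mphi.

HB.instance Definition _ := isMeasure.Build _ T2 R law_fun
  (measure0 m) (measure_ge0 m) (@measure_semi_sigma_additive _ _ _ m).

Let law_funT : law_fun setT = 1%E.
Proof. by rewrite /law_fun preimage_setT probability_setT. Qed.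

HB.instance Definition _ := Measure_isProbability.Build _ T2 R law_fun law_funT.

Definition law : probability T2 R := law_fun.

Lemma expect_law (g : T2 -> R) : measurable_fun setT g ->
  integ P (g \o phi) -> expect law g = expect P (g \o phi).
Proof.
move=> mg ig; rewrite /expect /Rintegral; congr fine.
have := @integral_pushforward _ _ T1 T2 R phi mphi P setT (EFin \o g).
by rewrite preimage_setT; apply => //; exact/measurable_EFinP.
Qed.

Lemma ge0_integral_law (g : T2 -> \bar R) : measurable_fun setT g ->
  (forall x, 0 <= g x)%E -> (\int[law]_x g x = \int[P]_x g (phi x))%E.
Proof.
move=> mg g0.
have := @ge0_integral_pushforward _ _ T1 T2 R phi mphi P setT g measurableT mg.
by rewrite preimage_setT; apply => x _; exact: g0.
Qed.

Lemma law_integ (g : T2 -> R) : integ law g -> integ P (g \o phi).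
Proof.
move=> gi; have mg := integ_measurable gi; move/integrableP : (gi) => [_ fin].
apply/integrableP; split.
  by apply/measurable_EFinP; exact: (measurableT_comp mg mphi).
rewrite -(ge0_integral_law (g := fun y => `|(g y)%:E|%E))//.
by apply: measurableT_comp => //; exact/measurable_EFinP.
Qed.

End Law.

Section EqMeasure.
Context {d : measure_display} {T : measurableType d} {R : realType}.
Variables P Q : probability T R.
Hypothesis PQ : forall A, measurable A -> P A = Q A.

Lemma eq_integ (f : T -> R) : integ P f -> integ Q f.
Proof.
move=> /integrableP[mf fi]; apply/integrableP; split => //.
by rewrite -(@eq_measure_integral _ T R setT Q P) => [//|A mA _]; exact: PQ.
Qed.

Lemma eq_expect (f : T -> R) : expect P f = expect Q f.
Proof.
rewrite /expect /Rintegral; congr fine.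
by apply: eq_measure_integral => A mA _; exact: PQ.
Qed.

End EqMeasure.

Section Product.
Context {d1 d2 : measure_display} {T1 : measurableType d1}
  {T2 : measurableType d2} {R : realType}.
Variables (P1 : probability T1 R) (P2 : probability T2 R).

(** A name for the product measure under which it is a probability, so that [integ] and [expect]
    apply to it. *)
Definition product_fun (A : set (T1 * T2)) : \bar R := (P1 \x P2)%E A.

Let m : measure (T1 * T2)%type R := (P1 \x P2)%E.

HB.instance Definition _ := isMeasure.Build _ (T1 * T2)%type R product_fun
  (measure0 m) (measure_ge0 m) (@measure_semi_sigma_additive _ _ _ m).

Let product_funT : product_fun setT = 1%E.
Proof.
rewrite /product_fun -setXTT product_measure1E//.
by rewrite [X in (X * _)%E](probability_setT P1) [X in (_ * X)%E](probability_setT P2) mule1.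
Qed.

HB.instance Definition _ :=
  Measure_isProbability.Build _ (T1 * T2)%type R product_fun product_funT.

Definition product_probability : probability (T1 * T2)%type R := product_fun.

Lemma product_probabilityX A B : measurable A -> measurable B ->
  product_probability (A `*` B) = (P1 A * P2 B)%E.
Proof. by move=> mA mB; exact: product_measure1E. Qed.

Lemma product_probability_unique (Q : probability (T1 * T2)%type R) :
  (forall A B, measurable A -> measurable B -> Q (A `*` B) = (P1 A * P2 B)%E) ->
  forall A, measurable A -> product_probability A = Q A.
Proof. by move=> QE A mA; exact: product_measure_unique. Qed.

Lemma integ_fst (h : T1 -> R) : integ P1 h ->
  integ product_probability (h \o fst).
Proof.
move=> hi; have mh : measurable_fun setT (h \o @fst T1 T2).
  exact: (measurableT_comp (integ_measurable hi) (@measurable_fst _ _ T1 T2)).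
have mE : measurable_fun setT (EFin \o (h \o @fst T1 T2)) by exact/measurable_EFinP.
apply/integrableP; split => //.
rewrite (fubini_tonelli1 (fun z : T1 * T2 => `|(EFin \o (h \o fst)) z|%E))//=; last first.
  apply: measurableT_comp => //.
  by change (measurable_fun setT (Num.norm \o (h \o @fst T1 T2))); exact: measurableT_comp.
rewrite /fubini_F /=.
under eq_integral do
  rewrite integral_cst// [X in (_ * X)%E](probability_setT P2) mule1.
by have /integrableP[] := hi.
Qed.

Variable F : T1 * T2 -> R.
Hypothesis iF : integ product_probability F.

Let fubiniE1 : (forall x, integ P2 (fun y => F (x, y))) ->
  fubini_F P2 (EFin \o F) = EFin \o (fun x => expect P2 (fun y => F (x, y))).
Proof. by move=> iFx; apply/funext => x; rewrite /fubini_F /= expectE. Qed.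

Let fubiniE2 : (forall y, integ P1 (fun x => F (x, y))) ->
  fubini_G P1 (EFin \o F) = EFin \o (fun y => expect P1 (fun x => F (x, y))).
Proof. by move=> iFx; apply/funext => x; rewrite /fubini_G /= expectE. Qed.

Lemma integ_fubini1 : (forall x, integ P2 (fun y => F (x, y))) ->
  integ P1 (fun x => expect P2 (fun y => F (x, y))).
Proof. by move=> iFx; have := integrable_fubini_F iF; rewrite fubiniE1. Qed.

Lemma expect_fubini1 : (forall x, integ P2 (fun y => F (x, y))) ->
  expect product_probability F = expect P1 (fun x => expect P2 (fun y => F (x, y))).
Proof.
move=> iFx; have := integral12_prod_meas1 iF; rewrite fubiniE1// => h.
by rewrite /expect /Rintegral; congr fine; exact/esym.
Qed.

Lemma integ_fubini2 : (forall y, integ P1 (fun x => F (x, y))) ->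
  integ P2 (fun y => expect P1 (fun x => F (x, y))).
Proof.
move=> iFx; apply/integrableP; split.
  by have := measurable_fubini_G iF; rewrite fubiniE2.
have := (integrable21ltyP P1 P2 (measurable_int _ iF)).1 iF; apply: le_lt_trans.
apply: ge0_le_integral => //.
- apply: measurableT_comp => //.
  by have := measurable_fubini_G iF; rewrite fubiniE2.
- apply: (measurable_fun_fubini_tonelli_G (abse \o (EFin \o F))) => //=.
  by apply: measurableT_comp => //; exact: (measurable_int _ iF).
- move=> y _; change (`|(expect P1 (fun x => F (x, y)))%:E| <= \int[P1]_x `|(F (x, y))%:E|)%E.
  rewrite -(expectE (iFx y)); apply: le_abse_integral => //.
  exact: (measurable_int _ (iFx y)).
Qed.

Lemma expect_fubini2 : (forall y, integ P1 (fun x => F (x, y))) ->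
  expect product_probability F = expect P2 (fun y => expect P1 (fun x => F (x, y))).
Proof.
move=> iFx; have := integral21_prod_meas1 iF; rewrite fubiniE2// => h.
by rewrite /expect /Rintegral; congr fine; exact/esym.
Qed.

End Product.

Section Bernoulli.
Context {d : measure_display} {T : measurableType d} {R : realType}.
Variables (p : probability T R) (P : probability (sequences_in T) R).
Hypothesis bP : is_bernoulli p P.

(** The past up to time k from w, the future from w'. With w and w' independent this has law P, so
    freezing w and averaging over w' is conditioning on the first k symbols. *)
Definition splice (k : nat) (w w' : sequences_in T) : sequences_in T :=
  fun i => if (i < k)%N then w i else w' (i - k)%N.

Lemma seq_shift_splice k w w' : seq_shift k (splice k w w') = w'.
Proof.
by apply/funext => i; rewrite /seq_shift /splice ltnNge leq_addr/= addKn.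
Qed.

Lemma seq_shiftD j k (w : sequences_in T) :
  seq_shift j (seq_shift k w) = seq_shift (k + j) w.
Proof. by apply/funext => i; rewrite /seq_shift addnA. Qed.

Lemma seq_shift0 (w : sequences_in T) : seq_shift 0 w = w.
Proof. by apply/funext => i. Qed.

Lemma measurable_coordinate i (B : set T) : measurable B ->
  measurable [set w : sequences_in T | B (w i)].
Proof. by move=> mB; apply: sub_sigma_algebra; exists i, B. Qed.

Lemma measurable_into_sequences {d'} {S : measurableType d'}
    (g : S -> sequences_in T) :
  (forall i (B : set T), measurable B -> measurable [set s | B (g s i)]) ->
  measurable_fun setT g.
Proof.
move=> mg; refine (@measurability _ _ S (sequences_in T) setT g (@coordinate_events d T) erefl _).
by move=> _ [_ [i [B [mB ->]]] <-]; rewrite setTI; exact: mg.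
Qed.

Lemma measurable_seq_shift k : measurable_fun setT (@seq_shift d T k).
Proof.
apply: measurable_into_sequences => i B mB; exact: (measurable_coordinate (k + i) mB).
Qed.

Lemma measurable_splice k :
  measurable_fun setT (fun ww : sequences_in T * sequences_in T => splice k ww.1 ww.2).
Proof.
apply: measurable_into_sequences => i B mB; rewrite /splice; case: (ltnP i k) => _.
- have := @measurable_fst _ _ (sequences_in T) (sequences_in T)
    measurableT _ (measurable_coordinate i mB); by rewrite setTI.
- have := @measurable_snd _ _ (sequences_in T) (sequences_in T)
    measurableT _ (measurable_coordinate (i - k) mB); by rewrite setTI.
Qed.

Definition cylinder (n : nat) (A : nat -> set T) : set (sequences_in T) :=
  [set w | forall i, (i < n)%N -> A i (w i)].

Lemma measurable_cylinder n A : (forall i, measurable (A i)) ->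
  measurable (cylinder n A).
Proof.
move=> mA; have -> : cylinder n A = \bigcap_(i in [set i | (i < n)%N]) [set w | A i (w i)].
  by apply/seteqP; split => w /= h i; exact: h.
by apply: bigcap_measurableType => i _; exact: measurable_coordinate.
Qed.

Lemma splice_preimage_cylinder k n A :
  (fun ww => splice k ww.1 ww.2) @^-1` cylinder n A =
  cylinder (minn n k) A `*` cylinder (n - k) (fun i => A (k + i)%N).
Proof.
apply/seteqP; split => [[w w'] h|[w w'] [/= h1 h2] i ni].
  split => i /= hi.
    move: hi; rewrite leq_min => /andP[i1 i2].
    by have := h i i1; rewrite /= /splice i2.
  have := h (k + i)%N; rewrite /= /splice; have -> : (k + i < k)%N = false by lia.
  by rewrite addKn; apply; lia.
rewrite /splice; case: ltnP => ik; first by apply: h1; rewrite leq_min ni ik.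
by have := h2 (i - k)%N; rewrite subnKC//; apply; rewrite ltn_sub2r//; lia.
Qed.

Lemma probability_cylinder n A : (forall i, measurable (A i)) ->
  P (cylinder n A) = (\prod_(i < n) p (A i))%E.
Proof. exact: bP. Qed.

Lemma splice_cylinder k n A : (forall i, measurable (A i)) ->
  product_probability P P ((fun ww => splice k ww.1 ww.2) @^-1` cylinder n A) =
  P (cylinder n A).
Proof.
move=> mA; rewrite splice_preimage_cylinder product_probabilityX; last 2 first.
- exact: measurable_cylinder.
- by apply: measurable_cylinder => i.
rewrite !probability_cylinder//; case: (leqP n k) => nk.
  rewrite (_ : (n - k)%N = 0%N) ?big_ord0 ?mule1//.
  by apply/eqP; rewrite subn_eq0.
have [m ->] : exists m, n = (k + m)%N by exists (n - k)%N; rewrite subnKC// ltnW.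
by rewrite addKn big_split_ord.
Qed.

(** Cylinders generate the sigma-algebra and are stable under intersection once the shorter one is
    padded with [setT]. *)
Lemma bernoulli_unique (Q : probability (sequences_in T) R) :
  (forall n A, (forall i, measurable (A i)) -> Q (cylinder n A) = P (cylinder n A)) ->
  forall A, measurable A -> Q A = P A.
Proof.
move=> QP A mA.
pose G := [set C | exists n A, (forall i, measurable (A i)) /\ C = cylinder n A].
have GE : measurable = <<s G >>.
  apply/seteqP; split; apply: smallest_sub.
  - exact: smallest_sigma_algebra.
  - move=> _ [i [B [mB ->]]]; apply: sub_sigma_algebra.
    exists i.+1, (fun j => if j == i then B else setT); split.
      by move=> j; case: ifP.
    apply/seteqP; split => w /= h; first by move=> j _; case: eqP => // ->.
    by have := h i (ltnSn i); rewrite eqxx.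
  - exact: (@sigma_algebra_measurable _ (sequences_in T)).
  - by move=> _ [n [B [mB ->]]]; exact: measurable_cylinder.
apply: (@measure_unique _ R (sequences_in T) G (fun _ => setT)) => //.
- move=> _ _ [n [B [mB ->]]] [m [C [mC ->]]].
  exists (maxn n m), (fun i => (if (i < n)%N then B i else setT) `&`
                          (if (i < m)%N then C i else setT)); split.
    by move=> i; apply: measurableI; case: ifP.
  apply/seteqP; split => w /=.
    by move=> [hB hC] i _; split; case: ifP => // hi; [exact: hB|exact: hC].
  move=> h; split => i hi.
    by have [] := h i; rewrite ?leq_max ?hi//.
  by have [] := h i; rewrite ?leq_max ?hi ?orbT//.
- by move=> _; exists 0%N, (fun _ => setT); split => //; apply/seteqP; split.
- by rewrite bigcup_const//; exists 0%N.
- by move=> _ [n [B [mB ->]]]; exact: QP.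
- by move=> _; rewrite (le_lt_trans (probability_le1 _ _))// ltry.
Qed.

Lemma splice_law k A : measurable A ->
  law (product_probability P P) (measurable_splice k) A = P A.
Proof. by apply: bernoulli_unique => n B mB; exact: splice_cylinder. Qed.

(** After [splice k] the shift by k is the second projection, so its law is that of w'. *)
Lemma shift_law k A : measurable A -> law P (measurable_seq_shift k) A = P A.
Proof.
move=> mA; change (P (@seq_shift d T k @^-1` A) = P A).
rewrite -[LHS](splice_law k); last first.
  rewrite -[X in measurable X]setTI; exact: measurable_seq_shift.
change (product_probability P P
  ((fun ww => splice k ww.1 ww.2) @^-1` (@seq_shift d T k @^-1` A)) = P A).
rewrite (_ : _ @^-1` _ = setT `*` A).
  by rewrite product_probabilityX// probability_setT mul1e.
by apply/seteqP; split => -[w w'] /=; rewrite seq_shift_splice; [split|case].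
Qed.

End Bernoulli.

(** * Null sets: changing an integrand, choosing a null section *)

Section NullModification.
Context {d : measure_display} {T : measurableType d} {R : realType}.
Variable mu : {measure set T -> \bar R}.
Local Open Scope ereal_scope.
Import HBNNSimple.

Let ge0_integral_eq_off_null_le (N : set T) (f g : T -> \bar R) :
  measurable N -> mu N = 0 -> (forall x, 0 <= f x) -> (forall x, 0 <= g x) ->
  (forall x, ~ N x -> f x = g x) -> \int[mu]_x f x <= \int[mu]_x g x.
Proof.
move=> mN N0 f0 g0 fg; rewrite !ge0_integralTE//.
apply: ge_ereal_sup => _ [h hf <-].
(* A simple function below f, set to 0 on N, lies below g and has the same integral. *)
pose h' := proj_nnsfun h (measurableC mN).
have h'E x : h' x = (if x \in ~` N then h x else 0%R).
  by rewrite /h' /proj_nnsfun /= mindicE; case: ifP => _; rewrite ?mulr1 ?mulr0.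
apply: le_ereal_sup_tmp; exists (sintegral mu h').
  exists h' => // x; rewrite h'E; case: ifPn => [|_]; last exact: g0.
  by rewrite inE /= => xN; rewrite -fg.
rewrite -!integralT_nnsfun le_eqVlt; apply/orP; left; apply/eqP.
apply: ae_eq_integral => //; [exact/measurable_EFinP|exact/measurable_EFinP|].
exists N; split => // x /= /not_implyP[_ hx]; apply: contrapT => Nx.
by apply: hx; congr EFin; apply/esym/(etrans (h'E x)); rewrite ifT// inE.
Qed.

(* No measurability is required: the integral of a nonnegative function is the
   supremum of the integrals of the simple functions below it. *)
Lemma integral_eq_off_null (N : set T) (f g : T -> \bar R) :
  measurable N -> mu N = 0 -> (forall x, ~ N x -> f x = g x) ->
  \int[mu]_x f x = \int[mu]_x g x.
Proof.
move=> mN N0 fg; rewrite integralE [RHS]integralE; congr (_ - _);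
  apply/eqP; rewrite eq_le; apply/andP; split;
  apply: (@ge0_integral_eq_off_null_le N) => // x Nx.
- by rewrite !funeposE fg.
- by rewrite !funeposE fg.
- by rewrite !funenegE fg.
- by rewrite !funenegE fg.
Qed.

End NullModification.

Section NullSections.
Context {d1 d2 : measure_display} {T1 : measurableType d1}
  {T2 : measurableType d2} {R : realType}.
Variables (P1 : probability T1 R) (P2 : probability T2 R).

(** By Tonelli almost every section is null, and a set of full probability is not empty. *)
Lemma null_ysection (A : set (T1 * T2)) : measurable A ->
  product_probability P1 P2 A = 0%E -> exists y, P1 (ysection A y) = 0%E.
Proof.
move=> mA A0.
have mf : measurable_fun setT (EFin \o (\1_A : T1 * T2 -> R)).
  by apply/measurable_EFinP; exact: measurable_indic.
have := @fubini_tonelli2 _ _ T1 T2 R P1 P2 (EFin \o \1_A) mf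
  (fun x => lee_tofin (ler0n R _)).
rewrite integral_indic// setIT.
rewrite [X in X = _ -> _](_ : _ = product_probability P1 P2 A)// A0 => /esym h.
have GE : fubini_G P1 (EFin \o (\1_A : T1 * T2 -> R)) = P1 \o ysection A.
  by apply/funext => y; rewrite indic_fubini_tonelli_GE.
rewrite GE in h.
have /ae_eq_integral_abs : (\int[P2]_x `|(P1 \o ysection A) x| = 0)%E.
  by rewrite -[RHS]h; apply: eq_integral => x _; rewrite gee0_abs.
move=> /(_ measurableT (measurable_fun_ysection P1 mA)) [N [mN N0 NA]].
apply: contrapT => /forallNP h'.
have : N = setT.
  by apply/seteqP; split => // y _; apply: NA => /= hy; apply: (h' y); exact: hy.
move=> NT; move: N0; rewrite NT => /eqP.
by rewrite [X in X == _](probability_setT P2) onee_eq0.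
Qed.

End NullSections.

(** * Lipschitz constants of random maps *)

Section LipOn.
Context {R : realType} {X : metricType R}.
Implicit Types (g : X -> X) (A B : set X).

Definition lip_bound A g (K : R) : Prop :=
  0 <= K /\ forall x y, A x -> A y -> mdist (g x) (g y) <= K * mdist x y.

Lemma Lip_on_ge0 A g : (0 <= Lip_on A g)%E.
Proof. by apply: le_ereal_inf_tmp => _ [K [K0 _] <-]; rewrite lee_fin. Qed.

Lemma Lip_on_le A g K : lip_bound A g K -> (Lip_on A g <= K%:E)%E.
Proof. by move=> hK; apply: ereal_inf_lbound; exists K. Qed.

Lemma Lip_on_attained A g : (Lip_on A g < +oo)%E ->
  lip_bound A g (fine (Lip_on A g)).
Proof.
move=> fA; have fin : Lip_on A g \is a fin_num by rewrite ge0_fin_numE// Lip_on_ge0.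
split; first by rewrite fine_ge0// Lip_on_ge0.
move=> x y Ax Ay; have [->|xy] := eqVneq x y.
  by rewrite !mdistxx mulr0.
have d0 : 0 < mdist x y by rewrite mdist_gt0.
rewrite -ler_pdivrMr// -lee_fin fineK//.
apply: le_ereal_inf_tmp => _ [K [K0 hK] <-].
by rewrite lee_fin ler_pdivrMr//; exact: hK.
Qed.

Lemma Lip_on_sub A B g : A `<=` B -> (Lip_on A g <= Lip_on B g)%E.
Proof.
move=> AB; apply: le_ereal_inf_tmp => _ [K [K0 hK] <-].
by apply: Lip_on_le; split => // x y Ax Ay; apply: hK; exact: AB.
Qed.

Lemma Lip_id_lty : (@Lip R X id < +oo)%E.
Proof.
apply: (@le_lt_trans _ _ 1%:E); last exact: ltry.
by apply: Lip_on_le; split => // x y _ _; rewrite mul1r.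
Qed.

End LipOn.

Section Reduction.
Context {d : measure_display} {T : measurableType d} {R : realType}
  {X : pointedMetricType R}.
Variables (p : probability T R) (P : probability (sequences_in T) R).
Hypothesis bP : is_bernoulli p P.
Variable f : sequences_in T -> X -> X.

(** The almost sure properties of f, required of every w. Dependence on the symbol at 0 is stated as
    an equality between maps, the form in which spliced sequences use it; no measurable factor
    through T is asked for. *)
Record good_random_map (h : sequences_in T -> X -> X) : Prop := GoodRandomMap {
  good_measurable : measurable_fun setT
    (fun wx : sequences_in T * borel X => h wx.1 wx.2 : borel X);
  good_head : forall w w' : sequences_in T, w 0%N = w' 0%N -> h w = h w';
  good_lip : forall w, (Lip (h w) < +oo)%E }.

Lemma null_shift (N : set (sequences_in T)) k : measurable N -> P N = 0%E ->
  measurable (@seq_shift d T k @^-1` N) /\ P (@seq_shift d T k @^-1` N) = 0%E.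
Proof.
move=> mN N0; split.
  by rewrite -[X in measurable X]setTI; exact: measurable_seq_shift.
by rewrite -N0 -[RHS](shift_law bP k mN).
Qed.

(* Fubini provides a sequence s' such that w |-> (w_0, s'_0, s'_1, ...) a.s. avoids
   the exceptional set; f at that sequence depends on w_0 only and is jointly
   measurable, which need not hold for the g of [random_map]. *)
Lemma random_map_reduction : random_map P f ->
  {ae P, forall w, (Lip (f w) < +oo)%E} ->
  exists h, good_random_map h /\
  exists N : set (sequences_in T), [/\ measurable N, P N = 0%E &
    forall w, ~ N w -> f w = h w /\ forall n, iterate f n w = iterate h n w].
Proof.
move=> [mf [g fg]] fL.
have [Ng [mNg PNg hNg]] := fg; have [NL [mNL PNL hNL]] := fL.
pose N0 := Ng `|` NL.
have mN0 : measurable N0 by exact: measurableU.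
have PN0 : P N0 = 0%E by apply/negligibleP => //; apply: negligibleU; exact/negligibleP.
have hN0 w : ~ N0 w -> f w = g (w 0%N) /\ (Lip (f w) < +oo)%E.
  move=> Nw; split; apply: contrapT => h; apply: Nw; [left|right].
    exact: hNg.
  exact: hNL.
have msp : measurable ((fun ww => splice 1 ww.1 ww.2) @^-1` N0 :
    set (sequences_in T * sequences_in T)).
  by rewrite -[X in measurable X]setTI; exact: measurable_splice.
have [s' hs'] := null_ysection msp (etrans (splice_law bP 1 mN0) PN0).
have msplice1 : measurable_fun setT (fun w : sequences_in T => splice 1 w s').
  apply: measurable_into_sequences => i B mB; rewrite /splice.
  case: (ltnP i 1) => _; first exact: measurable_coordinate.
  have [b|b] := pselect (B (s' (i - 1)%N)).
    by rewrite (_ : [set _ | _] = setT)//; apply/seteqP; split.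
  by rewrite (_ : [set _ | _] = set0)//; apply/seteqP; split.
pose N1 := [set w | N0 (splice 1 w s')].
have mN1 : measurable N1.
  by rewrite -[X in measurable X]setTI; exact: msplice1.
have PN1 : P N1 = 0%E.
  rewrite -[RHS]hs'; congr (P _); apply/seteqP; split => w.
    by rewrite /ysection /= inE.
  by rewrite /ysection /= inE.
(* On the bad set the identity serves as default: it is Lipschitz, and membership in [N1] depends on
   w 0 only. *)
pose h (w : sequences_in T) (x : X) : X :=
  if w \in N1 then x else f (splice 1 w s') x.
have sp (w w' : sequences_in T) : w 0%N = w' 0%N -> splice 1 w s' = splice 1 w' s'.
  by move=> e; apply/funext => i; rewrite /splice; case: ltnP => //; case: i.
exists h; split; first split.
- apply: measurable_fun_ifT.
  + apply: (measurable_fun_bool true); rewrite setTI.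
    have := @measurable_fst _ _ (sequences_in T) (borel X) measurableT _ mN1.
    rewrite setTI; congr measurable; apply/seteqP; split => -[w x] /=.
      by move=> ?; apply/mem_set.
    by move/set_mem.
  + exact: measurable_snd.
  + have mg : measurable_fun setT (fun wx : sequences_in T * borel X =>
        (splice 1 wx.1 s', wx.2) : sequences_in T * borel X).
      apply: measurable_fun_pair; last exact: measurable_snd.
      exact: (measurableT_comp msplice1 (@measurable_fst _ _ (sequences_in T) (borel X))).
    exact: (measurableT_comp mf mg).
- move=> w w' e; apply/funext => x; rewrite /h.
  have -> : (w \in N1) = (w' \in N1) by apply/idP/idP; rewrite !inE /N1 /= (sp _ _ e).
  by rewrite (sp _ _ e).
- move=> w; have [Nw|Nw] := pselect (N1 w).
    rewrite (_ : h w = id); first exact: Lip_id_lty.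
    by apply/funext => x; rewrite /h mem_set.
  rewrite (_ : h w = f (splice 1 w s')); first by have [] := hN0 _ Nw.
  by apply/funext => x; rewrite /h memNset.
(* Off both sets w and [splice 1 w s'] are regular and share the symbol at 0, so f takes the common
   value [g (w 0)] at both. *)
have fh w : ~ N0 w -> ~ N1 w -> f w = h w.
  move=> n0 n1; have [-> _] := hN0 _ n0; apply/funext => x.
  by rewrite /h memNset//; have [-> _] := hN0 _ n1.
(* All shifts of w must avoid the bad sets, since the iterates evaluate f along them. *)
exists (\bigcup_m ((@seq_shift d T m @^-1` N0) `|` (@seq_shift d T m @^-1` N1))).
have hm m : measurable ((@seq_shift d T m @^-1` N0) `|` (@seq_shift d T m @^-1` N1)).
  by apply: measurableU; [exact: (null_shift m mN0 PN0).1|exact: (null_shift m mN1 PN1).1].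
split.
- exact: bigcup_measurable.
- apply/(@measure_negligible _ _ _ P); first exact: bigcup_measurable.
  apply: negligible_bigcup => m; apply: negligibleU; apply/negligibleP.
  + exact: (null_shift m mN0 PN0).1.
  + exact: (null_shift m mN0 PN0).2.
  + exact: (null_shift m mN1 PN1).1.
  + exact: (null_shift m mN1 PN1).2.
- move=> w Nw.
  have key m : f (seq_shift m w) = h (seq_shift m w).
    by apply: fh => n; apply: Nw; exists m => //; [left|right].
  split; first by have := key 0%N; rewrite seq_shift0.
  by elim=> [//|n ih] /=; rewrite ih key.
Qed.

End Reduction.

Section DenseSequence.
Context {R : realType} {X : pointedMetricType R}.

Lemma dense_sequence : compact [set: X] -> exists D : nat -> X,
  forall x (e : R), 0 < e -> exists i, mdist x (D i) < e.
Proof.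
move=> /compact_second_countable [B /countable_injP[c cinj] [Bo Bx]].
(* The n-th point lies in the basic open set with code n; [point] fills the indices that code no set
   or an empty one. *)
exists (fun n => xget point [set y | exists2 U, B U /\ c U = n & U y]) => x e e0.
have [U [BU Ux] Ue] := Bx x (ball x e) (nbhsx_ballx x e e0).
exists (c U); case: xgetP => [y _ [V [BV cVU] Vy]|/(_ x)]; last first.
  by move=> /= h; exfalso; apply: h; exists U.
have VU : V = U by apply: cinj; rewrite ?inE.
by move: Vy; rewrite VU => /Ue; rewrite ballEmdist.
Qed.

End DenseSequence.

Section LocalLip.
Context {R : realType} {X : metricType R}.
Implicit Types (g h : X -> X) (A B : set X).

Definition lipc A g : R := fine (Lip_on A g).

Definition rad (k : nat) : R := k.+1%:R^-1.

(** A real-valued form of [local_Lip] along countably many radii, suited to measurability and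
    dominated convergence; [local_LipE] identifies the two for Lipschitz maps. *)
Definition llip g (z : X) : R := inf [set lipc (ball z (rad k)) g | k in setT].

Lemma rad_gt0 k : 0 < rad k.
Proof. by rewrite invr_gt0 ltr0n. Qed.

Lemma rad_small (r : R) : 0 < r -> \forall k \near \oo, rad k < r.
Proof.
move=> r0; near=> k; rewrite /rad -[r]invrK ltf_pV2 ?posrE ?ltr0n ?invr_gt0//.
apply: (@le_lt_trans _ _ k%:R); last by rewrite ltr_nat.
by near: k; exact: nbhs_infty_ger.
Unshelve. all: by end_near. Qed.

Lemma lipc_ge0 A g : 0 <= lipc A g.
Proof. by rewrite fine_ge0// Lip_on_ge0. Qed.

Lemma Lip_on_lty_sub A g : (Lip g < +oo)%E -> (Lip_on A g < +oo)%E.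
Proof. by apply: le_lt_trans; exact: Lip_on_sub. Qed.

Lemma lipcE A g : (Lip g < +oo)%E -> Lip_on A g = (lipc A g)%:E.
Proof.
by move=> Lg; rewrite fineK// ge0_fin_numE ?Lip_on_ge0//; exact: Lip_on_lty_sub.
Qed.

Lemma lipc_bound A g : (Lip g < +oo)%E -> lip_bound A g (lipc A g).
Proof. by move=> Lg; apply: Lip_on_attained; exact: Lip_on_lty_sub. Qed.

Lemma lipc_le A g K : (Lip g < +oo)%E -> lip_bound A g K -> lipc A g <= K.
Proof. by move=> Lg hK; rewrite -lee_fin -lipcE//; exact: Lip_on_le. Qed.

Lemma lipc_sub A B g : (Lip g < +oo)%E -> A `<=` B -> lipc A g <= lipc B g.
Proof. by move=> Lg AB; rewrite -lee_fin -!lipcE//; exact: Lip_on_sub. Qed.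

Lemma Lip_comp_lty g h : (Lip g < +oo)%E -> (Lip h < +oo)%E ->
  (Lip (h \o g) < +oo)%E.
Proof.
move=> Lg Lh; have [g0 hg] := lipc_bound setT Lg; have [h0 hh] := lipc_bound setT Lh.
apply: (@le_lt_trans _ _ (lipc setT h * lipc setT g)%:E); last exact: ltry.
apply: Lip_on_le; split; first exact: mulr_ge0.
move=> x y _ _ /=; apply: le_trans (hh _ _ I I) _.
by rewrite -mulrA ler_wpM2l// hg.
Qed.

Lemma lipc_comp A B g h : (Lip g < +oo)%E -> (Lip h < +oo)%E ->
  (forall x, A x -> B (g x)) -> lipc A (h \o g) <= lipc B h * lipc A g.
Proof.
move=> Lg Lh AB; have [g0 hg] := lipc_bound A Lg; have [h0 hh] := lipc_bound B Lh.
apply: lipc_le; first exact: Lip_comp_lty.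
split; first exact: mulr_ge0.
move=> x y Ax Ay /=; apply: le_trans (hh _ _ (AB _ Ax) (AB _ Ay)) _.
by rewrite -mulrA ler_wpM2l// hg.
Qed.

Lemma Lip_continuous g : (Lip g < +oo)%E -> continuous g.
Proof.
move=> Lg x; have [K0 hK] := lipc_bound setT Lg.
apply/(@metricType_numDomainType.cvgrPdist_lt _ _ _ _ _ g (g x)) => e e0.
have K1 : 0 < lipc setT g + 1 by rewrite ltr_wpDl.
have : nbhs x (ball x (e / (lipc setT g + 1))) by apply: nbhsx_ballx; rewrite divr_gt0.
apply: filterS => y; rewrite ballEmdist /= ltr_pdivlMr// => xy.
apply: le_lt_trans (hK _ _ I I) _; apply: le_lt_trans xy.
by rewrite mulrC ler_wpM2l ?mdist_ge0// lerDl.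
Qed.

Let inf_lip g z : has_inf [set lipc (ball z (rad k)) g | k in setT].
Proof.
split; first by exists (lipc (ball z (rad 0)) g); exists 0%N.
by exists 0 => _ [k _ <-]; exact: lipc_ge0.
Qed.

Lemma llip_ge0 g z : 0 <= llip g z.
Proof.
apply: lb_le_inf; first by have [] := inf_lip g z.
by move=> _ [k _ <-]; exact: lipc_ge0.
Qed.

Lemma llip_le k g z : llip g z <= lipc (ball z (rad k)) g.
Proof. by apply: ge_inf; [have [] := inf_lip g z|exists k]. Qed.

(** A small ball around z' lies inside the ball around z. This is where upper semicontinuity of
    local Lipschitz constants comes from. *)
Lemma llip_ball r g z z' : (Lip g < +oo)%E -> ball z r z' ->
  llip g z' <= lipc (ball z r) g.
Proof.
move=> Lg; rewrite ballEmdist /= => zz'.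
have e0 : 0 < r - mdist z z' by rewrite subr_gt0.
have [k _ hk] := rad_small e0; have {}hk := hk k (leqnn k).
apply: le_trans (llip_le k g z') _; apply: lipc_sub => // y.
rewrite !ballEmdist /= => yz'; have := metric_triangle z z' y.
by rewrite /= in hk; lra.
Qed.

Lemma llip_cvg g z : (Lip g < +oo)%E ->
  lipc (ball z (rad k)) g @[k --> \oo] --> llip g z.
Proof.
move=> Lg; apply: nonincreasing_cvgn; last by have [] := inf_lip g z.
move=> m n mn; apply: lipc_sub => //; apply: le_ball.
by rewrite /rad lef_pV2 ?posrE ?ltr0n// ler_nat.
Qed.

(** Two successive limits: with the radius around g z fixed, continuity of g maps all small balls
    around z into that ball; then the radius around g z shrinks. *)
Lemma llip_comp g h z : (Lip g < +oo)%E -> (Lip h < +oo)%E ->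
  llip (h \o g) z <= llip h (g z) * llip g z.
Proof.
move=> Lg Lh.
have key j : llip (h \o g) z <= lipc (ball (g z) (rad j)) h * llip g z.
  have : lipc (ball (g z) (rad j)) h * lipc (ball z (rad k)) g @[k --> \oo] -->
      lipc (ball (g z) (rad j)) h * llip g z.
    by apply: cvgM; [exact: cvg_cst|exact: llip_cvg].
  move=> /cvgr_to_ge; apply.
  have : nbhs z (g @^-1` (ball (g z) (rad j))).
    by apply: (Lip_continuous Lg); apply: nbhsx_ballx; exact: rad_gt0.
  move=> /nbhs_ballP[r /= r0 hr].
  near=> k; apply: le_trans (llip_le k _ z) _.
  apply: lipc_comp => // x zx; apply: hr; apply: le_ball zx.
  by apply: ltW; near: k; exact: rad_small.
have : lipc (ball (g z) (rad j)) h * llip g z @[j --> \oo] --> llip h (g z) * llip g z.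
  by apply: cvgM; [exact: llip_cvg|exact: cvg_cst].
by move=> /cvgr_to_ge; apply; apply: nearW.
Unshelve. all: by end_near. Qed.

Lemma local_LipE g z : (Lip g < +oo)%E -> local_Lip g z = (llip g z)%:E.
Proof.
move=> Lg; have : Lip_on (ball z r) g @[r --> 0^'+] -->
    ereal_inf [set Lip_on (ball z r) g | r in [set` Interval (BRight 0) +oo%O]].
  apply: nondecreasing_at_right_cvge => //.
  by move=> r s _ _ rs; apply: Lip_on_sub; exact: le_ball.
move=> /cvg_lim; rewrite /local_Lip => ->//.
apply/eqP; rewrite eq_le; apply/andP; split; last first.
  apply: le_ereal_inf_tmp => _ [r /= + <-]; rewrite in_itv/= andbT => r0.
  rewrite lipcE// lee_fin; apply: llip_ball => //; exact: ballxx.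
apply/lee_addgt0Pr => e e0.
have [_ [k _ <-] hk] := inf_adherent e0 (inf_lip g z).
apply: (@le_trans _ _ (lipc (ball z (rad k)) g)%:E); last by rewrite -EFinD lee_fin ltW.
rewrite -lipcE//; apply: ereal_inf_lbound; exists (rad k) => //=.
by rewrite in_itv/= andbT; exact: rad_gt0.
Qed.

End LocalLip.

(** * Measurability of distances and Lipschitz constants *)

Section MeasurableDistance.
Context {d : measure_display} {S : measurableType d} {R : realType}
  {X : pointedMetricType R}.
Hypothesis cX : compact [set: X].

Lemma measurable_sublevel (g : S -> R) :
  (forall r, measurable [set s | g s < r]) -> measurable_fun setT g.
Proof.
move=> mg mT; apply: (measurability _ (RGenInftyO.measurableE R)) => //.
move=> _ [_ [r ->] <-]; rewrite setTI.
by have := mg r; congr (measurable _); apply/seteqP; split => x /=; rewrite in_itv.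
Qed.

Lemma mdist_continuous (y : X) : continuous (fun x : X => mdist x y : R).
Proof.
apply: (@lipschitz_continuous _ _ _ 1) => x x'; rewrite mul1r lerBlDr.
exact: metric_triangle.
Qed.

Lemma open_ball (x : X) (r : R) : open (ball x r).
Proof.
have -> : ball x r = [set y | mdist y x < r].
  by apply/seteqP; split => y; rewrite ballEmdist /= metric_sym.
by apply: open_sublevel; exact: mdist_continuous.
Qed.

(** Two points are closer than r exactly when some point of the dense sequence has distances to them
    adding up to less than r; only distances to fixed points remain. *)
Lemma measurable_mdist (u v : S -> borel X) : measurable_fun setT u ->
  measurable_fun setT v -> measurable_fun setT (fun s => mdist (u s : X) (v s) : R).
Proof.
move=> mu mv; have [D hD] := dense_sequence cX.
have m1 (w : S -> borel X) y : measurable_fun setT w ->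
    measurable_fun setT (fun s => mdist (w s : X) y : R).
  move=> mw; exact: (measurableT_comp (continuous_borel (@mdist_continuous y)) mw).
apply: measurable_sublevel => r.
rewrite (_ : [set _ | _] =
  \bigcup_i [set s | mdist (u s : X) (D i) + mdist (v s : X) (D i) < r]).
  apply: bigcupT_measurable => i.
  have := measurable_funD (m1 u (D i) mu) (m1 v (D i) mv).
  move=> /(_ measurableT `]-oo, r[%classic (measurable_itv _)); rewrite setTI.
  by congr measurable; apply/seteqP; split => x /=; rewrite in_itv.
apply/seteqP; split => s /=.
  move=> h; have e0 : 0 < (r - mdist (u s : X) (v s)) / 2 by rewrite divr_gt0// subr_gt0.
  have [i hi] := hD (u s) _ e0; exists i => //=.
  have := metric_triangle (v s : X) (u s) (D i).
  by rewrite (metric_sym (v s : X) (u s)); lra.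
move=> [i _ /=]; have := metric_triangle (u s : X) (D i) (v s).
by rewrite (metric_sym (D i) (v s)); lra.
Qed.

(** As A s is open and u s continuous, a Lipschitz bound on A s need only be tested on pairs from
    the dense sequence that lie in A s; this leaves countably many conditions. *)
Lemma measurable_lipc (u : S -> X -> X) (A : S -> set X) :
  (forall s, (Lip (u s) < +oo)%E) -> (forall s, open (A s)) ->
  (forall y, measurable [set s | A s y]) ->
  (forall y, measurable_fun setT (fun s => u s y : borel X)) ->
  measurable_fun setT (fun s => lipc (A s) (u s)).
Proof.
move=> Lu oA mA mu; have [D hD] := dense_sequence cX.
apply: measurable_superlevel => t; rewrite -[X in measurable X]setCK; apply: measurableC.
have [t0|t0] := ltP t 0.
  rewrite (_ : ~` _ = set0)//; apply/seteqP; split => // s /= h; apply: h.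
  exact: lt_le_trans t0 (lipc_ge0 _ _).
rewrite (_ : ~` _ = \bigcap_i \bigcap_j (~` ([set s | A s (D i)] `&` [set s | A s (D j)]) `|`
   [set s | mdist (u s (D i)) (u s (D j)) <= t * mdist (D i) (D j)])).
  apply: bigcapT_measurable => i; apply: bigcapT_measurable => j.
  apply: measurableU; first by apply/measurableC/measurableI.
  have := measurable_mdist (mu (D i)) (mu (D j)).
  move=> /(_ measurableT `]-oo, (t * mdist (D i) (D j))]%classic (measurable_itv _)).
  rewrite setTI.
  by congr measurable; apply/seteqP; split => x /=; rewrite in_itv.
apply/seteqP; split => s /=.
  move=> /negP; rewrite -leNgt => h i _ j _.
  have [hij|] := pselect (A s (D i) /\ A s (D j)); last by left.
  right => /=; have [_ hl] := lipc_bound (A s) (Lu s).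
  apply: le_trans (hl _ _ hij.1 hij.2) _.
  by rewrite ler_wpM2r ?mdist_ge0.
move=> h; apply/negP; rewrite -leNgt; apply: lipc_le => //; split => // x y Ax Ay.
have [L0 hL] := lipc_bound setT (Lu s).
set K := lipc setT (u s) in L0 hL.
have [rx rx0 hrx] := open_sub_ball (oA s) Ax.
have [ry ry0 hry] := open_sub_ball (oA s) Ay.
apply/ler_addgt0Pr => e e0.
(* Moving x and y to dense points at distance less than [del] costs at most 2 (t + K) [del]; the
   added 1 keeps the divisor positive. *)
have c0 : 0 < 2 * (t + K) + 1 by rewrite ltr_wpDl// mulr_ge0// addr_ge0.
pose del := Num.min (Num.min rx ry) (e / (2 * (t + K) + 1)).
have del0 : 0 < del by rewrite !lt_min rx0 ry0 divr_gt0.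
have [i hi] := hD x _ del0; have [j hj] := hD y _ del0.
have Ai : A s (D i).
  by apply: hrx; rewrite ballEmdist /=; apply: lt_le_trans hi _; rewrite !ge_min lexx.
have Aj : A s (D j).
  by apply: hry; rewrite ballEmdist /=; apply: lt_le_trans hj _; rewrite !ge_min lexx orbT.
have [[]//|/= hij] := h i I j I.
have h1 : mdist (u s x) (u s (D i)) <= K * del.
  by apply: le_trans (hL _ _ I I) _; rewrite ler_wpM2l// ltW.
have h2 : mdist (u s (D j)) (u s y) <= K * del.
  by apply: le_trans (hL _ _ I I) _; rewrite ler_wpM2l// metric_sym ltW.
have h3 : t * mdist (D i) (D j) <= t * (mdist x y + 2 * del).
  rewrite ler_wpM2l//; have := metric_triangle (D i) x (D j).
  have := metric_triangle x y (D j); rewrite (metric_sym (D i) x).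
  by move: hi hj; lra.
have h4 : mdist (u s x) (u s y) <= K * del + t * (mdist x y + 2 * del) + K * del.
  have := metric_triangle (u s x) (u s (D i)) (u s y).
  have := metric_triangle (u s (D i)) (u s (D j)) (u s y).
  by lra.
have h5 : (2 * (t + K) + 1) * del <= e.
  by rewrite mulrC -ler_pdivlMr// ge_min lexx orbT.
have h6 : 0 <= del := ltW del0.
by lra.
Qed.

End MeasurableDistance.

Section GoodMap.
Context {d : measure_display} {T : measurableType d} {R : realType}
  {X : pointedMetricType R}.
Hypothesis cX : compact [set: X].
Variable f : sequences_in T -> X -> X.
Hypothesis gf : good_random_map f.
Local Notation Om := (sequences_in T).

Lemma iterateD a b (w : Om) x :
  iterate f (a + b) w x = iterate f b (seq_shift a w) (iterate f a w x).
Proof.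
elim: b => [|b ih]; first by rewrite addn0.
by rewrite addnS /= ih seq_shiftD.
Qed.

Lemma iterate_head n (w w' : Om) : (forall i, (i < n)%N -> w i = w' i) ->
  iterate f n w = iterate f n w'.
Proof.
elim: n => [//|n ih] h /=; rewrite ih; last by move=> i hi; apply: h; lia.
by congr (_ \o _); apply: (good_head gf); rewrite /seq_shift addn0 h.
Qed.

Lemma iterate_splice n k (w w' : Om) : (n <= k)%N ->
  iterate f n (splice k w w') = iterate f n w.
Proof.
by move=> nk; apply: iterate_head => i ni; rewrite /splice (leq_trans ni nk).
Qed.

Lemma iterate_spliceD k m (w w' : Om) x :
  iterate f (k + m) (splice k w w') x = iterate f m w' (iterate f k w x).
Proof. by rewrite iterateD seq_shift_splice iterate_splice. Qed.

Lemma iterate_lip n w : (Lip (iterate f n w) < +oo)%E.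
Proof.
elim: n => [|n ih]; first exact: Lip_id_lty.
by apply: Lip_comp_lty => //; exact: (good_lip gf).
Qed.

Lemma measurable_iterate n : measurable_fun setT
  (fun wx : Om * borel X => iterate f n wx.1 wx.2 : borel X).
Proof.
elim: n => [|n ih]; first exact: measurable_snd.
have mg : measurable_fun setT (fun wx : Om * borel X =>
    (seq_shift n wx.1, iterate f n wx.1 wx.2) : Om * borel X).
  apply: measurable_fun_pair => //.
  exact: (measurableT_comp (@measurable_seq_shift d T n) (@measurable_fst _ _ Om (borel X))).
exact: (measurableT_comp (good_measurable gf) mg).
Qed.

Lemma measurable_iterate_at n x :
  measurable_fun setT (fun w : Om => iterate f n w x : borel X).
Proof.
have mg : measurable_fun setT (fun w : Om => (w, x) : Om * borel X).
  by apply: measurable_fun_pair.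
exact: (measurableT_comp (measurable_iterate n) mg).
Qed.

Lemma measurable_ball_lip n r : measurable_fun setT
  (fun wx : Om * borel X => lipc (ball (wx.2 : X) r) (iterate f n wx.1)).
Proof.
apply: (@measurable_lipc _ (Om * borel X)%type R X cX (fun wx => iterate f n wx.1)
  (fun wx => ball (wx.2 : X) r)).
- by move=> wx; exact: iterate_lip.
- by move=> wx; exact: open_ball.
- move=> y; have m := @measurable_snd _ _ Om (borel X).
  have o : open [set z : X | mdist z y < r] by apply: open_sublevel; exact: mdist_continuous.
  have := m measurableT _ (open_borel o); rewrite setTI.
  by congr measurable; apply/seteqP; split => z; rewrite /= ballEmdist.
- move=> y; exact: (measurableT_comp (measurable_iterate_at n y)
    (@measurable_fst _ _ Om (borel X))).
Qed.

Lemma measurable_ball_lip_at n r x : measurable_fun setT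
  (fun w : Om => lipc (ball x r) (iterate f n w)).
Proof.
have mg : measurable_fun setT (fun w : Om => (w, x) : Om * borel X).
  by apply: measurable_fun_pair.
exact: (measurableT_comp (measurable_ball_lip n r) mg).
Qed.

Lemma measurable_llip n : measurable_fun setT
  (fun wx : Om * borel X => llip (iterate f n wx.1) wx.2).
Proof.
apply: (measurable_fun_cvg (fun k => measurable_ball_lip n (rad k))).
by move=> wx _; apply: llip_cvg; exact: iterate_lip.
Qed.

Lemma measurable_llip_at n x : measurable_fun setT
  (fun w : Om => llip (iterate f n w) x).
Proof.
have mg : measurable_fun setT (fun w : Om => (w, x) : Om * borel X).
  by apply: measurable_fun_pair.
exact: (measurableT_comp (measurable_llip n) mg).
Qed.

Definition loglip (w : Om) : R := ln (Num.max 1 (lipc setT (f w))).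

Lemma measurable_loglip : measurable_fun setT loglip.
Proof.
apply: (measurableT_comp (@measurable_ln R)); apply: measurable_maxr => //.
apply: (@measurable_lipc _ Om R X cX f (fun _ => setT)).
- exact: (good_lip gf).
- by move=> _; exact: openT.
- by move=> y; rewrite (_ : [set _ | _] = setT)//; apply/seteqP; split.
- move=> y; have := measurable_iterate_at 1 y.
  by congr measurable_fun; apply/funext => w /=; rewrite seq_shift0.
Qed.

Lemma loglip_ge0 w : 0 <= loglip w.
Proof. by rewrite /loglip ln_ge0// le_max lexx. Qed.

Lemma loglip_head (w w' : Om) : w 0%N = w' 0%N -> loglip w = loglip w'.
Proof. by move=> e; rewrite /loglip (good_head gf e). Qed.

(** It bounds the logarithm of every Lipschitz constant of the n-th iterate, on any set, hence is an
    integrable dominating function uniform in the starting point. *)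
Definition sumlip n (w : Om) : R := \sum_(i < n) loglip (seq_shift i w).

Lemma sumlip_ge0 n w : 0 <= sumlip n w.
Proof. by apply: sumr_ge0 => i _; exact: loglip_ge0. Qed.

Lemma sumlipS n w : sumlip n.+1 w = sumlip n w + loglip (seq_shift n w).
Proof. by rewrite /sumlip big_ord_recr. Qed.

Lemma sumlip_head n (w w' : Om) : (forall i, (i < n)%N -> w i = w' i) ->
  sumlip n w = sumlip n w'.
Proof.
move=> h; apply: eq_bigr => i _; apply: loglip_head.
by rewrite /seq_shift addn0 h.
Qed.

Lemma lipc_iterate_le A n w : lipc A (iterate f n w) <= expR (sumlip n w).
Proof.
apply: le_trans (lipc_sub (iterate_lip n w) (@subsetT _ A)) _.
elim: n => [|n ih].
  rewrite /sumlip big_ord0 expR0; apply: lipc_le; first exact: Lip_id_lty.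
  by split => // x y _ _; rewrite mul1r.
rewrite sumlipS expRD mulrC.
apply: (@le_trans _ _ (lipc setT (f (seq_shift n w)) * lipc setT (iterate f n w))).
  by apply: lipc_comp => //; [exact: iterate_lip|exact: (good_lip gf)].
apply: ler_pM => //; try exact: lipc_ge0.
by rewrite /loglip lnK ?posrE ?lt_max ?ltr01// le_max lexx orbT.
Qed.

End GoodMap.

(** * Truncated logarithms and finite-time exponents *)

Section TruncatedLog.
Context {R : realType}.
Implicit Types a b s t : R.

(** This is max(log t, -a), written so that it is finite at t = 0 as well. *)
Definition tlog a t : R := ln (Num.max t (expR (- a))).

Lemma tlog_arg_gt0 a t : 0 < Num.max t (expR (- a)).
Proof. by rewrite lt_max expR_gt0 orbT. Qed.

Lemma tlog_ge a t : - a <= tlog a t.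
Proof. by rewrite -[leLHS]expRK ler_ln ?posrE ?expR_gt0 ?tlog_arg_gt0// le_max lexx orbT. Qed.

Lemma tlog_le_of a s t : t <= expR s -> - a <= s -> tlog a t <= s.
Proof.
move=> ts as_; rewrite -[leRHS]expRK ler_ln ?posrE ?expR_gt0 ?tlog_arg_gt0//.
by rewrite ge_max ts ler_expR.
Qed.

Lemma le_tlog a s t : s <= t -> tlog a s <= tlog a t.
Proof.
move=> st; rewrite ler_ln ?posrE ?tlog_arg_gt0//.
by rewrite ge_max !le_max st lexx orbT.
Qed.

Lemma tlog_anti a b t : a <= b -> tlog b t <= tlog a t.
Proof.
move=> ab; rewrite ler_ln ?posrE ?tlog_arg_gt0//.
by rewrite ge_max !le_max lexx ler_expR lerN2 ab orbT.
Qed.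

Lemma expR_tlog_ge a t : t <= expR (tlog a t).
Proof. by rewrite lnK ?posrE ?tlog_arg_gt0// le_max lexx. Qed.

(** The cut-off levels add up, which is why later levels are multiples of the number of steps. *)
Lemma tlogM a b s t : 0 <= s -> 0 <= t -> tlog (a + b) (s * t) <= tlog a s + tlog b t.
Proof.
move=> s0 t0; rewrite -lnM ?posrE ?tlog_arg_gt0// ler_ln ?posrE ?mulr_gt0 ?tlog_arg_gt0//.
rewrite ge_max opprD expRD; apply/andP; split; apply: ler_pM;
  by rewrite ?expR_ge0// le_max lexx ?orbT.
Qed.

Lemma tlog_norm_le a s t : t <= expR s -> 0 <= s -> 0 <= a -> `|tlog a t| <= s + a.
Proof.
move=> ts s0 a0; rewrite ler_norml; apply/andP; split.
  by apply: le_trans (tlog_ge a t); lra.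
by apply: le_trans (tlog_le_of ts _) _; lra.
Qed.

Lemma tlog_cvg a (u : nat -> R) t : u k @[k --> \oo] --> t ->
  tlog a (u k) @[k --> \oo] --> tlog a t.
Proof.
move=> ut.
have cmax : {for t, continuous (fun s : R => Num.max s (expR (- a)))}.
  by apply: continuous_max; [exact: cvg_id|exact: cvg_cst].
have ct := continuous_comp cmax (continuous_ln (tlog_arg_gt0 a t)).
exact: (continuous_cvg _ ct ut).
Qed.

Lemma measurable_tlog {d} {S : measurableType d} a (g : S -> R) :
  measurable_fun setT g -> measurable_fun setT (fun x => tlog a (g x)).
Proof.
move=> mg; apply: (measurableT_comp (@measurable_ln R)).
by apply: measurable_maxr.
Qed.

End TruncatedLog.

Section BernoulliExpect.
Context {d : measure_display} {T : measurableType d} {R : realType}.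
Variables (p : probability T R) (P : probability (sequences_in T) R).
Hypothesis bP : is_bernoulli p P.
Local Notation Om := (sequences_in T).

Lemma integ_shift k (g : Om -> R) : integ P g -> integ P (fun w => g (seq_shift k w)).
Proof.
move=> gi; apply: (law_integ (mphi := @measurable_seq_shift d T k)).
by apply: eq_integ gi => A mA; rewrite (shift_law bP).
Qed.

Lemma expect_shift k (g : Om -> R) : integ P g ->
  expect P (fun w => g (seq_shift k w)) = expect P g.
Proof.
move=> gi.
rewrite -(expect_law (@measurable_seq_shift d T k) (integ_measurable gi) (integ_shift k gi)).
by apply: eq_expect => A mA; rewrite (shift_law bP).
Qed.

Lemma integ_splice k (F : Om -> R) : integ P F ->
  integ (product_probability P P) (fun ww => F (splice k ww.1 ww.2)).
Proof.
move=> Fi; apply: (law_integ (mphi := @measurable_splice d T k)).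
by apply: eq_integ Fi => A mA; rewrite (splice_law bP).
Qed.

(** Fubini for [splice]: conditioning on the first k symbols. *)
Lemma expect_splice k (F : Om -> R) : integ P F ->
  (forall w, integ P (fun w' => F (splice k w w'))) ->
  expect P F = expect P (fun w => expect P (fun w' => F (splice k w w'))).
Proof.
move=> Fi Fwi; rewrite -(expect_fubini1 (integ_splice k Fi))//.
have := expect_law (@measurable_splice d T k) (integ_measurable Fi) (integ_splice k Fi).
move=> <-.
by apply: eq_expect => A mA; rewrite (splice_law bP).
Qed.

End BernoulliExpect.

Section Exponents.
Context {d : measure_display} {T : measurableType d} {R : realType}
  {X : pointedMetricType R}.
Hypothesis cX : compact [set: X].
Variables (p : probability T R) (P : probability (sequences_in T) R).
Hypothesis bP : is_bernoulli p P.
Variable f : sequences_in T -> X -> X.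
Hypothesis gf : good_random_map f.
Hypothesis iY : integ P (loglip f).
Local Notation Om := (sequences_in T).
Local Notation m1 := (expect P (loglip f)).

Lemma integ_sumlip n : integ P (sumlip f n).
Proof.
exact: (@integ_sum _ _ _ P (fun i w => loglip f (seq_shift i w)) n
  (fun i => integ_shift bP i iY)).
Qed.

Lemma expect_sumlip n : expect P (sumlip f n) = n%:R * m1.
Proof.
rewrite (_ : sumlip f n = fun w => \sum_(i < n) loglip f (seq_shift i w))//.
rewrite (@expect_sum _ _ _ P (fun i w => loglip f (seq_shift i w)) n
  (fun i => integ_shift bP i iY)).
under eq_bigr do rewrite (expect_shift bP)//.
by rewrite sumr_const card_ord mulr_natl.
Qed.

Lemma m1_ge0 : 0 <= m1.
Proof. by apply: expect_ge0 => w; exact: loglip_ge0. Qed.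

Definition loc_log n (a : R) (w : Om) (x : X) : R := tlog a (llip (iterate f n w) x).
Definition ball_log n (a r : R) (w : Om) (x : X) : R :=
  tlog a (lipc (ball x r) (iterate f n w)).

Lemma llip_iterate_le n w x : llip (iterate f n w) x <= expR (sumlip f n w).
Proof. by apply: le_trans (llip_le 0 _ x) _; exact: lipc_iterate_le. Qed.

Lemma loc_log_norm n a w x : 0 <= a -> `|loc_log n a w x| <= sumlip f n w + a.
Proof.
by move=> a0; apply: tlog_norm_le => //; [exact: llip_iterate_le|exact: sumlip_ge0].
Qed.

Lemma ball_log_norm n a r w x : 0 <= a -> `|ball_log n a r w x| <= sumlip f n w + a.
Proof.
by move=> a0; apply: tlog_norm_le => //; [exact: lipc_iterate_le|exact: sumlip_ge0].
Qed.

Let integ_bd n a : integ P (fun w => sumlip f n w + a).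
Proof. by apply: integD; [exact: integ_sumlip|exact: integ_cst]. Qed.

Lemma measurable_loc_log n a :
  measurable_fun setT (fun wx : Om * borel X => loc_log n a wx.1 wx.2).
Proof. exact: (measurable_tlog a (measurable_llip cX gf n)). Qed.

Lemma measurable_ball_log n a r x : measurable_fun setT (fun w => ball_log n a r w x).
Proof. exact: (measurable_tlog a (measurable_ball_lip_at cX gf n r x)). Qed.

Lemma integ_loc_log n a x : 0 <= a -> integ P (fun w => loc_log n a w x).
Proof.
move=> a0; apply: integ_dom (integ_bd n a) _.
  exact: (measurable_tlog a (measurable_llip_at cX gf n x)).
by move=> w; exact: loc_log_norm.
Qed.

Lemma integ_ball_log n a r x : 0 <= a -> integ P (fun w => ball_log n a r w x).
Proof.
move=> a0; apply: integ_dom (integ_bd n a) _; first exact: measurable_ball_log.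
by move=> w; exact: ball_log_norm.
Qed.

Definition loc_exp n a (x : X) : R := expect P (fun w => loc_log n a w x).
Definition ball_exp n a r (x : X) : R := expect P (fun w => ball_log n a r w x).

Lemma loc_exp_ge n a x : 0 <= a -> - a <= loc_exp n a x.
Proof.
move=> a0; rewrite -[leLHS](expect_cst P); apply: expect_le => [||w].
- exact: integ_cst.
- exact: integ_loc_log.
- exact: tlog_ge.
Qed.

Lemma loc_exp_le n a x : 0 <= a -> loc_exp n a x <= n%:R * m1.
Proof.
move=> a0; rewrite -expect_sumlip; apply: expect_le => [||w].
- exact: integ_loc_log.
- exact: integ_sumlip.
- apply: tlog_le_of; first exact: llip_iterate_le.
  by rewrite (@le_trans _ _ 0)// ?oppr_le0// sumlip_ge0.
Qed.

Lemma loc_exp_norm n a x : 0 <= a -> `|loc_exp n a x| <= n%:R * m1 + a.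
Proof.
move=> a0; have := loc_exp_ge n x a0; have := loc_exp_le n x a0.
have : 0 <= n%:R * m1 by rewrite mulr_ge0// m1_ge0.
by rewrite ler_norml => *; apply/andP; split; lra.
Qed.

Lemma loc_exp_anti n a b x : 0 <= a -> a <= b -> loc_exp n b x <= loc_exp n a x.
Proof.
move=> a0 ab; apply: expect_le => [||w].
- by apply: integ_loc_log; exact: le_trans ab.
- exact: integ_loc_log.
- exact: tlog_anti.
Qed.

Lemma ball_exp_cvg n a x : 0 <= a ->
  ball_exp n a (rad k) x @[k --> \oo] --> loc_exp n a x.
Proof.
move=> a0; apply: (expect_cvg (g := fun w => sumlip f n w + a)).
- by move=> k; exact: measurable_ball_log.
- exact: integ_bd.
- by move=> k w; exact: ball_log_norm.
- by move=> w; apply: tlog_cvg; apply: llip_cvg; exact: iterate_lip.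
Qed.

Lemma loc_exp_ball n a r x z : 0 <= a -> ball x r z -> loc_exp n a z <= ball_exp n a r x.
Proof.
move=> a0 xz; apply: expect_le => [||w].
- exact: integ_loc_log.
- exact: integ_ball_log.
- by apply: le_tlog; apply: llip_ball => //; exact: iterate_lip.
Qed.

Lemma ball_exp_sub n a r s x z : 0 <= a -> ball z s `<=` ball x r ->
  ball_exp n a s z <= ball_exp n a r x.
Proof.
move=> a0 zx; apply: expect_le => [||w].
- exact: integ_ball_log.
- exact: integ_ball_log.
- by apply: le_tlog; apply: lipc_sub => //; exact: iterate_lip.
Qed.

Lemma ball_exp_lt n a x t : 0 <= a -> loc_exp n a x < t ->
  exists2 r, 0 < r & ball_exp n a r x < t.
Proof.
move=> a0 lt; have := @ball_exp_cvg n a x a0 => /cvgr_lt /(_ t lt) [k _ hk].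
by exists (rad k); [exact: rad_gt0|exact: (hk k (leqnn k))].
Qed.

(** If the mean over a ball around x is below t, then so is the mean at each point of that ball;
    dominated convergence supplies such a ball. *)
Lemma loc_exp_usc n a t : 0 <= a -> open [set x | loc_exp n a x < t].
Proof.
move=> a0; rewrite openE => x /= /(ball_exp_lt a0)[r r0 hr].
apply/nbhs_ballP; exists r => //= z xz.
exact: le_lt_trans (loc_exp_ball n a0 xz) hr.
Qed.

Lemma measurable_loc_exp n a : 0 <= a ->
  measurable_fun setT (loc_exp n a : borel X -> R).
Proof.
move=> a0; apply: measurable_sublevel => t.
by apply: open_borel; exact: loc_exp_usc.
Qed.

Lemma integ_loc_exp_comp k m b x : 0 <= b ->
  integ P (fun w => loc_exp m b (iterate f k w x)).
Proof.
move=> b0; apply: (@integ_bounded _ _ _ P _ (m%:R * m1 + b)).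
  exact: (measurableT_comp (measurable_loc_exp m b0) (measurable_iterate_at gf k x)).
by move=> w; exact: loc_exp_norm.
Qed.

Lemma sumlip_spliceD k m (w w' : Om) :
  sumlip f (k + m) (splice k w w') = sumlip f k w + sumlip f m w'.
Proof.
rewrite /sumlip big_split_ord /=; congr (_ + _); apply: eq_bigr => i _.
  by apply: (loglip_head gf); rewrite /seq_shift addn0 /splice ltn_ord.
by rewrite -seq_shiftD seq_shift_splice.
Qed.

(** The chain rule at time k, averaged: given the first k symbols, the last m steps are a fresh
    random map started at the point already reached. *)
Lemma loc_exp_subadd k m a b x : 0 <= a -> 0 <= b ->
  loc_exp (k + m) (a + b) x <=
  loc_exp k a x + expect P (fun w => loc_exp m b (iterate f k w x)).
Proof.
move=> a0 b0; have ab0 : 0 <= a + b by rewrite addr_ge0.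
have mjoint : measurable_fun setT (fun ww : Om * Om =>
    loc_log m b ww.2 (iterate f k ww.1 x)).
  have mg : measurable_fun setT (fun ww : Om * Om =>
      (ww.2, iterate f k ww.1 x) : Om * borel X).
    apply: measurable_fun_pair; first exact: measurable_snd.
    exact: (measurableT_comp (measurable_iterate_at gf k x) (@measurable_fst _ _ Om Om)).
  exact: (measurableT_comp (measurable_loc_log m b) mg).
have sect w : integ P (fun w' => loc_log (k + m) (a + b) (splice k w w') x).
  apply: (@integ_dom _ _ _ P _ (fun w' => sumlip f m w' + (sumlip f k w + (a + b)))).
  - have ms : measurable_fun setT (splice k w : Om -> Om).
      have mw : measurable_fun setT (fun w' : Om => (w, w')) by exact: measurable_fun_pair.
      exact: (measurableT_comp (measurable_splice k) mw).
    exact: (measurableT_comp (measurable_tlog (a + b) (measurable_llip_at cX gf (k + m) x)) ms).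
  - exact: integ_bd.
  - move=> w'; apply: le_trans (loc_log_norm _ _ _ ab0) _.
    by rewrite sumlip_spliceD; lra.
rewrite {1}/loc_exp (expect_splice bP (integ_loc_log (k + m) x ab0) sect).
rewrite -expectD; last 2 first.
- exact: integ_loc_log.
- exact: integ_loc_exp_comp.
apply: expect_le => [||w].
- have := integ_fubini1 (integ_splice bP k (integ_loc_log (k + m) x ab0)) sect.
  exact.
- by apply: integD; [exact: integ_loc_log|exact: integ_loc_exp_comp].
rewrite /loc_exp -[X in _ <= X + _](expect_cst P) -expectD; last 2 first.
- exact: integ_cst.
- exact: integ_loc_log.
apply: expect_le => [||w'].
- exact: sect.
- by apply: integD; [exact: integ_cst|exact: integ_loc_log].
apply: (@le_trans _ _ (tlog (a + b)
    (llip (iterate f k w) x * llip (iterate f m w') (iterate f k w x)))).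
  apply: le_tlog; rewrite mulrC.
  rewrite (_ : iterate f (k + m) (splice k w w') = iterate f m w' \o iterate f k w).
    by apply: llip_comp; exact: iterate_lip.
  by apply/funext => y; rewrite (iterate_spliceD gf).
by apply: tlogM; exact: llip_ge0.
Qed.

End Exponents.

(** * Stationary measures and Lyapunov exponents *)

Section UpperSemicontinuous.
Context {R : realType} {X : pointedMetricType R}.
Hypothesis cX : compact [set: X].
Variables (a : X -> R) (M : R).
Hypothesis usc : forall t, open [set x | a x < t].
Hypothesis aM : forall x, `|a x| <= M.

(* Lipschitz envelopes, decreasing to the upper semicontinuous function a. *)
Let env (k : nat) (x : X) : R := sup [set a y - k%:R * mdist x y | y in setT].

Let env_sup k x : has_sup [set a y - k%:R * mdist x y | y in setT].
Proof.
split; first by exists (a x - k%:R * mdist x x), x.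
exists M => _ [y _ <-]; have := aM y; rewrite ler_norml => /andP[_ h].
by rewrite lerBlDr (le_trans h)// lerDl mulr_ge0// mdist_ge0.
Qed.

Let env_ge k x : a x <= env k x.
Proof.
apply: ub_le_sup; first by have [] := env_sup k x.
by exists x => //; rewrite mdistxx mulr0 subr0.
Qed.

Let env_le k x : env k x <= M.
Proof.
apply: ge_sup; first by have [] := env_sup k x.
move=> _ [y _ <-]; have := aM y; rewrite ler_norml => /andP[_ h].
by rewrite lerBlDr (le_trans h)// lerDl mulr_ge0// mdist_ge0.
Qed.

Let env_continuous k : continuous (env k).
Proof.
apply: (@lipschitz_continuous _ _ _ k%:R) => x x'.
rewrite lerBlDr; apply: ge_sup; first by have [] := env_sup k x.
move=> _ [y _ <-].
have : a y - k%:R * mdist x' y <= env k x'.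
  by apply: ub_le_sup; [have [] := env_sup k x'|exists y].
have : k%:R * mdist x' y <= k%:R * (mdist x x' + mdist x y).
  rewrite ler_wpM2l//; have := metric_triangle x' x y.
  by rewrite (metric_sym x' x).
by lra.
Qed.

Let env_cvg x : env k x @[k --> \oo] --> a x.
Proof.
apply/cvgrPdist_le => e e0.
have [r r0 hr] : exists2 r : R, 0 < r & ball x r `<=` [set y | a y < a x + e].
  by apply: open_sub_ball; [exact: usc|rewrite /= ltrDl].
near=> k; rewrite ler_norml; apply/andP; split; last first.
  by have := env_ge k x; lra.
suff : env k x <= a x + e by lra.
apply: ge_sup; first by have [] := env_sup k x.
move=> _ [y _ <-]; have [xy|xy] := ltP (mdist x y) r.
  have /= := hr y; rewrite ballEmdist /= => /(_ xy) ay.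
  have : 0 <= k%:R * mdist x y by rewrite mulr_ge0// mdist_ge0.
  by lra.
(* Outside the ball of radius r the penalty exceeds the oscillation 2 M of [a], so only nearby y
   matter to the envelope at x. *)
have kr : 2 * M <= k%:R * mdist x y.
  apply: (@le_trans _ _ (k%:R * r)); last by rewrite ler_wpM2l.
  by rewrite -ler_pdivrMr//; near: k; exact: nbhs_infty_ger.
have := aM y; have := aM x; rewrite !ler_norml => /andP[h1 h2] /andP[h3 h4].
by lra.
Unshelve. all: by end_near. Qed.

(** A limit measure is known through continuous functions only; the envelopes are continuous
    majorants whose integrals converge to that of [a]. *)
Lemma usc_expect_ge (mu : probability (borel X) R) (C : R) :
  (forall phi : X -> R, continuous phi -> (forall x, a x <= phi x) ->
    C <= expect mu phi) -> C <= expect mu a.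
Proof.
move=> hC.
have : expect mu (env k) @[k --> \oo] --> expect mu (a : borel X -> R).
  apply: (expect_cvg (g := fun _ => M)).
  - by move=> k; apply: continuous_borel; exact: env_continuous.
  - exact: integ_cst.
  - move=> k x; rewrite ler_norml env_le andbT.
    by have := aM x; have := env_ge k x; rewrite ler_norml => ? /andP[]; lra.
  - exact: env_cvg.
by move=> /cvgr_to_ge; apply; apply: nearW => k; exact: hC.
Qed.

End UpperSemicontinuous.

Section UltraLimit.
Context {R : realType}.

(** Compactness of [-M, M]. A single ultrafilter gives limits for all test functions at once, in
    place of a diagonal extraction. *)
Lemma ultra_bounded_cvg (U : set_system nat) (u : nat -> R) (M : R) :
  UltraFilter U -> (forall n, `|u n| <= M) -> cvg (u n @[n --> U]).
Proof.
move=> UU uM; have PU : ProperFilter U by exact: ultra_proper.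
have uI : U (u @^-1` `[- M, M]%classic).
  by apply: filterE => n /=; rewrite in_itv /= -ler_norml; exact: uM.
have [l [_ ul]] := @segment_compact R (- M) M (u @ U) _ uI.
apply/cvg_ex; exists l => V lV; have [//|UV] := in_ultra_setVsetC (u @^-1` V) UU.
by have [y []] := ul (~` V) V UV lV.
Qed.

End UltraLimit.

(** * Limits of averaged orbits *)

Section KrylovBogoliubov.
Context {d : measure_display} {T : measurableType d} {R : realType}
  {X : pointedMetricType R}.
Hypothesis cX : compact [set: X].
Variables (p : probability T R) (P : probability (sequences_in T) R).
Hypothesis bP : is_bernoulli p P.
Variable f : sequences_in T -> X -> X.
Hypothesis gf : good_random_map f.
Local Notation Om := (sequences_in T).

Definition markov_op (phi : X -> R) (x : X) : R := expect P (fun w => phi (f w x)).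

Lemma integ_iterate_comp (phi : borel X -> R) (M : R) k x :
  measurable_fun setT phi -> (forall y, `|phi y| <= M) ->
  integ P (fun w => phi (iterate f k w x)).
Proof.
move=> mphi phiM; apply: (@integ_bounded _ _ _ P _ M) => //.
exact: (measurableT_comp mphi (measurable_iterate_at gf k x)).
Qed.

Lemma integ_map_comp (phi : borel X -> R) (M : R) x :
  measurable_fun setT phi -> (forall y, `|phi y| <= M) ->
  integ P (fun w => phi (f w x)).
Proof.
move=> mphi phiM; have := integ_iterate_comp 1 x mphi phiM.
by congr integ; apply/funext => w /=; rewrite seq_shift0.
Qed.

(** The Feller property. Arguing by contradiction with radii [rad k] yields a sequence converging to
    x, to which dominated convergence applies. *)
Lemma markov_op_continuous (phi : X -> R) : continuous phi ->
  continuous (markov_op phi).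
Proof.
move=> cphi x; have [M phiM] := continuous_bounded cX cphi.
have mphi := continuous_borel cphi.
apply: contrapT => /cvgrPdist_lt/existsNP[e /not_implyP[e0 he]].
have ex k : exists y, ball x (rad k) y /\ e <= `|markov_op phi x - markov_op phi y|.
  apply: contrapT => /forallNP h; apply: he.
  apply/nbhs_ballP; exists (rad k : R); first exact: rad_gt0.
  move=> y xy /=; rewrite ltNge; apply/negP => hy; apply: (h y); split => //.
have [y hy] := choice ex.
have yx : y k @[k --> \oo] --> x.
  apply/(@metricType_numDomainType.cvgrPdist_lt _ _ _ _ _ y x) => t t0.
  have [k _ hk] := rad_small t0; exists k => // j kj; have [] := hy j.
  rewrite ballEmdist /= => h _; apply: lt_trans h _; exact: hk.
have : markov_op phi (y k) @[k --> \oo] --> markov_op phi x.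
  apply: (expect_cvg (g := fun _ => M)).
  - by move=> k; exact: integ_measurable (integ_map_comp (y k) mphi phiM).
  - exact: integ_cst.
  - by move=> k w; exact: phiM.
  - move=> w; apply: (continuous_cvg _ (cphi (f w x))).
    apply: (continuous_cvg _ _ yx).
    exact: (Lip_continuous (good_lip gf w)).
move=> /cvgrPdist_lt /(_ e e0)[k _ hk].
have [_] := hy k; rewrite leNgt => /negP; apply.
exact: hk (leqnn k).
Qed.

(** The Markov property: splicing at time k makes the next map independent of the point reached. *)
Lemma expect_markov_op_iterate (phi : X -> R) k x : continuous phi ->
  expect P (fun w => markov_op phi (iterate f k w x)) =
  expect P (fun w => phi (iterate f k.+1 w x)).
Proof.
move=> cphi; have [M phiM] := continuous_bounded cX cphi.
have mphi := continuous_borel cphi.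
have e (w w' : Om) : iterate f k.+1 (splice k w w') x = f w' (iterate f k w x).
  by rewrite -addn1 (iterate_spliceD gf) /= seq_shift0.
rewrite [RHS](expect_splice bP (k := k)); last 2 first.
- exact: integ_iterate_comp mphi phiM.
- move=> w; have := integ_map_comp (iterate f k w x) mphi phiM.
  by congr integ; apply/funext => w'; rewrite e.
congr expect; apply/funext => w; rewrite /markov_op.
by congr expect; apply/funext => w'; rewrite e.
Qed.

Variable xs : nat -> X.

Let avg (phi : X -> R) (n : nat) : R :=
  n.+1%:R^-1 * \sum_(k < n.+1) expect P (fun w => phi (iterate f k w (xs n))).

Let expect_iterate_bound (phi : X -> R) (M : R) k x : continuous phi ->
  (forall y, `|phi y| <= M) -> `|expect P (fun w => phi (iterate f k w x))| <= M.
Proof.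
move=> cphi phiM; have mphi := continuous_borel cphi.
have ip := integ_iterate_comp k x mphi phiM.
rewrite ler_norml; apply/andP; split.
  rewrite -[leLHS](expect_cst P); apply: expect_le => // [|w]; first exact: integ_cst.
  by have := phiM (iterate f k w x); rewrite ler_norml => /andP[].
rewrite -[leRHS](expect_cst P); apply: expect_le => // [|w]; first exact: integ_cst.
by have := phiM (iterate f k w x); rewrite ler_norml => /andP[].
Qed.

Let avg_bound (phi : X -> R) (M : R) n : continuous phi ->
  (forall y, `|phi y| <= M) -> `|avg phi n| <= M.
Proof.
move=> cphi phiM; rewrite /avg normrM normfV (gtr0_norm (ltr0Sn R n)).
rewrite mulrC ler_pdivrMr ?ltr0n//; apply: le_trans (ler_norm_sum _ _ _) _.
apply: (@le_trans _ _ (\sum_(k < n.+1) M)).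
  by apply: ler_sum => k _; exact: expect_iterate_bound.
by rewrite sumr_const card_ord mulr_natr.
Qed.

Let avgD (phi psi : X -> R) n : continuous phi -> continuous psi ->
  avg (fun x => phi x + psi x) n = avg phi n + avg psi n.
Proof.
move=> cphi cpsi; have [M phiM] := continuous_bounded cX cphi.
have [N psiN] := continuous_bounded cX cpsi.
rewrite /avg -mulrDr -big_split /=; congr (_ * _); apply: eq_bigr => k _.
rewrite expectD//; apply: integ_iterate_comp; try exact: continuous_borel;
  [exact: phiM|exact: psiN].
Qed.

Let avgZ (a : R) (phi : X -> R) n : continuous phi ->
  avg (fun x => a * phi x) n = a * avg phi n.
Proof.
move=> cphi; have [M phiM] := continuous_bounded cX cphi.
rewrite /avg [RHS]mulrCA [in RHS]mulr_sumr; congr (_ * _); apply: eq_bigr => k _.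
by rewrite expectZ//; apply: integ_iterate_comp phiM; exact: continuous_borel.
Qed.

(* Telescoping: averaging [markov_op phi] shifts the orbit by one step. *)
Let avg_markov_op (phi : X -> R) (M : R) n : continuous phi ->
  (forall y, `|phi y| <= M) ->
  `|avg (markov_op phi) n - avg phi n| <= n.+1%:R^-1 * (2 * M).
Proof.
move=> cphi phiM; rewrite /avg -mulrBr normrM ger0_norm ?invr_ge0//.
rewrite ler_wpM2l ?invr_ge0//.
under eq_bigr do rewrite expect_markov_op_iterate//.
rewrite -[X in X - _](big_mkord xpredT
  (fun k => expect P (fun w => phi (iterate f k.+1 w (xs n))))).
rewrite -[X in _ - X](big_mkord xpredT
  (fun k => expect P (fun w => phi (iterate f k w (xs n))))).
rewrite -sumrB telescope_sumr//.
apply: le_trans (ler_normB _ _) _; rewrite mulr_natl mulr2n.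
by apply: lerD; exact: expect_iterate_bound.
Qed.

(** The measure represents the ultrafilter limit of averages along orbits started at [xs n], n + 1
    steps long. The second property passes lower bounds with an error of order 1 / n to the
    limit. *)
Lemma stationary_limit : exists mu : probability (borel X) R,
  (forall phi : X -> R, continuous phi -> expect mu (markov_op phi) = expect mu phi) /\
  (forall (phi : X -> R) (C D : R), continuous phi ->
    (\forall n \near \oo, C - D / n.+1%:R <= n.+1%:R^-1 *
      \sum_(k < n.+1) expect P (fun w => phi (iterate f k w (xs n)))) ->
    C <= expect mu phi).
Proof.
have [U [UU sU]] := ultraFilterLemma (eventually_filter : ProperFilter \oo).
have PU : ProperFilter U by exact: ultra_proper.
pose Lam (phi : X -> R) : R := lim (avg phi n @[n --> U]).
have cL (phi : X -> R) : continuous phi -> avg phi n @[n --> U] --> Lam phi.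
  move=> cphi; have [M phiM] := continuous_bounded cX cphi.
  by apply: (ultra_bounded_cvg (M := M)) => // n; exact: avg_bound.
have [||||mu hmu] := @riesz_representation R X Lam cX.
- move=> phi psi cphi cpsi; apply: cvg_lim => //.
  under eq_fun do rewrite avgD//.
  by apply: cvgD; exact: cL.
- move=> a phi cphi; apply: cvg_lim => //; under eq_fun do rewrite avgZ//.
  by apply: cvgM; [exact: cvg_cst|exact: cL].
- move=> phi cphi phi0; have := cL phi cphi => /cvgr_to_ge; apply.
  apply: filterE => n; rewrite mulr_ge0 ?invr_ge0//; apply: sumr_ge0 => k _.
  by apply: expect_ge0 => w; exact: phi0.
- apply: cvg_lim => //; rewrite (_ : avg _ = cst 1); first exact: cvg_cst.
  apply/funext => n; rewrite /avg; under eq_bigr do rewrite expect_cst.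
  by rewrite sumr_const card_ord /= -mulr_natr mul1r mulVf.
exists mu; split.
- move=> phi cphi; have [M phiM] := continuous_bounded cX cphi.
  have cQ := markov_op_continuous cphi.
  rewrite !hmu//; apply/eqP; rewrite -subr_eq0; apply/eqP.
  have h1 : avg (markov_op phi) n - avg phi n @[n --> U] --> Lam (markov_op phi) - Lam phi.
    by apply: cvgB; exact: cL.
  have h2 : avg (markov_op phi) n - avg phi n @[n --> U] --> (0 : R).
    apply: cvg_trans; first exact: (cvg_app _ sU).
    apply/cvgrPdist_le => e e0; near=> n.
    rewrite sub0r normrN; apply: le_trans (avg_markov_op n cphi phiM) _.
    rewrite mulrC ler_pdivrMr ?ltr0n// -ler_pdivrMl//.
    rewrite (@le_trans _ _ n%:R)// ?ler_nat//.
    by near: n; exact: nbhs_infty_ger.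
  exact: cvg_unique h1 h2.
- move=> phi C D cphi hC; rewrite hmu//.
  have h : avg phi n + D / n.+1%:R @[n --> U] --> Lam phi + 0.
    apply: cvgD; first exact: cL.
    apply: cvg_trans; first exact: (cvg_app _ sU).
    apply/cvgrPdist_le => e e0; near=> n.
    rewrite sub0r normrN normrM normfV (gtr0_norm (ltr0Sn _ _)).
    rewrite ler_pdivrMr ?ltr0n// -ler_pdivrMl//.
    rewrite (@le_trans _ _ n%:R)// ?ler_nat//.
    by near: n; exact: nbhs_infty_ger.
  rewrite -[leRHS]addr0; move/cvgr_to_ge : h; apply.
  by apply: sU; apply: filterS hC => n; rewrite lerBlDr.
Unshelve. all: by end_near. Qed.

End KrylovBogoliubov.

(** Telescoping with step m: only the m terms at each end survive. *)
Lemma sum_shift_sub {V : zmodType} (u : nat -> V) n m :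
  \sum_(k < n) (u (k + m)%N - u k) = \sum_(j < m) (u (n + j)%N - u j).
Proof.
elim: n => [|n ih].
  by rewrite big_ord0 big1// => j _; rewrite add0n subrr.
rewrite big_ord_recr ih /= !sumrB.
have h1 : \sum_(i < m.+1) u (n + i)%N = \sum_(i < m) u (n + i)%N + u (n + m)%N.
  by rewrite big_ord_recr.
have h2 : \sum_(i < m.+1) u (n + i)%N = u n + \sum_(i < m) u (n.+1 + i)%N.
  rewrite big_ord_recl addn0; congr (_ + _); apply: eq_bigr => i _.
  by rewrite lift0 addSnnS.
have -> : \sum_(i < m) u (n.+1 + i)%N = \sum_(i < m) u (n + i)%N + u (n + m)%N - u n.
  by rewrite -h1 h2 addrAC subrr add0r.
by rewrite -!addrA; congr (_ + _); rewrite addrC -addrA.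
Qed.

Section LimitMeasure.
Context {d : measure_display} {T : measurableType d} {R : realType}
  {X : pointedMetricType R}.
Hypothesis cX : compact [set: X].
Variables (p : probability T R) (P : probability (sequences_in T) R).
Hypothesis bP : is_bernoulli p P.
Variable f : sequences_in T -> X -> X.
Hypothesis gf : good_random_map f.
Hypothesis iY : integ P (loglip f).
Local Notation Om := (sequences_in T).
Local Notation m1 := (expect P (loglip f)).

(** By subadditivity the increment [a (k + m) - a k] is at most the mean of [phi] at time k: the
    level left for the last m steps is N * m, at least M * m. Summed over k < N - m the increments
    telescope to m differences between late and early values of [a]. Each is bounded below by -c N
    up to two errors [m * m1], whence [2 * m * m * m1]; the last m terms of the orbit sum cost m
    B. *)
Let orbit_sum_ge (c B : R) (phi : X -> R) (m M N : nat) (x : X) : continuous phi ->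
  (forall y, `|phi y| <= B) ->
  (forall y, loc_exp P f m (M * m)%:R y <= phi y) ->
  (m <= N)%N -> (M <= N)%N -> (0 < N)%N ->
  - (c * N%:R) <= loc_exp P f N (N * N)%:R x ->
  - (c * m%:R) * N%:R - (2 * m%:R * m%:R * m1 + m%:R * B) <=
  \sum_(k < N) expect P (fun w => phi (iterate f k w x)).
Proof.
move=> cphi phiB phiE mN MN N0 hx.
pose a k := loc_exp P f k (N * k)%:R x.
pose e k := expect P (fun w => phi (iterate f k w x)).
have iphi k : integ P (fun w => phi (iterate f k w x)).
  by apply: (integ_iterate_comp P gf k x (continuous_borel cphi) phiB).
have m10 : 0 <= m1 by exact: m1_ge0.
have ae k : a (k + m)%N - a k <= e k.
  rewrite lerBlDl /a mulnDr natrD.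
  apply: le_trans (loc_exp_subadd cX bP gf iY k m x (ler0n _ _) (ler0n _ _)) _.
  rewrite lerD2l; apply: expect_le => // [|w].
    exact: (integ_loc_exp_comp cX bP gf iY).
  apply: le_trans (phiE _); apply: (loc_exp_anti cX bP gf iY) => //.
  by rewrite ler_nat leq_mul2r MN orbT.
have aN j : (j < m)%N -> a N <= a (N - m + j)%N + m%:R * m1.
  move=> jm; have NE : N = (N - m + j + (m - j))%N by lia.
  have -> : a N = loc_exp P f (N - m + j + (m - j))
      ((N * (N - m + j))%:R + (N * (m - j))%:R) x by rewrite /a -natrD -mulnDr -NE.
  apply: le_trans (loc_exp_subadd cX bP gf iY _ _ x (ler0n _ _) (ler0n _ _)) _.
  rewrite lerD2l -[leRHS](expect_cst P); apply: expect_le => [||w].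
  - exact: (integ_loc_exp_comp cX bP gf iY).
  - exact: integ_cst.
  - apply: le_trans (loc_exp_le cX bP gf iY _ _ (ler0n _ _)) _.
    by rewrite ler_wpM2r// ler_nat leq_subr.
have aj j : (j < m)%N -> a j <= m%:R * m1.
  move=> jm; apply: le_trans (loc_exp_le cX bP gf iY _ _ (ler0n _ _)) _.
  by rewrite ler_wpM2r// ler_nat ltnW.
(* [aN] says that going from time N - m + j to N adds at most [m * m1]; [aj] bounds the early values
   by the same amount. *)
have h1 : m%:R * (- (c * N%:R) - 2 * m%:R * m1) <= \sum_(k < N - m) e k.
  apply: (@le_trans _ _ (\sum_(k < N - m) (a (k + m)%N - a k))); last first.
    by apply: ler_sum => k _; exact: ae.
  rewrite sum_shift_sub mulr_natl -[X in _ *+ X](card_ord m) -sumr_const.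
  have aux (u v s t z : R) : - z <= u -> u <= s + v -> t <= v -> - z - 2 * v <= s - t.
    by move=> *; lra.
  apply: ler_sum => j _; rewrite -mulrA.
  exact: aux hx (aN j (ltn_ord j)) (aj j (ltn_ord j)).
have h2 : - (m%:R * B) <= \sum_(k < m) e (N - m + k)%N.
  rewrite -mulrN mulr_natl -[X in _ *+ X](card_ord m) -sumr_const.
  apply: ler_sum => k _; rewrite -[leLHS](expect_cst P); apply: expect_le => // [|w].
    exact: integ_cst.
  by have := phiB (iterate f (N - m + k) w x); rewrite ler_norml => /andP[].
have -> : \sum_(k < N) expect P (fun w => phi (iterate f k w x)) =
    \sum_(k < N - m) e k + \sum_(k < m) e (N - m + k)%N.
  by rewrite -[in LHS](subnK mN) big_split_ord.
apply: le_trans (lerD h1 h2); rewrite le_eqVlt; apply/orP; left; apply/eqP; ring.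
Qed.

(* The truncation level n * n eventually exceeds M * m for every block of length m,
   whatever M, so that the truncation can be removed in the limit measure. *)
Lemma limit_measure (c : R) :
  (forall n, (1 <= n)%N -> exists x, - (c * n%:R) <= loc_exp P f n (n * n)%:R x) ->
  exists mu : probability (borel X) R,
  (forall phi : X -> R, continuous phi -> expect mu (markov_op P f phi) = expect mu phi) /\
  (forall m M : nat, - (c * m%:R) <= expect mu (loc_exp P f m (M * m)%:R)).
Proof.
move=> hx; have [xs hxs] := choice (fun n => hx n.+1 isT).
have [mu [mu1 mu2]] := stationary_limit cX bP gf xs.
exists mu; split => // m M.
apply: (usc_expect_ge (M := m%:R * m1 + (M * m)%:R)).
- by move=> t; apply: (loc_exp_usc cX bP gf iY).
- by move=> x; apply: (loc_exp_norm cX bP gf iY).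
- move=> phi cphi phiE; have [B phiB] := continuous_bounded cX cphi.
  apply: (mu2 phi _ (2 * m%:R * m%:R * m1 + m%:R * B)) => //.
  near=> n.
  have h := @orbit_sum_ge c B phi m M n.+1 (xs n) cphi phiB phiE.
  rewrite -ler_pdivrMl ?invr_gt0// invrK.
  rewrite (_ : n.+1%:R * _ = - (c * m%:R) * n.+1%:R - (2 * m%:R * m%:R * m1 + m%:R * B));
    last by field.
  apply: h => //.
  + by near: n; exists m => // k /= mk; rewrite (leq_trans mk).
  + by near: n; exists M => // k /= mk; rewrite (leq_trans mk).
Unshelve. all: by end_near. Qed.

Local Notation joint mu := (product_probability P mu).

Lemma measurable_skew : measurable_fun setT (skew_product f).
Proof.
apply: measurable_fun_pair; last exact: (good_measurable gf).
exact: (measurableT_comp (@measurable_seq_shift d T 1) (@measurable_fst _ _ Om (borel X))).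
Qed.

Section InvariantMeasure.
Variable mu : probability (borel X) R.
Hypothesis mu_inv : forall phi : X -> R, continuous phi ->
  expect mu (markov_op P f phi) = expect mu phi.

Let mev := good_measurable gf.

(** On continuous functions this is [mu_inv] after Fubini, and continuous functions determine a
    Borel probability. *)
Let law_ev (B : set (borel X)) : measurable B -> law (joint mu) mev B = mu B.
Proof.
apply: borel_probability_ext => phi cphi.
have [M phiM] := continuous_bounded cX cphi.
have mphi := continuous_borel cphi.
have ic : integ (joint mu) (fun wx => phi (f wx.1 wx.2)).
  apply: (@integ_bounded _ _ _ (joint mu) _ M) => //.
  exact: (measurableT_comp mphi mev).
rewrite (expect_law mev mphi ic) -[RHS]mu_inv//.
apply: (expect_fubini2 ic) => x.
exact: integ_map_comp mphi phiM.
Qed.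

Let indic_bound {S : Type} (A : set S) (s : S) : `|\1_A s : R| <= 1.
Proof. by rewrite indicE; case: (_ \in _); rewrite ?normr0 ?normr1. Qed.

(** The shifted sequence ignores the symbol at 0 and f sees nothing else, so after splicing at 1 the
    two indicators depend on independent sequences and the expectation factors. *)
Let law_skew (C : set Om) (B : set (borel X)) : measurable C -> measurable B ->
  law (joint mu) measurable_skew (C `*` B) = (P C * mu B)%E.
Proof.
move=> mC mB.
have mC1 : measurable (@seq_shift d T 1 @^-1` C).
  by rewrite -[X in measurable X]setTI; exact: measurable_seq_shift.
have mindB : measurable_fun setT (\1_B : borel X -> R) by exact: measurable_indic.
pose F (wx : Om * borel X) : R := \1_C (seq_shift 1 wx.1) * \1_B (f wx.1 wx.2).
have mF : measurable_fun setT F.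
  apply: measurable_funM.
    have ms := measurableT_comp (@measurable_seq_shift d T 1) (@measurable_fst _ _ Om (borel X)).
    have mi : measurable_fun setT (\1_C : Om -> R) by exact: measurable_indic.
    exact: (measurableT_comp mi ms).
  exact: (measurableT_comp mindB mev).
have F1 wx : `|F wx| <= 1.
  rewrite /F normrM -[leRHS]mulr1.
  by apply: ler_pM => //; exact: indic_bound.
have iF : integ (joint mu) F by apply: (@integ_bounded _ _ _ (joint mu) F 1).
have mx x : measurable_fun setT (fun w : Om => (w, x) : Om * borel X).
  by apply: measurable_fun_pair.
have iFx x : integ P (fun w => F (w, x)).
  apply: (@integ_bounded _ _ _ P _ 1) => //.
  exact: (measurableT_comp mF (mx x)).
have iBx x : integ P (fun w => \1_B (f w x) : R).
  exact: (integ_map_comp P gf x mindB (fun y => indic_bound B y)).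
have iC : integ P (\1_C : Om -> R) by exact: integrable_indic.
have key x : expect P (fun w => F (w, x)) = fine (P C) * expect P (fun w => \1_B (f w x)).
  have e w w' : F (splice 1 w w', x) = \1_B (f w x) * \1_C w'.
    rewrite /F /= seq_shift_splice mulrC; congr (_ * _).
    by rewrite (good_head gf (w' := w)).
  rewrite (expect_splice bP (k := 1)) //; last first.
    by move=> w; rewrite (_ : (fun w' => _) = (fun w' => \1_B (f w x) * \1_C w'));
      [exact: integZ|apply/funext => w'; exact: e].
  rewrite -expectZ//; congr expect; apply/funext => w.
  rewrite (_ : (fun w' => _) = (fun w' => \1_B (f w x) * \1_C w')); last first.
    by apply/funext => w'; exact: e.
  by rewrite expectZ// mulrC; congr (_ * _); rewrite -(expect_indic P mC).
have mCB : measurable (C `*` B) by exact: measurableX.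
rewrite -(expect_indic _ mCB) (expect_law measurable_skew); last 2 first.
- exact: measurable_indic.
- apply: (@integ_bounded _ _ _ (joint mu) _ 1); last by move=> z; exact: indic_bound.
  have mindCB : measurable_fun setT (\1_(C `*` B) : Om * borel X -> R).
    exact: measurable_indic.
  exact: (measurableT_comp mindCB measurable_skew).
rewrite (_ : _ \o _ = F); last first.
  apply/funext => -[w x]; rewrite /F /= !indicE in_setX /=.
  by case: (_ \in _); case: (_ \in _); rewrite ?mulr1 ?mulr0.
rewrite (expect_fubini2 iF iFx).
under eq_fun do rewrite key.
have iBm : integ (joint mu) (fun wx => \1_B (f wx.1 wx.2) : R).
  apply: (@integ_bounded _ _ _ (joint mu) _ 1); last by move=> z; exact: indic_bound.
  exact: (measurableT_comp mindB mev).
have iB2 : integ mu (fun x => expect P (fun w => \1_B (f w x))).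
  exact: (integ_fubini2 iBm iBx).
rewrite expectZ//.
have -> : expect mu (fun x => expect P (fun w => \1_B (f w x))) = expect mu \1_B.
  rewrite -(expect_fubini2 iBm iBx).
  rewrite -[LHS](expect_law mev (g := \1_B) mindB)//.
  by apply: eq_expect => A mA; exact: law_ev.
by rewrite EFinM fineK ?fin_num_measure// expect_indic.
Qed.

Lemma skew_invariant (A : set (Om * borel X)) : measurable A ->
  joint mu (skew_product f @^-1` A) = joint mu A.
Proof.
move=> mA; rewrite [RHS](product_probability_unique
  (Q := law (joint mu) measurable_skew))//; exact: law_skew.
Qed.

End InvariantMeasure.

End LimitMeasure.

(** * Removing the truncation: from means to Lyapunov exponents *)

Section LogPositivePart.
Context {R : realType}.
Local Open Scope ereal_scope.

Lemma lne_funepos (t : R) : (0 <= t)%R -> maxe (lne t%:E) 0 = (tlog 0 t)%:E.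
Proof.
move=> t0; rewrite /tlog oppr0 expR0.
have [t1|t1] := ltP t 1%R.
  by rewrite ln1 max_r// lne_le0 lee_fin ltW.
rewrite lne_EFin ?(lt_le_trans ltr01)//.
by rewrite max_l// lee_fin ln_ge0.
Qed.

(** For t > 0 the sequence is eventually constant; for t = 0 it is M a, which tends to the infinite
    negative part of log 0. *)
Lemma lne_funeneg_cvg (t a : R) : (0 <= t)%R -> (0 < a)%R ->
  (tlog 0 t - tlog (M%:R * a) t)%:E @[M --> \oo] --> maxe (- lne t%:E) 0.
Proof.
move=> t0 a0; move: t0; rewrite le_eqVlt => /predU1P[<-|t0].
  rewrite le0_lneNy//= max_l ?leey//.
  rewrite (_ : (fun M => _) = (fun M : nat => (M%:R * a)%:E)); last first.
    apply/funext => M; rewrite /tlog !max_r ?expR_ge0//.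
    by rewrite !expRK oppr0 opprK add0r.
  apply/cvgeyPge => B; near=> M; rewrite lee_fin -ler_pdivrMr//.
  by near: M; exact: nbhs_infty_ger.
rewrite lne_EFin// -EFinN -EFin_max; apply: cvg_near_cst.
near=> M; congr EFin.
have -> : tlog (M%:R * a) t = ln t.
  rewrite /tlog max_l// -[leRHS](lnK t0) ler_expR.
  rewrite lerNl -ler_pdivrMr//.
  by near: M; exact: nbhs_infty_ger.
rewrite /tlog oppr0 expR0; have [t1|t1] := leP t 1%R.
  by rewrite ln1 sub0r max_l// oppr_ge0 ln_le0.
by rewrite subrr max_r// oppr_le0 ln_ge0// ltW.
Unshelve. all: by end_near. Qed.

Lemma tlog_diff_ge0 (t a : R) : (0 <= a)%R -> (0 <= tlog 0 t - tlog a t)%R.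
Proof. by move=> a0; rewrite subr_ge0; exact: tlog_anti. Qed.

End LogPositivePart.

Section Transfer.
Context {d : measure_display} {T : measurableType d} {R : realType}
  {X : pointedMetricType R}.
Hypothesis cX : compact [set: X].
Variables (p : probability T R) (P : probability (sequences_in T) R).
Hypothesis bP : is_bernoulli p P.
Variables f0 f : sequences_in T -> X -> X.
Hypothesis gf : good_random_map f.
Hypothesis iY : integ P (loglip f).
Variable N : set (sequences_in T).
Hypothesis mN : measurable N.
Hypothesis PN : P N = 0%E.
Hypothesis f0f : forall w, ~ N w ->
  f0 w = f w /\ forall n, iterate f0 n w = iterate f n w.
Local Notation Om := (sequences_in T).
Variable mu : probability (borel X) R.

Let N2 : set (Om * borel X) := N `*` setT.

Let mN2 : measurable N2. Proof. exact: measurableX. Qed.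

Let PN2 : (P \x mu)%E N2 = 0%E.
Proof. by rewrite /N2 product_measure1E// [X in (X * _)%E]PN mul0e. Qed.

Lemma stationary_transfer :
  measurable_fun setT (fun wx : Om * borel X => f0 wx.1 wx.2 : borel X) ->
  (forall A : set (Om * borel X), measurable A ->
    product_probability P mu (skew_product f @^-1` A) = product_probability P mu A) ->
  stationary P f0 mu.
Proof.
move=> mf0 inv A mA.
have msk : measurable_fun setT (skew_product f0 : Om * borel X -> Om * borel X).
  apply: measurable_fun_pair => //.
  exact: (measurableT_comp (@measurable_seq_shift d T 1) (@measurable_fst _ _ Om (borel X))).
have m0 : measurable (skew_product f0 @^-1` A : set (Om * borel X)).
  by rewrite -[X in measurable X]setTI; exact: msk.
have m1 : measurable (skew_product f @^-1` A : set (Om * borel X)).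
  by rewrite -[X in measurable X]setTI; exact: (measurable_skew gf).
have := inv A mA.
rewrite [X in X = _ -> _](_ : _ = (P \x mu)%E (skew_product f @^-1` A))//.
rewrite [X in _ = X -> _](_ : _ = (P \x mu)%E A)// => <-.
(* Both measures become integrals of indicators, which agree off the null set where f0 and f
   differ. *)
rewrite -[X in (P \x mu)%E X = _]setIT -[X in _ = (P \x mu)%E X]setIT.
rewrite -!integral_indic//.
apply: (@integral_eq_off_null _ _ _ _ N2 _ _ mN2 PN2).
move=> -[w x] Nw; congr EFin; rewrite !indicE; congr (nat_of_bool _)%:R.
have nw : ~ N w by move=> h; apply: Nw; split.
by apply/idP/idP; rewrite !inE /preimage /skew_product /= (f0f nw).1.
Qed.

(** The positive part has the finite integral of [tlog 0]. The negative part is the increasing limit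
    of [tlog 0 - tlog (M * m)], whose integrals exceed that number by at most c, uniformly in M. *)
Lemma integral_lne_ge (c : R) (m : nat) : (0 < m)%N ->
  (forall M : nat, - c <= expect mu (loc_exp P f m (M * m)%:R)) ->
  ((- c)%:E <= \int[P \x mu]_wx lne (local_Lip (iterate f0 m wx.1) wx.2))%E.
Proof.
move=> m0 hc.
pose L (wx : Om * borel X) : R := llip (iterate f m wx.1) wx.2.
have L0 wx : 0 <= L wx by exact: llip_ge0.
have -> : (\int[P \x mu]_wx lne (local_Lip (iterate f0 m wx.1) wx.2) =
    \int[P \x mu]_wx lne (L wx)%:E)%E.
  apply: (@integral_eq_off_null _ _ _ _ N2 _ _ mN2 PN2).
  move=> -[w x] Nw /=; have nw : ~ N w by move=> h; apply: Nw; split.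
  by rewrite (f0f nw).2 local_LipE//; exact: iterate_lip.
have mL : measurable_fun setT L by exact: measurable_llip.
have mt a : measurable_fun setT (fun wx => tlog a (L wx)) by exact: measurable_tlog.
pose J := product_probability P mu.
have iS a : integ J (fun wx => sumlip f m wx.1 + a).
  apply: (@integD _ _ _ J (fun wx => sumlip f m wx.1) (fun _ => a)); last exact: integ_cst.
  exact: (integ_fst mu (integ_sumlip bP iY m)).
have it a : 0 <= a -> integ J (fun wx => tlog a (L wx)).
  move=> a0; apply: integ_dom (iS a) _ => // wx.
  exact: loc_log_norm.
have hcJ M : - c <= expect J (fun wx => tlog (M%:R * m%:R) (L wx)).
  have a0 : 0 <= M%:R * m%:R :> R by rewrite mulr_ge0.
  rewrite /J (expect_fubini2 (it _ a0)).
    by have := hc M; rewrite natrM.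
  by move=> x; have := integ_loc_log cX bP gf iY m x a0.
rewrite integralE.
have -> : (\int[P \x mu]_wx (fun wx => lne (L wx)%:E)^\+ wx =
    (expect J (fun wx => tlog 0 (L wx)))%:E)%E.
  rewrite -expectE; last exact: it.
  by apply: eq_integral => wx _; rewrite funeposE lne_funepos.
have m0' : 0 < m%:R :> R by rewrite ltr0n.
have mono : (\int[P \x mu]_wx (fun wx => lne (L wx)%:E)^\- wx <=
   (expect J (fun wx => tlog 0 (L wx)) + c)%:E)%E.
  pose h (M : nat) (wx : Om * borel X) : \bar R :=
    (tlog 0 (L wx) - tlog (M%:R * m%:R) (L wx))%:E.
  have hE : ((fun wx => lne (L wx)%:E)^\-)%E = (fun wx => limn (h ^~ wx)).
    apply/funext => wx; rewrite funenegE; apply/esym/cvg_lim => //.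
    exact: lne_funeneg_cvg.
  rewrite hE monotone_convergence//; last 3 first.
  - move=> M; apply/measurable_EFinP; exact: measurable_funB.
  - move=> M wx _; rewrite lee_fin; apply: tlog_diff_ge0; exact: mulr_ge0.
  - move=> wx _ M M' MM'; rewrite lee_fin lerD2l lerN2; apply: tlog_anti.
    by rewrite ler_wpM2r// ler_nat.
  have a0 M : 0 <= M%:R * m%:R :> R by rewrite mulr_ge0.
  apply: lime_le.
    apply: ereal_nondecreasing_is_cvgn => M M' MM'; apply: ge0_le_integral => //.
    + move=> wx _; rewrite lee_fin; exact: tlog_diff_ge0.
    + by apply/measurable_EFinP; exact: measurable_funB.
    + by apply/measurable_EFinP; exact: measurable_funB.
    + move=> wx _; rewrite lee_fin lerD2l lerN2; apply: tlog_anti.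
      by rewrite ler_wpM2r// ler_nat.
  apply: nearW => M.
  have -> : (\int[P \x mu]_wx h M wx)%E =
      (expect J (fun wx => tlog 0 (L wx) - tlog (M%:R * m%:R) (L wx)))%:E.
    rewrite -expectE//; apply: (@integB _ _ _ J (fun wx => tlog 0 (L wx))); exact: it.
  rewrite lee_fin (@expectB _ _ _ J (fun wx => tlog 0 (L wx))); try exact: it.
  by rewrite lerD2l lerNl; exact: hcJ.
apply: le_trans (leeB (lexx _) mono).
by rewrite -EFinB lee_fin; lra.
Qed.

(** Every term from n = 1 on is at least -c, so no subadditive convergence theorem is called for. *)
Lemma lyapunov_ge (c : R) : 0 <= c ->
  (forall m M : nat, - (c * m%:R) <= expect mu (loc_exp P f m (M * m)%:R)) ->
  ((- c)%:E <= lyapunov P f0 mu)%E.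
Proof.
move=> c0 hc; rewrite /lyapunov.
set u := fun n : nat => _.
have hu n : (0 < n)%N -> ((- c)%:E <= u n)%E.
  move=> n0; have n0' : 0 < n%:R :> R by rewrite ltr0n.
  have := integral_lne_ge n0 (hc n).
  rewrite /u -(lee_pmul2l _ _ (x := n%:R^-1%:E)) ?lte_fin ?invr_gt0//.
  by rewrite -EFinM mulrN mulrCA mulVf ?gt_eqF// mulr1.
have [cu|du] := pselect (cvgn u).
  apply: lime_ge => //; exists 1%N => // n /= n1; exact: hu.
(* limn is 0 on a divergent sequence *)
by rewrite (dvgP du) lee_fin oppr_le0.
Qed.

End Transfer.

(** * Almost sure contraction *)

Section BlockSums.
Context {d : measure_display} {T : measurableType d} {R : realType}.
Variables (p : probability T R) (P : probability (sequences_in T) R).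
Hypothesis bP : is_bernoulli p P.
Local Notation Om := (sequences_in T).

Lemma sum_geometric_le (r : R) n : 0 <= r < 1 -> \sum_(i < n) r ^+ i <= (1 - r)^-1.
Proof.
move=> /andP[r0 r1]; have r1' : 0 < 1 - r by rewrite subr_gt0.
rewrite -[leRHS]mul1r ler_pdivlMr//.
have -> : (\sum_(i < n) r ^+ i) * (1 - r) = 1 - r ^+ n.
  elim: n => [|n ih]; first by rewrite big_ord0 mul0r expr0 subrr.
  by rewrite big_ord_recr /= mulrDl ih exprS; ring.
by rewrite lerBlDr lerDl exprn_ge0.
Qed.

(** The series of the g n has finite expectation, hence is almost surely finite, and it bounds each
    of its terms. *)
Lemma ae_bounded_of_geometric (g : nat -> Om -> R) (r : R) : 0 <= r < 1 ->
  (forall n, integ P (g n)) -> (forall n w, 0 <= g n w) ->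
  (forall n, expect P (g n) <= r ^+ n) ->
  {ae P, forall w, exists C, forall n, g n w <= C}.
Proof.
move=> r01 ig g0 gr.
pose G (w : Om) : \bar R := (\sum_(0 <= n <oo) (g n w)%:E)%E.
have mg n : measurable_fun setT (EFin \o g n).
  by apply/measurable_EFinP; exact: integ_measurable (ig n).
have G0 w : (0 <= G w)%E.
  by apply: nneseries_ge0 => n _ _; rewrite lee_fin.
have mG : measurable_fun setT G.
  apply: (@ge0_emeasurable_sum _ _ _ setT (fun n w => (g n w)%:E) xpredT) => [n w _ _|n _].
    by rewrite lee_fin.
  exact: mg.
have iG : P.-integrable setT G.
  apply/integrableP; split => //.
  have -> : (\int[P]_w `|G w| = \int[P]_w G w)%E.
    by apply: eq_integral => w _; rewrite gee0_abs.
  rewrite /G integral_nneseries//; last by move=> n w _; rewrite lee_fin.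
  apply: (@le_lt_trans _ _ ((1 - r)^-1)%:E); last exact: ltry.
  apply: lime_le.
    apply: is_cvg_nneseries => n _ _; apply: integral_ge0 => w _.
    by rewrite lee_fin.
  apply: nearW => n; rewrite big_mkord.
  apply: (@le_trans _ _ (\sum_(i < n) (r ^+ i)%:E)%E).
    by apply: lee_sum => i _; rewrite expectE// lee_fin.
  by rewrite sumEFin lee_fin; exact: sum_geometric_le.
have [N [mN N0 hN]] := integrable_ae measurableT iG.
exists N; split => // w /= hw; apply: hN => /= h; apply: hw.
have Gfin := h Logic.I; exists (fine (G w)) => n.
rewrite -lee_fin fineK//.
apply: le_trans (nneseries_lim_ge (P := xpredT) (u_ := fun i => (g i w)%:E) n.+1 _); last first.
  by move=> i _ _; rewrite lee_fin.
rewrite big_mkord big_ord_recr /= leeDr//.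
by apply: sume_ge0 => i _; rewrite lee_fin.
Qed.

Section Maximal.
Variables (N : nat) (z : Om -> R).
Hypothesis iz : integ P z.
Hypothesis z_head : forall w w', z (splice N w w') = z w.
Hypothesis Ez : expect P z < 0.

(** The maximum of 0 and the first n block sums, by recursion on the first block: this form compares
    it with its own shift. *)
Fixpoint maxsum (n : nat) (w : Om) : R :=
  if n is m.+1 then Num.max 0 (z w + maxsum m (seq_shift N w)) else 0.

Definition blocksum (n : nat) (w : Om) : R :=
  \sum_(k < n) z (seq_shift (N * k) w).

Lemma blocksumS n w : blocksum n.+1 w = z w + blocksum n (seq_shift N w).
Proof.
rewrite /blocksum big_ord_recl muln0 seq_shift0; congr (_ + _).
by apply: eq_bigr => k _; rewrite lift0 seq_shiftD mulnS.
Qed.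

Let maxsum_ge0 n w : 0 <= maxsum n w.
Proof. by case: n => [|n] //=; rewrite le_max lexx. Qed.

Let maxsum_leS n w : maxsum n w <= maxsum n.+1 w.
Proof.
elim: n w => [|n ih] w; first exact: maxsum_ge0.
rewrite [leLHS]/= [leRHS]/= ge_max !le_max lexx /= lerD2l.
by rewrite [X in _ || X](ih (seq_shift N w)) orbT.
Qed.

Let maxsum_mono m n w : (m <= n)%N -> maxsum m w <= maxsum n w.
Proof.
elim: n => [|n ih]; first by rewrite leqn0 => /eqP->.
rewrite leq_eqVlt => /predU1P[->//|]; rewrite ltnS => /ih h.
exact: le_trans h (maxsum_leS n w).
Qed.

Let blocksum_le n w : blocksum n w <= maxsum n w.
Proof.
elim: n w => [|n ih] w; first by rewrite /blocksum big_ord0.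
by rewrite blocksumS /= le_max lerD2l ih orbT.
Qed.

Let integ_maxsum n : integ P (maxsum n).
Proof.
elim: n => [|n ih]; first exact: integ_cst.
apply: integ_max; first exact: integ_cst.
by apply: integD => //; exact: (integ_shift bP).
Qed.

Let unb := [set w | forall C : R, exists n, C < maxsum n w].

Let mI : measurable unb.
Proof.
have -> : unb = \bigcap_j \bigcup_n [set w | j%:R < maxsum n w].
  apply/seteqP; split => w.
    by move=> h j _; have [n hn] := h j%:R; exists n.
  move=> h C; have [n _ /= hn] := h (Num.truncn C).+1 Logic.I.
  by exists n; apply: lt_trans hn; exact: truncnS_gt.
apply: bigcapT_measurable => j; apply: bigcupT_measurable => n.
have := integ_measurable (integ_maxsum n).
move=> /(_ measurableT `]j%:R, +oo[%classic (measurable_itv _)); rewrite setTI.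
by congr measurable; apply/seteqP; split => w /=; rewrite in_itv /= andbT.
Qed.

Let I_shift w : unb (seq_shift N w) <-> unb w.
Proof.
split=> h C.
  have [n hn] := h (C - z w); exists n.+1 => /=.
  by rewrite lt_max -ltrBlDl hn orbT.
have [n hn] := h (Num.max 0 (C + z w)); exists n.
have := lt_le_trans hn (maxsum_leS n w).
rewrite /= lt_max !gt_max ltxx /= => /andP[_].
by rewrite addrC ltrD2l.
Qed.

Let indic_I_shift w : \1_unb (seq_shift N w) = \1_unb w :> R.
Proof.
rewrite !indicE; congr (nat_of_bool _)%:R.
by apply/idP/idP; rewrite !inE; [move=> /(I_shift w).1|move=> /(I_shift w).2].
Qed.

Let indic01 w : 0 <= (\1_unb w : R) <= 1.
Proof. by rewrite indicE; case: (_ \in _); rewrite ?lexx ?ler01. Qed.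

Let integ_mul_indic (g : Om -> R) : integ P g -> integ P (fun w => g w * \1_unb w).
Proof.
move=> gi; apply: integ_dom (integ_norm gi) _.
  by apply: measurable_funM => //; exact: (integ_measurable gi).
move=> w; rewrite normrM; have /andP[a b] := indic01 w.
by rewrite (ger0_norm a) ler_piMr.
Qed.

(** The event is invariant under the shift by N, so it is decided by the symbols from N on, whereas
    z reads only the first N: they are independent. *)
Let Ez_indic : expect P (fun w => z w * \1_unb w) = expect P z * fine (P unb).
Proof.
have e w w' : z (splice N w w') * \1_unb (splice N w w') = z w * \1_unb w'.
  by rewrite z_head -indic_I_shift seq_shift_splice.
have iI : integ P (\1_unb : Om -> R) by exact: integrable_indic.
rewrite (expect_splice bP (k := N)); last 2 first.
- exact: integ_mul_indic.
- move=> w; rewrite (_ : (fun w' => _) = (fun w' => z w * \1_unb w')); first exact: integZ.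
  by apply/funext => w'; exact: e.
rewrite mulrC -expectZ//; congr expect; apply/funext => w.
rewrite (_ : (fun w' => _) = (fun w' => z w * \1_unb w')); last first.
  by apply/funext => w'; exact: e.
by rewrite expectZ// mulrC; congr (_ * _); rewrite -(expect_indic P mI).
Qed.

(* Garsia's argument: on the invariant event [unb], where the running maximum is
   unbounded, [maxsum n.+1 - maxsum n \o shift] tends to [z], and its integral
   over [unb] is nonnegative because the maxima increase. *)
Let Ez_indic_ge0 : 0 <= expect P (fun w => z w * \1_unb w).
Proof.
pose dn n w := (maxsum n.+1 w - maxsum n (seq_shift N w)) * \1_unb w.
have idn n : integ P (dn n).
  apply: integ_mul_indic; apply: integB; first exact: integ_maxsum.
  exact: (integ_shift bP).
have dnE n w : dn n w = Num.max (- maxsum n (seq_shift N w)) (z w) * \1_unb w.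
  rewrite /dn /=; congr (_ * _); set M := maxsum _ _.
  by rewrite /Num.max; case: ifPn; case: ifPn; rewrite -?leNgt => *; lra.
have Edn n : 0 <= expect P (dn n).
  have -> : expect P (dn n) = expect P (fun w => maxsum n.+1 w * \1_unb w) -
      expect P (fun w => maxsum n w * \1_unb w).
    rewrite -[X in _ - X](expect_shift bP N); last exact: integ_mul_indic.
    rewrite -expectB; last 2 first.
    - exact: integ_mul_indic.
    - exact: (integ_shift bP N (integ_mul_indic (integ_maxsum n))).
    by congr expect; apply/funext => w; rewrite /dn indic_I_shift mulrBl.
  rewrite subr_ge0; apply: expect_le => [||w]; try exact: integ_mul_indic.
  by rewrite ler_wpM2r//; have /andP[] := indic01 w.
have : expect P (dn n) @[n --> \oo] --> expect P (fun w => z w * \1_unb w).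
  apply: (expect_cvg (g := fun w => `|z w|)).
  - by move=> n; exact: integ_measurable.
  - exact: integ_norm.
  - move=> n w; rewrite dnE normrM; have /andP[a b] := indic01 w.
    rewrite (ger0_norm a) -[leRHS]mulr1; apply: ler_pM => //.
    have := maxsum_ge0 n (seq_shift N w); set M := maxsum _ _ => M0.
    rewrite ler_norml le_max ge_max.
    have := ler_norm (z w); have := ler_norm (- z w); rewrite normrN => h1 h2.
    by apply/andP; split; [apply/orP; right; lra|apply/andP; split; lra].
  - move=> w; have [Iw|Iw] := pselect (unb w); last first.
      rewrite indicE memNset// mulr0; apply: cvg_near_cst; apply: nearW => n.
      by rewrite dnE indicE memNset// mulr0.
    have Isw := (I_shift w).2 Iw; have [n hn] := Isw (- z w).
    apply: cvg_near_cst; exists n => // m /= nm; rewrite dnE; congr (_ * _).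
    apply/max_idPr; rewrite lerNl.
    exact: le_trans (ltW hn) (maxsum_mono _ nm).
by move=> /cvgr_to_ge; apply; apply: nearW.
Qed.

(** The product of the negative mean of z and the probability of [unb] is nonnegative, so [unb] is
    null. *)
Lemma ae_blocksum_bounded : {ae P, forall w, exists C, forall n, blocksum n w <= C}.
Proof.
exists unb; split => //.
  have := Ez_indic_ge0; rewrite Ez_indic nmulr_rge0// => h.
  have : P unb = (fine (P unb))%:E by rewrite fineK// fin_num_measure.
  move=> ->; congr EFin; apply/eqP; rewrite eq_le h /=.
  by rewrite fine_ge0.
move=> w /= hw C; apply: contrapT => /forallNP h; apply: hw; exists C => n.
by apply: le_trans (blocksum_le n w) _; rewrite leNgt; apply/negP/h.
Qed.

End Maximal.

End BlockSums.

(** From exp(-t) >= 1 - t one gets exp t <= 1 / (1 - t), and (1 + t + 2 t^2)(1 - t) = 1 + t^2 (1 - 2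
    t) is at least 1 for t <= 1 / 2. *)
Lemma expR_quadratic {R : realType} (t : R) : `|t| <= 2^-1 ->
  expR t <= 1 + t + 2 * t ^+ 2.
Proof.
rewrite ler_norml => /andP[tl tu].
have h := expR_ge1Dx (- t); have t1 : 0 < 1 - t by lra.
have e1 : expR t * (1 - t) <= 1.
  by rewrite -[leRHS](expRxMexpNx_1 t) ler_wpM2l ?expR_ge0.
rewrite -(ler_pM2r t1); apply: le_trans e1 _.
have := sqr_ge0 t; set s := t ^+ 2 => s0.
have -> : (1 + t + 2 * s) * (1 - t) = 1 + s * (1 - 2 * t) by rewrite /s; ring.
by rewrite lerDl mulr_ge0//; lra.
Qed.

Section Contraction.
Context {d : measure_display} {T : measurableType d} {R : realType}
  {X : pointedMetricType R}.
Hypothesis cX : compact [set: X].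
Variables (p : probability T R) (P : probability (sequences_in T) R).
Hypothesis bP : is_bernoulli p P.
Variable f : sequences_in T -> X -> X.
Hypothesis gf : good_random_map f.
Hypothesis iY : integ P (loglip f).
Local Notation Om := (sequences_in T).

(** A ball that works at x contains all balls of less than half its radius centred within half its
    radius of x; compactness then gives one radius for all points. *)
Lemma uniform_radius N a c : 0 <= a ->
  (forall x, loc_exp P f N a x < - c) ->
  exists2 r, 0 < r & forall x, ball_exp P f N a r x <= - c.
Proof.
move=> a0 h.
have [n _ hn] : \forall n \near \oo, [set: X] `<=`
    (fun x => ball_exp P f N a (rad n) x <= - c).
  move/compact_near_coveringP : cX; apply => x _.
  have [r r0 hr] := ball_exp_lt cX bP gf iY a0 (h x).
  have r20 : 0 < r / 2 by rewrite divr_gt0.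
  exists (ball x (r / 2), [set n | rad n < r / 2]) => /=.
    by split; [exact: nbhsx_ballx|exact: rad_small].
  move=> [z k] /= [xz kr]; apply: le_trans (ltW hr).
  apply: (ball_exp_sub cX bP gf iY) => // y.
  move: xz; rewrite !ballEmdist /= => xz zy.
  by have := metric_triangle x z y; lra.
exists (rad n); first exact: rad_gt0.
by move=> x; exact: hn (leqnn n) _ _.
Qed.

Lemma iterate_mdist_le n w x y :
  mdist (iterate f n w x) (iterate f n w y) <= expR (sumlip f n w) * mdist x y.
Proof.
have [_ h] := lipc_bound setT (iterate_lip gf n w).
apply: le_trans (h x y Logic.I Logic.I) _.
by rewrite ler_wpM2r ?mdist_ge0//; exact: lipc_iterate_le.
Qed.

Lemma sumlip_mono m n w : (m <= n)%N -> sumlip f m w <= sumlip f n w.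
Proof.
move=> mn; rewrite -(subnKC mn) /sumlip big_split_ord /= lerDl.
by apply: sumr_ge0 => i _; exact: loglip_ge0.
Qed.

Section Blocks.
Variable N : nat.
Hypothesis N0 : (0 < N)%N.

Definition orbit_sum (b : Om -> X -> R) (n : nat) (w : Om) (x : X) : R :=
  \sum_(k < n) b (seq_shift (N * k) w) (iterate f (N * k) w x).

Lemma orbit_sumS b n w x : orbit_sum b n.+1 w x =
  b w x + orbit_sum b n (seq_shift N w) (iterate f N w x).
Proof.
rewrite /orbit_sum big_ord_recl muln0 seq_shift0; congr (_ + _).
apply: eq_bigr => k _; rewrite lift0 seq_shiftD mulnS.
by rewrite iterateD.
Qed.

Section ExponentialMoment.
Variables (b : Om -> X -> R) (B r1 : R).
Hypothesis mb : measurable_fun setT (fun wx : Om * borel X => b wx.1 wx.2).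
Hypothesis bB : forall w x, `|b w x| <= B.
Hypothesis b_head : forall w w' x, b (splice N w w') x = b w x.
Hypothesis br : forall x, expect P (fun w => expR (b w x)) <= r1.
Hypothesis r10 : 0 <= r1.

Lemma integ_exp_orbit_sum n x : integ P (fun w => expR (orbit_sum b n w x)).
Proof.
apply: (@integ_bounded _ _ _ P _ (expR (n%:R * B))).
  apply: (measurableT_comp (@measurable_expR R)).
  rewrite /orbit_sum; apply: measurable_sum => k.
  have mg : measurable_fun setT (fun w : Om =>
      (seq_shift (N * k) w, iterate f (N * k) w x) : Om * borel X).
    apply: measurable_fun_pair; first exact: measurable_seq_shift.
    exact: (measurable_iterate_at gf).
  exact: (measurableT_comp mb mg).
move=> w; rewrite ger0_norm ?expR_ge0// ler_expR.
apply: le_trans (ler_norm _) _; apply: le_trans (ler_norm_sum _ _ _) _.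
rewrite mulr_natl -[X in _ *+ X](card_ord n) -sumr_const.
by apply: ler_sum => k _; exact: bB.
Qed.

(** Condition on the first block: the rest is the same sum from another starting point, and the
    induction hypothesis is uniform in that point. *)
Lemma expect_exp_orbit_sum n x : expect P (fun w => expR (orbit_sum b n w x)) <= r1 ^+ n.
Proof.
elim: n x => [|n ih] x.
  rewrite (_ : (fun w => _) = (fun _ => 1)); first by rewrite expect_cst expr0.
  by apply/funext => w; rewrite /orbit_sum big_ord0 expR0.
have e w w' : expR (orbit_sum b n.+1 (splice N w w') x) =
    expR (b w x) * expR (orbit_sum b n w' (iterate f N w x)).
  by rewrite orbit_sumS b_head seq_shift_splice (iterate_splice gf)// expRD.
have sect w : integ P (fun w' => expR (orbit_sum b n.+1 (splice N w w') x)).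
  rewrite (_ : (fun w' => _) = fun w' => expR (b w x) * expR (orbit_sum b n w' (iterate f N w x))).
    by apply: integZ; exact: integ_exp_orbit_sum.
  by apply/funext => w'; exact: e.
have i1 := integ_exp_orbit_sum n.+1 x.
rewrite (expect_splice bP i1 sect).
have ib : integ P (fun w => expR (b w x)).
  have := integ_exp_orbit_sum 1 x; congr integ; apply/funext => w.
  by rewrite orbit_sumS /orbit_sum big_ord0 addr0.
apply: (@le_trans _ _ (expect P (fun w => r1 ^+ n * expR (b w x)))).
  apply: expect_le => [||w].
  - exact: (integ_fubini1 (integ_splice bP N i1) sect).
  - exact: integZ.
  - rewrite (_ : (fun w' => _) = fun w' => expR (b w x) * expR (orbit_sum b n w' (iterate f N w x))); last first.
      by apply/funext => w'; exact: e.
    rewrite expectZ; last exact: integ_exp_orbit_sum.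
    by rewrite mulrC ler_wpM2r ?expR_ge0//; exact: ih.
by rewrite expectZ// exprSr ler_wpM2l ?exprn_ge0//; exact: br.
Qed.

End ExponentialMoment.

Section Drift.
Variables (a c r : R).
Hypothesis a0 : 0 <= a.
Hypothesis c0 : 0 < c.
Hypothesis hr : forall x, ball_exp P f N a r x <= - c.

Definition capped_log (K : R) (w : Om) (x : X) : R := Num.min K (ball_log f N a r w x).

(** For small [th] the exponential of [th] times a bounded variable of negative mean has expectation
    below 1; its orbit products then decay geometrically in mean and are almost surely bounded. *)
Lemma ae_capped_sum (K : R) x : 0 <= K ->
  {ae P, forall w, exists C, forall n,
    orbit_sum (capped_log K) n w x <= C - n%:R * (c / 4)}.
Proof.
move=> K0; pose B := a + K + c.
have B0 : 0 < B by rewrite ltr_wpDl// addr_ge0.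
(* makes the quadratic error 2 th^2 B^2 a third of the drift 3/4 th c *)
pose th := c / (8 * B ^+ 2).
have th0 : 0 < th by rewrite divr_gt0// mulr_gt0// exprn_gt0.
(* Adding c / 4 builds the claimed drift into the summands, which keep mean at most -3 c / 4. *)
pose xi w x := capped_log K w x + c / 4.
have xiB w y : `|xi w y| <= B.
  have := tlog_ge a (lipc (ball y r) (iterate f N w)).
  rewrite -/(ball_log f N a r w y) => h.
  rewrite /xi /capped_log /B ler_norml; have := c0; have := a0; have := K0.
  by rewrite /Num.min; case: ifPn; rewrite -?leNgt => *; apply/andP; split; lra.
have thB w y : `|th * xi w y| <= 8^-1.
  rewrite normrM (gtr0_norm th0).
  apply: (@le_trans _ _ (th * B)); first by rewrite ler_wpM2l// ltW.
  rewrite /th (_ : c / (8 * B ^+ 2) * B = (c / B) * 8^-1); last first.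
    by field; rewrite gt_eqF.
  rewrite -[leRHS]mul1r ler_wpM2r// ler_pdivrMr// mul1r /B; have := a0; have := K0; lra.
pose b w y := th * xi w y.
have mxi : measurable_fun setT (fun wx : Om * borel X => xi wx.1 wx.2).
  apply: measurable_funD => //; apply: measurable_minr => //.
  exact: (measurable_tlog a (measurable_ball_lip cX gf N r)).
have mb : measurable_fun setT (fun wx : Om * borel X => b wx.1 wx.2).
  by apply: measurable_funM.
have b_head w w' y : b (splice N w w') y = b w y.
  by rewrite /b /xi /capped_log /ball_log (iterate_splice gf).
have ixi y : integ P (fun w => xi w y).
  apply: (@integ_bounded _ _ _ P _ B) => //.
  have mg : measurable_fun setT (fun w : Om => (w, y) : Om * borel X).
    by apply: measurable_fun_pair.
  exact: (measurableT_comp mxi mg).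
have Exi y : expect P (fun w => xi w y) <= - (3 / 4 * c).
  apply: (@le_trans _ _ (expect P (fun w => ball_log f N a r w y + c / 4))).
    apply: expect_le => [||w]; first exact: ixi.
      by apply: integD; [exact: (integ_ball_log cX bP gf iY)|exact: integ_cst].
    by rewrite lerD2r ge_min lexx orbT.
  rewrite expectD; last 2 first.
  - exact: (integ_ball_log cX bP gf iY).
  - exact: integ_cst.
  by rewrite expect_cst; have := hr y; rewrite /ball_exp; lra.
(* The quadratic bound gives 1 + th c / 4 - 3 th c / 4. *)
pose r1 := 1 - th * c / 2.
have thc : th * c <= 8^-1.
  rewrite /th (_ : c / (8 * B ^+ 2) * c = (c / B) ^+ 2 * 8^-1); last first.
    by field; rewrite gt_eqF.
  rewrite -[leRHS]mul1r ler_wpM2r// expr_le1 ?divr_ge0 ?(ltW c0) ?(ltW B0)//.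
  by rewrite ler_pdivrMr// mul1r /B; have := a0; have := K0; lra.
have thc0 : 0 < th * c by rewrite mulr_gt0.
have r1b : 0 <= r1 < 1 by rewrite /r1; apply/andP; split; lra.
have thB2 : 2 * th ^+ 2 * B ^+ 2 = th * c / 4.
  by rewrite /th; field; rewrite gt_eqF.
have br y : expect P (fun w => expR (b w y)) <= r1.
  apply: (@le_trans _ _ (expect P (fun w => (1 + th * c / 4) + th * xi w y))).
    apply: expect_le => [||w].
    - have := @integ_exp_orbit_sum b 8^-1 mb thB 1 y.
      by congr integ; apply/funext => w; rewrite orbit_sumS /orbit_sum big_ord0 addr0.
    - by apply: integD; [exact: integ_cst|exact: integZ].
    - apply: le_trans (expR_quadratic _) _.
        by apply: le_trans (thB w y) _; lra.
      have : xi w y ^+ 2 <= B ^+ 2.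
        by rewrite -[leLHS]real_normK ?num_real// lerXn2r ?nnegrE ?normr_ge0// ltW.
      move=> hx; have : 2 * th ^+ 2 * xi w y ^+ 2 <= 2 * th ^+ 2 * B ^+ 2.
        by rewrite ler_wpM2l// mulr_ge0// sqr_ge0.
      rewrite thB2 /b => h.
      have -> : 2 * (th * xi w y) ^+ 2 = 2 * th ^+ 2 * xi w y ^+ 2 by ring.
      by lra.
  rewrite expectD; last 2 first.
  - exact: integ_cst.
  - exact: integZ.
  rewrite expect_cst expectZ//.
  have : th * expect P (fun w => xi w y) <= th * (- (3 / 4 * c)) by rewrite ler_wpM2l// ltW.
  by rewrite /r1; lra.
have [r10 _] := andP r1b.
have := @ae_bounded_of_geometric _ _ _ P (fun n w => expR (orbit_sum b n w x)) r1 r1b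
  (fun n => @integ_exp_orbit_sum b 8^-1 mb thB n x) (fun n w => expR_ge0 _)
  (fun n => @expect_exp_orbit_sum b 8^-1 r1 mb thB b_head br r10 n x).
apply: filterS => w [C hC]; exists (C / th) => n.
have e : orbit_sum b n w x = th * (orbit_sum (capped_log K) n w x + n%:R * (c / 4)).
  rewrite /orbit_sum /b -mulr_sumr; congr (_ * _).
  by rewrite /xi big_split /= sumr_const card_ord mulr_natl.
(* A bound C on the exponential bounds its exponent through 1 + t <= exp t; dividing by [th] gives
   the constant. *)
have := hC n; rewrite e => h.
have h2 := le_trans (expR_ge1Dx _) h.
rewrite lerBrDr ler_pdivlMr// mulrC; lra.
Qed.

End Drift.

Lemma exists_cap (e : R) : 0 < e -> exists2 K : R, 0 <= K &
  expect P (fun w => Num.max 0 (sumlip f N w - K)) < e.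
Proof.
move=> e0; have iN := integ_sumlip bP iY N.
have ms := integ_measurable iN.
have : expect P (fun w => Num.max 0 (sumlip f N w - n%:R)) @[n --> \oo] --> expect P (fun _ => 0).
  apply: (expect_cvg (g := sumlip f N)) => //.
  - move=> n; apply: measurable_maxr => //; exact: measurable_funB.
  - move=> n w; have s0 := sumlip_ge0 f N w.
    rewrite ger0_norm; last by rewrite le_max lexx.
    by rewrite ge_max s0 lerBlDr lerDl ler0n.
  - move=> w; apply: cvg_near_cst; near=> n; apply/max_idPl.
    rewrite subr_le0; near: n; exact: nbhs_infty_ger.
rewrite expect_cst => /cvgr_lt /(_ e e0)[n _ hn].
by exists n%:R => //; exact: hn (leqnn n).
Unshelve. all: by end_near. Qed.

Lemma ae_excess_sum (K e : R) : 0 < e ->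
  expect P (fun w => Num.max 0 (sumlip f N w - K)) < e ->
  {ae P, forall w, exists C, forall n, \sum_(k < n)
    (Num.max 0 (sumlip f N (seq_shift (N * k) w) - K) - e) <= C}.
Proof.
move=> e0 he.
pose z (w : Om) := Num.max 0 (sumlip f N w - K) - e.
have im : integ P (fun w => Num.max 0 (sumlip f N w - K)).
  apply: integ_max; first exact: integ_cst.
  by apply: integB; [exact: (integ_sumlip bP iY)|exact: integ_cst].
have iz : integ P z by apply: integB => //; exact: integ_cst.
apply: (@ae_blocksum_bounded _ _ _ p P bP N z iz).
- move=> w w'; rewrite /z (sumlip_head gf (w' := w))// => i iN.
  by rewrite /splice iN.
- rewrite /z expectB//; last exact: integ_cst.
  by rewrite expect_cst subr_lt0.
Qed.

Section OrbitContraction.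
Variables (a r eta C D : R) (w : Om) (x : X).
Hypothesis r0 : 0 < r.
Hypothesis eta0 : 0 < eta.
Hypothesis hC : forall n, orbit_sum (ball_log f N a r) n w x <= C - n%:R * eta.
Hypothesis hD : forall k, sumlip f N (seq_shift (N * k) w) <= D + k%:R * (eta / 2).

(** The block products never exceed exp C, so a point starting within [rho] of x stays within r at
    all block times. *)
Let rho := r * expR (- C).

(** The induction hypothesis itself shows that the two orbits are less than r apart at time N k, so
    the Lipschitz constant on the ball of radius r governs the next block. *)
Let block_contraction k y : ball x rho y ->
  mdist (iterate f (N * k) w x) (iterate f (N * k) w y) <=
  expR (orbit_sum (ball_log f N a r) k w x) * mdist x y.
Proof.
move=> xy; elim: k => [|k ih].
  by rewrite muln0 /= /orbit_sum big_ord0 expR0 mul1r.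
have hk : mdist (iterate f (N * k) w x) (iterate f (N * k) w y) < r.
  apply: le_lt_trans ih _; move: xy; rewrite ballEmdist /= /rho => xy.
  apply: (@le_lt_trans _ _ (expR C * mdist x y)).
    rewrite ler_wpM2r ?mdist_ge0// ler_expR; apply: le_trans (hC k) _.
    by rewrite lerBlDr lerDl mulr_ge0// ltW.
  by rewrite mulrC -ltr_pdivlMr ?expR_gt0// -expRN.
rewrite mulnS addnC !iterateD.
set w' := seq_shift (N * k) w; set u := iterate f (N * k) w x in hk ih *.
set v := iterate f (N * k) w y in hk ih *.
have [_ h] := lipc_bound (ball u r) (iterate_lip gf N w').
have : mdist (iterate f N w' u) (iterate f N w' v) <=
    lipc (ball u r) (iterate f N w') * mdist u v.
  by apply: h; [exact: ballxx|rewrite ballEmdist].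
move=> /le_trans; apply.
rewrite {1}/orbit_sum big_ord_recr /= -/(orbit_sum _ k w x) expRD mulrAC [leRHS]mulrC.
by apply: ler_pM; rewrite ?lipc_ge0 ?mdist_ge0//; exact: expR_tlog_ge.
Qed.

(** After k full blocks the remaining j < N steps expand by at most exp(D + k eta / 2), half of the
    gain k eta. As n / N <= k + 1, a rate eta / (2 N) per step remains, and the extra eta / 2 in the
    constant covers the unfinished block. *)
Lemma orbit_contraction n y : ball x rho y ->
  mdist (iterate f n w x) (iterate f n w y) <=
  rho * expR (D + C + eta / 2) * expR (- (eta / (2 * N%:R))) ^+ n.
Proof.
move=> xy; pose k := (n %/ N)%N; pose j := (n %% N)%N.
have nE : n = (N * k + j)%N by rewrite /k /j mulnC -divn_eq.
have jN : (j < N)%N by rewrite ltn_pmod.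
rewrite [in leLHS]nE !iterateD.
apply: le_trans (iterate_mdist_le _ _ _ _) _.
have s1 : sumlip f j (seq_shift (N * k) w) <= D + k%:R * (eta / 2).
  by apply: le_trans (sumlip_mono _ (ltnW jN)) _; exact: hD.
have s2 : mdist (iterate f (N * k) w x) (iterate f (N * k) w y) <=
    expR (C - k%:R * eta) * rho.
  apply: le_trans (block_contraction k xy) _.
  apply: ler_pM; rewrite ?expR_ge0 ?mdist_ge0 ?ler_expR//.
  by move: xy; rewrite ballEmdist /= => /ltW.
apply: (@le_trans _ _ (expR (D + k%:R * (eta / 2)) * (expR (C - k%:R * eta) * rho))).
  by apply: ler_pM; rewrite ?expR_ge0 ?mdist_ge0 ?ler_expR.
rewrite mulrA -expRD mulrC -expRM_natl -mulrA -expRD.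
have rho0 : 0 <= rho by rewrite mulr_ge0 ?expR_ge0// ltW.
rewrite ler_wpM2l// ler_expR.
have Nr : 0 < N%:R :> R by rewrite ltr0n.
have hn : n%:R * (eta / (2 * N%:R)) <= (k%:R + 1) * (eta / 2).
  rewrite (_ : n%:R * (eta / (2 * N%:R)) = (n%:R / N%:R) * (eta / 2)); last first.
    by field; rewrite gt_eqF.
  rewrite ler_wpM2r ?divr_ge0 ?(ltW eta0)// ler_pdivrMr// natr1 -natrM ler_nat.
  by rewrite {1}nE mulSn mulnC addnC leq_add2r ltnW.
by rewrite mulrN; lra.
Qed.

End OrbitContraction.

End Blocks.

Lemma ae_local_contraction N a c r x : (0 < N)%N -> 0 <= a -> 0 < c -> 0 < r ->
  (forall x, ball_exp P f N a r x <= - c) ->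
  {ae P, forall w, exists rho C, [/\ 0 < rho, 0 < C &
    forall n y, ball x rho y -> mdist (iterate f n w x) (iterate f n w y) <=
      C * expR (- (c / 8 / (2 * N%:R))) ^+ n]}.
Proof.
move=> N0 a0 c0 r0 hr.
(* With eta = c / 8: the net drift c / 4 - c / 16 is at least eta, and c / 16 is the growth eta / 2
   allowed to a single block. *)
have e0 : 0 < c / 16 by rewrite divr_gt0.
have [K K0 hK] := exists_cap N e0.
have h1 := ae_capped_sum a0 c0 hr x K0.
have h2 := ae_excess_sum e0 hK.
move: h1 h2; apply: filterS2 => w [C1 hC1] [C2 hC2].
pose C := Num.max 0 (C1 + C2); pose D := K + C2 + c / 16.
have C0 : 0 <= C by rewrite le_max lexx.
pose m k := Num.max 0 (sumlip f N (seq_shift (N * k) w) - K).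
have hm n : \sum_(k < n) m k <= C2 + n%:R * (c / 16).
  have := hC2 n; rewrite sumrB sumr_const card_ord -mulr_natl.
  by rewrite -/(m _); lra.
have hC n : orbit_sum N (ball_log f N a r) n w x <= C - n%:R * (c / 8).
  (* The block logarithm is at most [sumlip], so what lies above the cap K is at most the excess
     [m k]. *)
  apply: (@le_trans _ _ (orbit_sum N (capped_log N a r K) n w x + \sum_(k < n) m k)).
    rewrite /orbit_sum -big_split /=; apply: ler_sum => k _.
    have := tlog_le_of (lipc_iterate_le gf
      (ball (iterate f (N * k) w x) r) N (seq_shift (N * k) w)) (a := a).
    have := sumlip_ge0 f N (seq_shift (N * k) w).
    rewrite -/(ball_log f N a r (seq_shift (N * k) w) (iterate f (N * k) w x)).
    rewrite /capped_log /m; set L := ball_log _ _ _ _ _ _; set s := sumlip _ _ _.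
    move=> s0 h; have {}h : L <= s by apply: h; lra.
    by rewrite /Num.min /Num.max; case: ifPn; case: ifPn; rewrite -?leNgt => *; lra.
  have CC : C1 + C2 <= C by rewrite le_max lexx orbT.
  have n0 : 0 <= n%:R * c by rewrite mulr_ge0// ltW.
  by have := hC1 n; have := hm n; lra.
have hD k : sumlip f N (seq_shift (N * k) w) <= D + k%:R * (c / 8 / 2).
  have m0 : 0 <= \sum_(i < k) m i.
    by apply: sumr_ge0 => i _; rewrite le_max lexx.
  (* One block's excess is at most the sum through that block; the index k + 1 is the source of c /
     16 in D. *)
  have := hm k.+1; rewrite big_ord_recr /= -natr1 /D.
  have : sumlip f N (seq_shift (N * k) w) - K <= m k by rewrite le_max lexx orbT.
  by lra.
exists (r * expR (- C)), (r * expR (- C) * expR (D + C + c / 8 / 2)); split.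
- by rewrite mulr_gt0// expR_gt0.
- by rewrite !mulr_gt0// expR_gt0.
- move=> n y xy; apply: (orbit_contraction N0 r0 _ hC hD n xy).
  by rewrite divr_gt0.
Qed.

End Contraction.

Lemma diam_image_le {R : realType} {X : pointedMetricType R} (g : X -> X) (x : X)
    (B : set X) (K : R) : (forall y, B y -> mdist (g x) (g y) <= K) ->
  (diam (g @` B) <= (2 * K)%:E)%E.
Proof.
move=> h; apply: ge_ereal_sup => _ [[_ _] [/= [u Bu <-] [v Bv <-]] <-].
rewrite lee_fin /=; apply: le_trans (metric_triangle _ (g x) _) _.
by rewrite metric_sym mulr_natl mulr2n lerD// h.
Qed.

Section Integrability.
Context {d : measure_display} {T : measurableType d} {R : realType}
  {X : pointedMetricType R}.
Hypothesis cX : compact [set: X].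
Variable P : probability (sequences_in T) R.
Variables f0 f : sequences_in T -> X -> X.
Hypothesis gf : good_random_map f.
Variable N : set (sequences_in T).
Hypothesis mN : measurable N.
Hypothesis PN : P N = 0%E.
Hypothesis f0f : forall w, ~ N w -> f0 w = f w.

Lemma integ_loglip : (\int[P]_w maxe (lne (Lip (f0 w))) 0 < +oo)%E ->
  integ P (loglip f).
Proof.
rewrite (@integral_eq_off_null _ _ _ P N _ (fun w => (loglip f w)%:E))//.
  move=> fin; apply/integrableP; split.
    by apply/measurable_EFinP; exact: measurable_loglip.
  rewrite [X in (X < _)%E](_ : _ = \int[P]_w (loglip f w)%:E)%E//.
  by apply: eq_integral => w _; rewrite /= ger0_norm// loglip_ge0.
move=> w Nw; rewrite f0f// /Lip lipcE; last exact: (good_lip gf).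
rewrite lne_funepos ?lipc_ge0//; congr EFin.
by rewrite /tlog /loglip oppr0 expR0 maxC.
Qed.

End Integrability.

Section UniformExponent.
Context {d : measure_display} {T : measurableType d} {R : realType}
  {X : pointedMetricType R}.
Hypothesis cX : compact [set: X].
Variables (p : probability T R) (P : probability (sequences_in T) R).
Hypothesis bP : is_bernoulli p P.
Variables f0 f : sequences_in T -> X -> X.
Hypothesis rf0 : random_map P f0.
Hypothesis gf : good_random_map f.
Hypothesis iY : integ P (loglip f).
Variable N : set (sequences_in T).
Hypothesis mN : measurable N.
Hypothesis PN : P N = 0%E.
Hypothesis f0f : forall w, ~ N w ->
  f0 w = f w /\ forall n, iterate f0 n w = iterate f n w.

Lemma uniform_exponent (c : R) : 0 <= c -> (max_lyapunov P f0 < (- c)%:E)%E ->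
  exists2 n, (0 < n)%N & forall x, loc_exp P f n (n * n)%:R x < - (c * n%:R).
Proof.
move=> c0; apply: contraPP => /forall2NP h.
have hx n : (1 <= n)%N -> exists x, - (c * n%:R) <= loc_exp P f n (n * n)%:R x.
  move=> n1; have [//|/existsNP[x /negP]] := h n.
  by rewrite -leNgt => hx; exists x.
have [mu [mu1 mu2]] := limit_measure cX bP gf iY hx.
have st : stationary P f0 mu.
  apply: (stationary_transfer gf mN PN f0f); first by case: rf0.
  by move=> A mA; exact: (skew_invariant cX bP gf mu1).
apply/negP; rewrite -leNgt.
apply: le_trans (lyapunov_ge cX bP gf iY mN PN f0f c0 mu2) _.
by apply: ereal_sup_ubound; exists mu.
Qed.

End UniformExponent.

(** The supremum may be -oo, so a finite margin has to be chosen. *)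
Lemma lt0_ereal_gap {R : realType} (l : \bar R) : (l < 0)%E ->
  exists2 c : R, 0 < c & (l < (- c)%:E)%E.
Proof.
case: l => [l| |] //; last by exists 1; rewrite ?ltNyr.
by rewrite lte_fin => l0; exists (- l / 2); rewrite ?lte_fin; lra.
Qed.

Unset Implicit Arguments.

Theorem theorem1 (R : realType) (X : pointedMetricType R)
    (d : measure_display) (T : measurableType d)
    (p : probability T R) (P : probability (sequences_in T) R)
    (f : sequences_in T -> X -> X) :
  compact [set: X] ->
  is_bernoulli p P ->
  mostly_contracting P f ->
  exists q : R, q < 1 /\
    forall x : X, {ae P, forall w : sequences_in T,
      exists (B : set X) (C : R), [/\ nbhs x B, 0 < C &
        forall n : nat, (1 <= n)%N ->
          (diam (iterate f n w @` B) <= (C * q ^+ n)%:E)%E]}.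
Proof.
move=> cX bP [rf Lf If lf].
have [h [gh [N [mN PN fh]]]] := random_map_reduction bP rf Lf.
have iY : integ P (loglip h).
  by apply: (integ_loglip cX gh mN PN _ If) => w Nw; have [] := fh w Nw.
have [c c0 hc] := lt0_ereal_gap lf.
have [m m0 hm] := uniform_exponent cX bP rf gh iY mN PN fh (ltW c0) hc.
have mr : 0 < m%:R :> R by rewrite ltr0n.
have cm0 : 0 < c * m%:R by rewrite mulr_gt0.
have [r r0 hr] := uniform_radius cX bP gh iY (ler0n R (m * m)) hm.
(* The block length cancels: this is exp(-c / 16), chosen before x. *)
exists (expR (- (c * m%:R / 8 / (2 * m%:R)))); split.
  by rewrite expR_lt1 oppr_lt0 !divr_gt0// mulr_gt0.
move=> x; have := ae_local_contraction cX bP gh iY x m0 (ler0n R (m * m)) cm0 r0 hr.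
have NN : {ae P, forall w, ~ N w} by exists N; split => // w /= /contrapT.
apply: filterS2 NN => w Nw [rho [C [rho0 C0 hC]]].
exists (ball x rho), (2 * C); split; first exact: nbhsx_ballx.
  by rewrite mulr_gt0.
move=> n _; have [_ /(_ n)->] := fh w Nw.
rewrite -(mulrA 2 C); apply: diam_image_le => y; exact: hC.
Qed.
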